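(* Let $s>0$ and $1\le q\le p<\infty$. Let $f\in B^s_{p,q}(\mathbb R^2)$. Then for a.e. $x\in\mathbb R$ we have $f(x,\cdot)\in B^s_{p,q}(\mathbb R)$.
   Context: Besov spaces. Let $s\in\mathbb R$, $1\le p<\infty$, $1\le q\le\infty$. Fix $(\varphi_j)_{j\ge 0}\subset\mathcal S(\mathbb R^n)$ with $\operatorname{supp}\varphi_0\subset B(0,2)$, $\operatorname{supp}\varphi_j\subset B(0,2^{j+1})\setminus B(0,2^{j-1})$ for $j\ge1$, $|\partial^\alpha\varphi_j|\le c_\alpha 2^{-j|\alpha|}$ for all multi-indices $\alpha$ and all $j$, and $\sum_{j\ge0}\varphi_j=1$. With $\mathcal F$ the Fourier transform, $B^s_{p,q}(\mathbb R^n)$ is the space of tempered distributions $f$ with $\left(\sum_{j\ge0}2^{sjq}\|\mathcal F^{-1}(\varphi_j\mathcal Ff)\|_{L^p(\mathbb R^n)}^q\right)^{1/q}<\infty$ (supremum over $j$ if $q=\infty$); the space does not depend on the choice of $(\varphi_j)$. For $s>0$ one has $B^s_{p,q}(\mathbb R^2)\subset L^p(\mathbb R^2)$, so $f(x,\cdot)$ is a well-defined element of $L^p(\mathbb R)$ for a.e. $x\in\mathbb R$. *)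

(* Defs.v *)
From HB Require Import structures.
From mathcomp Require Import all_boot all_order all_algebra.
From mathcomp Require Export complex.
From mathcomp Require Import all_classical all_reals all_analysis.

Set Implicit Arguments.
Unset Strict Implicit.
Unset Printing Implicit Defensive.
Import Order.TTheory GRing.Theory Num.Theory.
Import numFieldNormedType.Exports.
Import Normc.

Local Open Scope classical_set_scope.
Local Open Scope ring_scope.
Local Open Scope complex_scope.

(* R^n is 'rV[R]_n with its product, i.e., Borel, sigma-algebra. *)
Section rV_measurable.
Variables (R : realType) (n : nat).

Let coords (i : 'I_n) (x : 'rV[R]_n) : R := x ord0 i.

Let rV_set0 : g_sigma_preimage coords set0.
Proof. exact: sigma_algebra0. Qed.

Let rV_setC A : g_sigma_preimage coords A -> g_sigma_preimage coords (~` A).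
Proof. exact: sigma_algebraC. Qed.

Let rV_bigcup (F : (set _)^nat) : (forall i, g_sigma_preimage coords (F i)) ->
  g_sigma_preimage coords (\bigcup_i (F i)).
Proof. exact: sigma_algebra_bigcup. Qed.

HB.instance Definition _ := @isMeasurable.Build default_measure_display
  'rV[R]_n (g_sigma_preimage coords) rV_set0 rV_setC rV_bigcup.

End rV_measurable.

Definition rV_cons (R : realType) (n : nat) (p : measurableTypeR R * 'rV[R]_n) :
  'rV[R]_n.+1 := row_mx (const_mx p.1 : 'rV[R]_1) p.2.

Section lebesgue_rV_cons.
Variables (R : realType) (n : nat).

Lemma rV_cons0 (p : measurableTypeR R * 'rV[R]_n) : rV_cons p ord0 ord0 = p.1.
Proof.
rewrite /rV_cons; have -> : ord0 = lshift n (ord0 : 'I_1) by exact: val_inj.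
by rewrite (row_mxEl (const_mx p.1 : 'rV[R]_1) p.2) mxE.
Qed.

Lemma rV_consS (p : measurableTypeR R * 'rV[R]_n) (i : 'I_n) :
  rV_cons p ord0 (lift ord0 i) = p.2 ord0 i.
Proof.
rewrite /rV_cons; have -> : lift ord0 i = rshift 1 i by exact: val_inj.
by rewrite (row_mxEr (const_mx p.1 : 'rV[R]_1) p.2).
Qed.

Lemma measurable_rV_coord m (i : 'I_m) :
  measurable_fun [set: 'rV[R]_m] (fun x : 'rV[R]_m => x ord0 i).
Proof.
move=> _ Y mY; rewrite setTI; apply: sub_sigma_algebra => /=.
rewrite -bigcup_seq/=; exists i => /=; first by rewrite mem_index_enum.
by exists Y => //; rewrite setTI.
Qed.

Lemma measurable_fun_rV d (T : measurableType d) m (g : T -> 'rV[R]_m) :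
  (forall i, measurable_fun setT (fun t => g t ord0 i)) -> measurable_fun setT g.
Proof.
move=> mg; pose S := [set A : set 'rV[R]_m | measurable (g @^-1` A)].
move=> _ A mA; rewrite setTI; suff : S A by [].
apply: mA => /=; split; first split => /=.
- by rewrite /S /= preimage_set0; exact: measurable0.
- by move=> B; rewrite /S /= setTD preimage_setC; apply: measurableC.
- by move=> F mF; rewrite /S /= preimage_bigcup; apply: bigcupT_measurable.
move=> B; rewrite -bigcup_seq/= => -[i _] [Y mY <-]; rewrite /S /= setTI.
by have := mg i measurableT Y mY; rewrite setTI.
Qed.

Lemma measurable_rV_cons : measurable_fun setT (@rV_cons R n).
Proof.
apply: measurable_fun_rV => i; case: (unliftP ord0 i) => [j|] ->.
- under eq_fun do rewrite rV_consS.
  by apply: measurableT_comp (measurable_rV_coord j) _; exact: measurable_snd.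
- under eq_fun do rewrite rV_cons0.
  exact: measurable_fst.
Qed.

Variable mu : {sigma_finite_measure set 'rV[R]_n -> \bar R}.

Definition lebesgue_rV_cons : set 'rV[R]_n.+1 -> \bar R :=
  pushforward (lebesgue_measure \x mu)%E (@rV_cons R n).

Let lebesgue_rV_cons0 : lebesgue_rV_cons set0 = 0%E.
Proof. by rewrite /lebesgue_rV_cons /pushforward preimage_set0 measure0. Qed.

Let lebesgue_rV_cons_ge0 A : (0 <= lebesgue_rV_cons A)%E.
Proof. by rewrite /lebesgue_rV_cons /pushforward measure_ge0. Qed.

Let mpre A : measurable A -> measurable (@rV_cons R n @^-1` A).
Proof. by move=> mA; rewrite -[X in measurable X]setTI; exact: measurable_rV_cons. Qed.

Let lebesgue_rV_cons_sigma_additive : semi_sigma_additive lebesgue_rV_cons.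
Proof.
move=> F mF tF mUF; rewrite /lebesgue_rV_cons /pushforward preimage_bigcup.
apply: measure_semi_sigma_additive.
- by move=> k; exact: mpre.
- apply/trivIsetP => /= i j _ _ ij; rewrite -preimage_setI.
  by move/trivIsetP : tF => /(_ _ _ _ _ ij) ->//; rewrite preimage_set0.
- by rewrite -preimage_bigcup; exact: mpre.
Qed.

HB.instance Definition _ := isMeasure.Build _ _ _ lebesgue_rV_cons
  lebesgue_rV_cons0 lebesgue_rV_cons_ge0 lebesgue_rV_cons_sigma_additive.

Let split_rV (x : 'rV[R]_n.+1) : measurableTypeR R * 'rV[R]_n :=
  (x ord0 ord0, \row_i x ord0 (lift ord0 i)).

Let split_rVK : cancel split_rV (@rV_cons R n).
Proof.
move=> x; apply/rowP => i.
by case: (unliftP ord0 i) => [j|] ->; rewrite ?rV_consS ?rV_cons0//= mxE.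
Qed.

Let rV_consK : cancel (@rV_cons R n) split_rV.
Proof.
move=> -[a v]; rewrite /split_rV rV_cons0 /=; congr pair.
by apply/rowP => i; rewrite mxE rV_consS.
Qed.

Let measurable_split_rV : measurable_fun setT split_rV.
Proof.
apply: measurable_fun_pair => /=; first exact: measurable_rV_coord.
apply: measurable_fun_rV => i; under eq_fun do rewrite mxE.
exact: measurable_rV_coord.
Qed.

Let lebesgue_rV_cons_sigma_finite : sigma_finite setT lebesgue_rV_cons.
Proof.
have /sigma_finiteP[F [FT ndF Foo]] :=
  sigma_finiteT (@lebesgue_measure R : {sigma_finite_measure set _ -> \bar R}).
have /sigma_finiteP[G [GT ndG Goo]] := sigma_finiteT mu.
exists (fun k => split_rV @^-1` (F k `*` G k)).
  rewrite -preimage_bigcup; apply/esym; rewrite -[RHS](preimage_setT split_rV).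
  congr (_ @^-1` _); apply/seteqP; split => // -[x y] _.
  have : [set: measurableTypeR R] x by []. rewrite FT => -[i _ Fix].
  have : [set: 'rV[R]_n] y by []. rewrite GT => -[j _ Gjy].
  exists (maxn i j) => //; split => /=.
  - by move: x Fix; exact/subsetPset/ndF/leq_maxl.
  - by move: y Gjy; exact/subsetPset/ndG/leq_maxr.
move=> k; have [mF Fk] := Foo k; have [mG Gk] := Goo k; split.
  rewrite -[X in measurable X]setTI; apply: measurable_split_rV => //.
  exact: measurableX.
rewrite /lebesgue_rV_cons /pushforward.
rewrite (_ : _ @^-1` _ = F k `*` G k); last first.
  by rewrite -comp_preimage (_ : _ \o _ = id)//; exact/funext/rV_consK.
by rewrite product_measure1E// lte_mul_pinfty// ge0_fin_numE.
Qed.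

HB.instance Definition _ := Measure_isSigmaFinite.Build _ _ _ lebesgue_rV_cons
  lebesgue_rV_cons_sigma_finite.

End lebesgue_rV_cons.

(* the n-fold product of the Lebesgue measure on R, transported along the    *)
(* bijection rV_cons : R * R^n -> R^(n + 1)                                   *)
Fixpoint lebesgue_rV (R : realType) (n : nat) :
    {sigma_finite_measure set 'rV[R]_n -> \bar R} :=
  match n with
  | 0 => \d_(0 : 'rV[R]_0)
  | m.+1 => lebesgue_rV_cons (lebesgue_rV R m)
  end.

Section complex_functions.
Variables (R : realType) (n : nat).
Implicit Types (f : 'rV[R]_n -> R[i]) (x : 'rV[R]_n).

(* the library norm on 'rV[R]_n is the sup norm *)
Definition euclid_dot (x y : 'rV[R]_n) : R := \sum_(i < n) x ord0 i * y ord0 i.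

Definition euclid_norm x : R := Num.sqrt (euclid_dot x x).

Definition re_fun f : 'rV[R]_n -> R := fun x => complex.Re (f x).

Definition im_fun f : 'rV[R]_n -> R := fun x => complex.Im (f x).

Definition cmeasurable f : Prop :=
  measurable_fun setT (re_fun f) /\ measurable_fun setT (im_fun f).

Definition cintegrable f : Prop :=
  (lebesgue_rV R n).-integrable setT (EFin \o re_fun f) /\
  (lebesgue_rV R n).-integrable setT (EFin \o im_fun f).

Definition cintegral f : R[i] :=
  (\int[lebesgue_rV R n]_x re_fun f x) +i* (\int[lebesgue_rV R n]_x im_fun f x).

Definition cLnorm (p : R) f : \bar R :=
  ('N[lebesgue_rV R n]_(p%:E)[(fun x => (normc (f x))%:E)])%E.

Definition basis_vec (i : 'I_n) : 'rV[R]_n := delta_mx ord0 i.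

Definition cpartial (i : 'I_n) f : 'rV[R]_n -> R[i] := fun x =>
  ('D_(basis_vec i) (re_fun f) x) +i* ('D_(basis_vec i) (im_fun f) x).

(* A multi-index alpha is given by a word [:: i_1; ...; i_k] in which each    *)
(* i occurs alpha_i times, so that |alpha| = k; for smooth functions the      *)
(* order of the letters is irrelevant.                                        *)
Definition cpartials (l : seq 'I_n) f : 'rV[R]_n -> R[i] := foldr cpartial f l.

Definition csmooth f : Prop := forall l : seq 'I_n,
  [/\ continuous (re_fun (cpartials l f)),
      continuous (im_fun (cpartials l f)) &
      forall i x, derivable (re_fun (cpartials l f)) x (basis_vec i) /\
                  derivable (im_fun (cpartials l f)) x (basis_vec i)].

Definition schwartz_norm (N : nat) f : \bar R :=
  ereal_sup [set ((1 + euclid_norm lx.2) ^+ N *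
                  normc (cpartials lx.1 f lx.2))%:E
            | lx in [set lx : seq 'I_n * 'rV[R]_n | (size lx.1 <= N)%N]].

Definition schwartz f : Prop :=
  csmooth f /\ forall N, (schwartz_norm N f < +oo)%E.

Definition cis (t : R) : R[i] := cos t +i* sin t.

(* The normalization of the Fourier transform is immaterial here: only        *)
(* F^-1 (phi_j F T) is used, and the constants cancel.                        *)
Definition fourier f : 'rV[R]_n -> R[i] := fun xi =>
  cintegral (fun x => cis (- euclid_dot x xi) * f x).

Definition ifourier f : 'rV[R]_n -> R[i] := fun x =>
  ((2 * pi) ^- n)%:C * cintegral (fun xi => cis (euclid_dot x xi) * f xi).

End complex_functions.

Section distributions.
Variables (R : realType) (n : nat).

(* Functionals are total on 'rV[R]_n -> R[i]; only their values on Schwartz   *)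
(* functions are meaningful.                                                  *)
Definition functional : Type := ('rV[R]_n -> R[i]) -> R[i].

Implicit Types (T : functional) (f psi : 'rV[R]_n -> R[i]).

Definition tempered T : Prop :=
  (forall (a : R[i]) u v, schwartz u -> schwartz v ->
     T (fun x => a * u x + v x) = a * T u + T v) /\
  (exists (N : nat) (c : R), forall psi, schwartz psi ->
     ((normc (T psi))%:E <= c%:E * schwartz_norm N psi)%E).

Definition dist_mul f T : functional := fun psi => T (fun x => f x * psi x).

Definition dist_fourier T : functional := fun psi => T (fourier psi).

Definition dist_ifourier T : functional := fun psi => T (ifourier psi).

Definition represents f T : Prop :=
  cmeasurable f /\
  forall psi, schwartz psi ->
    cintegrable (fun x => f x * psi x) /\
    T psi = cintegral (fun x => f x * psi x).

(* +oo if T is not given by a function; otherwise the infimum is over a       *)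
(* single value, since representing functions agree almost everywhere.        *)
Definition dist_Lnorm (p : R) T : \bar R :=
  ereal_inf [set cLnorm p f | f in [set f | represents f T]].

End distributions.

Section besov.
Variables (R : realType) (n : nat).
Implicit Types (phi : nat -> 'rV[R]_n -> R[i]) (T : functional R n).

Definition csupport (f : 'rV[R]_n -> R[i]) : set 'rV[R]_n :=
  closure [set x | f x != 0].

Definition euclid_ball (r : R) : set 'rV[R]_n := [set x | euclid_norm x < r].

Definition dyadic_resolution phi : Prop :=
  [/\ forall j, schwartz (phi j),
      csupport (phi 0%N) `<=` euclid_ball 2,
      forall j, csupport (phi j.+1) `<=`
        euclid_ball (2 ^+ j.+2) `\` euclid_ball (2 ^+ j),
      forall l : seq 'I_n, exists c : R, forall j x,
        normc (cpartials l (phi j) x) <= c * 2 ^- (j * size l) &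
      forall x, series (fun j => re_fun (phi j) x) @ \oo --> (1 : R) /\
                series (fun j => im_fun (phi j) x) @ \oo --> (0 : R)].

Definition dyadic_block phi (j : nat) T : functional R n :=
  dist_ifourier (dist_mul (phi j) (dist_fourier T)).

(* the l^q norm over j is the L^q norm of the counting measure on nat         *)
Definition besov_norm phi (s p : R) (q : \bar R) T : \bar R :=
  ('N[counting]_q[(fun j : nat =>
     (2 `^ (s * j%:R))%:E * dist_Lnorm p (dyadic_block phi j T))])%E.

Definition besov phi (s p : R) (q : \bar R) T : Prop :=
  tempered T /\ (besov_norm phi s p q T < +oo)%E.

Definition besov_fun phi (s p : R) (q : \bar R) (f : 'rV[R]_n -> R[i]) : Prop :=
  exists T, represents f T /\ besov phi s p q T.

End besov.

Definition slice (R : realType) (n : nat) (f : 'rV[R]_n.+1 -> R[i]) (x : R) :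
  'rV[R]_n -> R[i] := fun y => f (rV_cons (x, y)).

(* Main.v *)
(* The slices of f have to be controlled by the Littlewood-Paley pieces of f. Let F_j be the function
   representing the j-th block of f on R^2, so that f = sum_j F_j almost everywhere, and let K_k be
   the kernels of the blocks on R. For almost every x the k-th block of f(x,.) is
   h_k = f(x,.) * K_k = sum_j F_j(x,.) * K_k, and the terms with j <= k - 2 vanish because the
   frequency supports are disjoint. Since the K_k are uniformly bounded in L^1, Jensen's inequality
   with geometric weights gives, with b = 2^(sp/2) and U_j(x) the integral of |F_j(x,y)|^p dy,
     integral |h_k|^p <= C sum_(j >= k - 1) b^(j + 1 - k) U_j(x).
   As q/p <= 1, the power q/p is subadditive, and Hardy's inequality reduces the claim to
   sum_j (2^(spj) U_j(x))^(q/p) < +oo for almost every x. This holds because the integrals of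
   2^(spj) U_j are bounded by some A_j with sum_j A_j^(q/p) < +oo, and t^r <= A^r (1 + t/A) for
   r <= 1 bounds the integral of this sum against the finite measure dx / (1 + x^2). *)

From HB Require Import structures.
Require Import Defs.
From mathcomp Require Import all_boot all_order all_algebra.
From mathcomp Require Import zify ring lra.
From mathcomp Require Import all_classical all_reals all_analysis measurable_realfun.

Set Implicit Arguments.
Unset Strict Implicit.
Unset Printing Implicit Defensive.
Import Order.TTheory GRing.Theory Num.Theory.
Import numFieldNormedType.Exports.
Import Normc.

Local Open Scope classical_set_scope.
Local Open Scope ring_scope.
Local Open Scope complex_scope.

(** * Complex-valued functions and their integrals *)

(** A slice of a tempered distribution has no meaning of its own, so the pieces of [f] are tied to
    slices only by testing on tensor products [tens a b]: pairing with [b] in [y] and then with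
    countably many [a] in [x] yields identities for almost every [x], with one null set for all
    indices. This need for countability shapes the test functions, which are carved out of [phi1 0].
    Fourier inversion is proved up to a nonzero constant whose value is never computed; the
    functions [F j] therefore represent the blocks divided by that constant. They are
    near-minimizers in the infimum that defines the norm of a block. In the [L^p] estimates,
    Jensen's and Hölder's inequalities are replaced by [v <= a + a^(1-p) v^p] with [a] left free
    until the pieces have been summed. The choice of [b] splits the smoothness: the weight [2^(spj)]
    is [b^(2j)], where one factor [b] pays for the growth [b^(j+1-k)] lost to the geometric weights
    and the other leaves the geometric decay that Hardy's inequality requires. *)

Section complex_norm.
Variable R : realType.
Implicit Types z w : R[i].

Lemma normc_ge0 z : 0 <= normc z.
Proof. by case: z => a b; exact: sqrtr_ge0. Qed.

Lemma normc_Re z : `|complex.Re z| <= normc z.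
Proof.
by case: z => a b /=; rewrite -sqrtr_sqr ler_wsqrtr// lerDl sqr_ge0.
Qed.

Lemma normc_Im z : `|complex.Im z| <= normc z.
Proof.
by case: z => a b /=; rewrite -sqrtr_sqr ler_wsqrtr// lerDr sqr_ge0.
Qed.

Lemma normc_real (a : R) : normc a%:C = `|a|.
Proof. by rewrite /= expr0n/= addr0 sqrtr_sqr. Qed.

Lemma normc_le z : normc z <= `|complex.Re z| + `|complex.Im z|.
Proof.
case: z => a b /=.
rewrite -[leRHS]ger0_norm ?addr_ge0// -sqrtr_sqr ler_wsqrtr// sqrrD.
by rewrite !real_normK ?num_real// addrAC lerDl mulrn_wge0// mulr_ge0.
Qed.

Lemma normcD z w : normc (z + w) <= normc z + normc w.
Proof. exact: le_normcD. Qed.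

Lemma normcB z w : normc (z - w) <= normc z + normc w.
Proof. by rewrite -(normcN w) normcD. Qed.

Lemma normc_sum (I : Type) (r : seq I) (P : pred I) (F : I -> R[i]) :
  normc (\sum_(i <- r | P i) F i) <= \sum_(i <- r | P i) normc (F i).
Proof.
elim/big_rec2 : _ => [|i x z _ ih]; first by rewrite normc0.
by rewrite (le_trans (normcD _ _))// lerD2l.
Qed.

Lemma normc_cis (t : R) : normc (cis t) = 1.
Proof. by rewrite /= cos2Dsin2 sqrtr1. Qed.

Lemma cReM z w : complex.Re (z * w) =
  complex.Re z * complex.Re w - complex.Im z * complex.Im w.
Proof. by case: z w => a b [c d]. Qed.

Lemma cImM z w : complex.Im (z * w) =
  complex.Re z * complex.Im w + complex.Im z * complex.Re w.
Proof. by case: z w => a b [c d]. Qed.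

Lemma cReD z w : complex.Re (z + w) = complex.Re z + complex.Re w.
Proof. by case: z w => a b [c d]. Qed.

Lemma cImD z w : complex.Im (z + w) = complex.Im z + complex.Im w.
Proof. by case: z w => a b [c d]. Qed.

Lemma complexP z w : complex.Re z = complex.Re w ->
  complex.Im z = complex.Im w -> z = w.
Proof. by case: z w => a b [c d] /= -> ->. Qed.

Lemma normc_eq0 z : (normc z == 0) = (z == 0).
Proof. by apply/eqP/eqP => [/eq0_normc//|->]; rewrite normc0. Qed.

Lemma normc_conj z : normc (conjc z) = normc z.
Proof. by case: z => a b /=; rewrite sqrrN. Qed.

End complex_norm.

Section complex_measurable.
Context d (T : measurableType d) (R : realType).
Implicit Types f g : T -> R[i].

(** [cmeasurable] over an arbitrary measurable type, since products and the real line are needed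
    besides row vectors. Likewise [cintb] and [cint] generalize [cintegrable] and [cintegral], with
    which they agree by conversion on [lebesgue_rV]. *)
Definition cmfun f := measurable_fun setT (fun x => complex.Re (f x)) /\
  measurable_fun setT (fun x => complex.Im (f x)).

Lemma cmfun_cst (a : R[i]) : cmfun (fun=> a).
Proof. by split; exact: measurable_cst. Qed.

Lemma cmfunD f g : cmfun f -> cmfun g -> cmfun (fun x => f x + g x).
Proof.
move=> [f1 f2] [g1 g2]; split.
  by under eq_fun do rewrite cReD; exact: measurable_funD.
by under eq_fun do rewrite cImD; exact: measurable_funD.
Qed.

Lemma cmfunM f g : cmfun f -> cmfun g -> cmfun (fun x => f x * g x).
Proof.
move=> [f1 f2] [g1 g2]; split.
  under eq_fun do rewrite cReM.
  by apply: measurable_funB; exact: measurable_funM.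
under eq_fun do rewrite cImM.
by apply: measurable_funD; exact: measurable_funM.
Qed.

Lemma cmfunN f : cmfun f -> cmfun (fun x => - f x).
Proof.
move=> mf; rewrite (_ : (fun _ => _) = (fun x => -1 * f x)); last first.
  by apply/funext => x; rewrite mulN1r.
exact/cmfunM/mf/cmfun_cst.
Qed.

Lemma cmfunB f g : cmfun f -> cmfun g -> cmfun (fun x => f x - g x).
Proof. by move=> mf mg; exact/cmfunD/cmfunN/mg. Qed.

Lemma cmfun_real (k : T -> R) : measurable_fun setT k -> cmfun (fun x => (k x)%:C).
Proof. by move=> mk; split => //=; exact: measurable_cst. Qed.

Lemma cmfun_sum (I : Type) (r : seq I) (F : I -> T -> R[i]) :
  (forall i, cmfun (F i)) -> cmfun (fun x => \sum_(i <- r) F i x).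
Proof.
move=> mF; elim: r => [|i r ih].
  by under eq_fun do rewrite big_nil; exact: cmfun_cst.
by under eq_fun do rewrite big_cons; exact: cmfunD.
Qed.

Lemma cmfun_normc f : cmfun f -> measurable_fun setT (fun x => normc (f x)).
Proof.
move=> [f1 f2]; rewrite (_ : (fun _ => _) = (fun x =>
    Num.sqrt (complex.Re (f x) ^+ 2 + complex.Im (f x) ^+ 2))); last first.
  by apply/funext => x; case: (f x).
apply: (measurableT_comp (continuous_measurable_fun _)); first exact: sqrt_continuous.
by apply: measurable_funD; exact: measurable_funX.
Qed.

Lemma cmfun_cis (k : T -> R) : measurable_fun setT k -> cmfun (fun x => cis (k x)).
Proof.
move=> mk; split => /=.
  by apply: measurableT_comp mk; apply: continuous_measurable_fun; exact: continuous_cos.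
by apply: measurableT_comp mk; apply: continuous_measurable_fun; exact: continuous_sin.
Qed.

End complex_measurable.

Lemma cmfun_comp (R : realType) d d' (T : measurableType d) (T' : measurableType d')
    (h : T' -> T) (f : T -> R[i]) :
  cmfun f -> measurable_fun setT h -> cmfun (fun x => f (h x)).
Proof.
move=> [f1 f2] mh; split.
  exact: (measurableT_comp f1 mh).
exact: (measurableT_comp f2 mh).
Qed.

Section complex_integral.
Context d (T : measurableType d) (R : realType).
Variable mu : {measure set T -> \bar R}.
Implicit Types f g : T -> R[i].

Definition cintb f :=
  mu.-integrable setT (fun x => (complex.Re (f x))%:E) /\
  mu.-integrable setT (fun x => (complex.Im (f x))%:E).

Definition cint f : R[i] :=
  (\int[mu]_x complex.Re (f x)) +i* (\int[mu]_x complex.Im (f x)).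

Lemma cintb_cmfun f : cintb f -> cmfun f.
Proof.
by move=> [/measurable_int/measurable_EFinP f1 /measurable_int/measurable_EFinP f2].
Qed.

Lemma cintb_le f (g : T -> R) : cmfun f -> mu.-integrable setT (EFin \o g) ->
  (forall x, normc (f x) <= g x) -> cintb f.
Proof.
move=> [f1 f2] ig fg; split.
  apply: le_integrable ig => //; first exact/measurable_EFinP.
  move=> x _ /=; rewrite lee_fin (le_trans (normc_Re _))//.
  by rewrite (le_trans (fg x))// ler_norm.
apply: le_integrable ig => //; first exact/measurable_EFinP.
move=> x _ /=; rewrite lee_fin (le_trans (normc_Im _))//.
by rewrite (le_trans (fg x))// ler_norm.
Qed.

Lemma cintb_normc f : cintb f -> mu.-integrable setT (fun x => (normc (f x))%:E).
Proof.
move=> [f1 f2]; have [m1 m2] := cintb_cmfun (conj f1 f2).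
have := integrableD measurableT (integrable_abse f1) (integrable_abse f2).
apply: le_integrable => //; first by apply/measurable_EFinP/cmfun_normc.
move=> x _ /=; rewrite lee_fin ger0_norm ?normc_ge0//.
by rewrite [leRHS]ger0_norm ?addr_ge0// normc_le.
Qed.

Lemma cintb_lty f : cintb f -> (\int[mu]_x (normc (f x))%:E < +oo)%E.
Proof.
move=> /cintb_normc/integrableP[_]; under eq_integral => x _.
  rewrite gee0_abs; last by rewrite lee_fin normc_ge0.
  over.
by [].
Qed.

Lemma lty_integrable_ge0 (g : T -> R) : measurable_fun setT g -> (forall x, 0 <= g x) ->
  (\int[mu]_x (g x)%:E < +oo)%E -> mu.-integrable setT (EFin \o g).
Proof.
move=> mg g0 goo; apply/integrableP; split; first exact/measurable_EFinP.
under eq_integral => x _ do rewrite gee0_abs ?lee_fin ?g0//.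
by [].
Qed.

Lemma lty_cintb f : cmfun f -> (\int[mu]_x (normc (f x))%:E < +oo)%E -> cintb f.
Proof.
move=> mf foo; apply: (cintb_le mf) (fun=> lexx _).
apply: lty_integrable_ge0 => //; first exact: cmfun_normc.
by move=> x; exact: normc_ge0.
Qed.

Lemma cintbD f g : cintb f -> cintb g -> cintb (fun x => f x + g x).
Proof.
move=> fi gi; apply: (@cintb_le _ (fun x => normc (f x) + normc (g x))).
- by apply: cmfunD; exact: cintb_cmfun.
- exact: (integrableD measurableT (cintb_normc fi) (cintb_normc gi)).
- by move=> x; exact: normcD.
Qed.

Lemma cintbM_bounded f g (M : R) : cintb f -> cmfun g -> (forall x, normc (g x) <= M) ->
  cintb (fun x => g x * f x).
Proof.
move=> fi mg gM; apply: (@cintb_le _ (fun x => M * normc (f x))).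
- by apply: cmfunM => //; exact: cintb_cmfun.
- exact: (integrableZl measurableT M (cintb_normc fi)).
- by move=> x; rewrite normcM ler_wpM2r// normc_ge0.
Qed.

Lemma cintbZ (a : R[i]) f : cintb f -> cintb (fun x => a * f x).
Proof. by move=> fi; apply: (cintbM_bounded fi); [exact: cmfun_cst|move=> x; exact: lexx]. Qed.

Lemma cintbN f : cintb f -> cintb (fun x => - f x).
Proof.
move=> fi; rewrite (_ : (fun _ => _) = (fun x => -1 * f x)); last first.
  by apply/funext => x; rewrite mulN1r.
exact: cintbZ.
Qed.

Lemma cintbB f g : cintb f -> cintb g -> cintb (fun x => f x - g x).
Proof. by move=> fi gi; exact/cintbD/cintbN. Qed.

Lemma cintb0 : cintb (fun=> 0).
Proof. by split; exact: integrable0. Qed.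

Lemma cintb_sum (I : Type) (r : seq I) (F : I -> T -> R[i]) :
  (forall i, cintb (F i)) -> cintb (fun x => \sum_(i <- r) F i x).
Proof.
move=> iF; elim: r => [|i r ih].
  by under eq_fun do rewrite big_nil; exact: cintb0.
by under eq_fun do rewrite big_cons; exact: cintbD.
Qed.

Lemma eq_cint f g : f =1 g -> cint f = cint g.
Proof. by move=> /funext ->. Qed.

Lemma cintD f g : cintb f -> cintb g ->
  cint (fun x => f x + g x) = cint f + cint g.
Proof.
move=> [f1 f2] [g1 g2]; apply: complexP; rewrite /cint /=.
  by under eq_Rintegral do rewrite cReD; rewrite RintegralD.
by under eq_Rintegral do rewrite cImD; rewrite RintegralD.
Qed.

Lemma cintZ (a : R[i]) f : cintb f -> cint (fun x => a * f x) = a * cint f.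
Proof.
move=> [f1 f2]; apply: complexP; rewrite /cint ?cReM ?cImM /=.
  under eq_Rintegral do rewrite cReM.
  rewrite RintegralB//; [|exact: (integrableZl measurableT _ f1)|
    exact: (integrableZl measurableT _ f2)].
  by rewrite !RintegralZl.
under eq_Rintegral do rewrite cImM.
rewrite RintegralD//; [|exact: (integrableZl measurableT _ f2)|
  exact: (integrableZl measurableT _ f1)].
by rewrite !RintegralZl.
Qed.

Lemma cintN f : cintb f -> cint (fun x => - f x) = - cint f.
Proof.
by move=> fi; rewrite -mulN1r -cintZ//; apply: eq_cint => x; rewrite mulN1r.
Qed.

Lemma cintB f g : cintb f -> cintb g ->
  cint (fun x => f x - g x) = cint f - cint g.
Proof. by move=> fi gi; rewrite cintD ?cintN//; exact: cintbN. Qed.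

Lemma cint0 : cint (fun=> 0) = 0.
Proof. by apply: complexP; rewrite /cint/= /Rintegral integral0. Qed.

Lemma cint_sum (I : Type) (r : seq I) (F : I -> T -> R[i]) :
  (forall i, cintb (F i)) ->
  cint (fun x => \sum_(i <- r) F i x) = \sum_(i <- r) cint (F i).
Proof.
move=> iF; elim: r => [|i r ih].
  by rewrite big_nil; under eq_fun do rewrite big_nil; exact: cint0.
rewrite big_cons -ih -cintD//; last exact: cintb_sum.
by under eq_fun do rewrite big_cons.
Qed.

(** The factor 2 comes from estimating the real and imaginary parts separately; every use tolerates
    a constant. *)
Lemma cint_normc_le f : cintb f ->
  ((normc (cint f))%:E <= 2%:E * \int[mu]_x (normc (f x))%:E)%E.
Proof.
move=> fi; have [f1 f2] := fi; have nfi := cintb_normc fi.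
rewrite -[X in (_ * X)%E]fineK; last exact: integrable_fin_num.
rewrite -EFinM lee_fin (le_trans (normc_le _))//= mulr2n mulrDl mul1r.
by apply: lerD; apply: (le_trans (le_normr_Rintegral _ _)) => //;
  apply: le_Rintegral => //; [exact: integrable_norm|move=> x _; exact: normc_Re|
    exact: integrable_norm|move=> x _; exact: normc_Im].
Qed.

Lemma cint_normc_le_bound f (g : T -> R) : cmfun f ->
  mu.-integrable setT (EFin \o g) -> (forall x, normc (f x) <= g x) ->
  normc (cint f) <= 2 * \int[mu]_x g x.
Proof.
move=> mf ig fg; have fi := cintb_le mf ig fg.
rewrite -lee_fin (le_trans (cint_normc_le fi))// EFinM lee_wpmul2l//.
rewrite /Rintegral fineK; last exact: integrable_fin_num.
apply: le_integral => //; first exact: cintb_normc.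
by move=> x _; rewrite lee_fin.
Qed.

Lemma ae_eq_cint f g : cmfun f -> cmfun g -> {ae mu, forall x, f x = g x} ->
  cint f = cint g.
Proof.
move=> [f1 f2] [g1 g2] fg; rewrite /cint /Rintegral; congr (fine _ +i* fine _);
  apply: ae_eq_integral => //; try exact/measurable_EFinP;
  by apply: filterS fg => x -> _.
Qed.

Lemma ae_cintb f g : cmfun g -> {ae mu, forall x, f x = g x} -> cintb f -> cintb g.
Proof.
move=> mg fg fi; apply: (lty_cintb mg); have mf := cintb_cmfun fi.
apply: le_lt_trans (cintb_lty fi); apply: ae_ge0_le_integral => //.
- by move=> x _; rewrite lee_fin normc_ge0.
- by apply/measurable_EFinP; exact: cmfun_normc.
- by move=> x _; rewrite lee_fin normc_ge0.
- by apply/measurable_EFinP; exact: cmfun_normc.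
- by apply: filterS fg => x -> _.
Qed.

(** Limits in [R[i]] are expressed by [normc] and epsilon; dominated convergence is applied to the
    two real components. *)
Lemma cint_dominated (F : nat -> T -> R[i]) f (g : T -> R) :
  (forall n, cmfun (F n)) -> cmfun f ->
  mu.-integrable setT (EFin \o g) ->
  {ae mu, forall x, forall e, 0 < e -> \forall n \near \oo, normc (F n x - f x) <= e} ->
  (forall n, {ae mu, forall x, normc (F n x) <= g x}) ->
  cintb f /\ forall e, 0 < e -> \forall n \near \oo,
    normc (cint (F n) - cint f) <= e.
Proof.
move=> mF [mf1 mf2] ig Ff Fg.
have Fg' : {ae mu, forall x n, normc (F n x) <= g x} by exact/ae_foralln.
have cre : {ae mu, forall x, setT x -> (fun n => (complex.Re (F n x))%:E) @ \oo -->
    (complex.Re (f x))%:E}.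
  apply: filterS Ff => x Ffx _; apply/cvg_EFin; first by near=> n.
  apply/cvgrPdist_le => e e0; near=> n.
  rewrite distrC -(_ : complex.Re (F n x - f x) = complex.Re (F n x) - complex.Re (f x)).
    by apply: (le_trans (normc_Re _)); near: n; exact: Ffx.
  by case: (F n x) (f x) => ? ? [].
have cim : {ae mu, forall x, setT x -> (fun n => (complex.Im (F n x))%:E) @ \oo -->
    (complex.Im (f x))%:E}.
  apply: filterS Ff => x Ffx _; apply/cvg_EFin; first by near=> n.
  apply/cvgrPdist_le => e e0; near=> n.
  rewrite distrC -(_ : complex.Im (F n x - f x) = complex.Im (F n x) - complex.Im (f x)).
    by apply: (le_trans (normc_Im _)); near: n; exact: Ffx.
  by case: (F n x) (f x) => ? ? [].
have [|||||i1 _ c1] := @dominated_convergence _ _ _ mu setT measurableT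
  (fun n x => (complex.Re (F n x))%:E) (fun x => (complex.Re (f x))%:E) (EFin \o g).
- by move=> n; apply/measurable_EFinP; exact: (mF n).1.
- exact/measurable_EFinP.
- exact: cre.
- by [].
- by apply: filterS Fg' => x h n _; rewrite lee_fin (le_trans (normc_Re _)).
have [|||||i2 _ c2] := @dominated_convergence _ _ _ mu setT measurableT
  (fun n x => (complex.Im (F n x))%:E) (fun x => (complex.Im (f x))%:E) (EFin \o g).
- by move=> n; apply/measurable_EFinP; exact: (mF n).2.
- exact/measurable_EFinP.
- exact: cim.
- by [].
- by apply: filterS Fg' => x h n _; rewrite lee_fin (le_trans (normc_Im _)).
split => // e e0.
have fc (u : (\bar R)^nat) l : l \is a fin_num -> u @ \oo --> l ->
    forall e, 0 < e -> \forall n \near \oo, `|fine (u n) - fine l| <= e.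
  move=> lf ul e' e'0; move: ul; rewrite -{1}(fineK lf) => /fine_cvgP[_ /cvgrPdist_le/(_ _ e'0)].
  by apply: filterS => n; rewrite distrC.
have e20 : 0 < e / 2 by rewrite divr_gt0.
have h1 := fc _ _ (integrable_fin_num measurableT i1) c1 _ e20.
have h2 := fc _ _ (integrable_fin_num measurableT i2) c2 _ e20.
near=> n; rewrite (le_trans (normc_le _))// [leRHS]splitr; apply: lerD.
  by near: n; exact: h1.
by near: n; exact: h2.
Unshelve. all: by end_near. Qed.

End complex_integral.

(** * Change of variables under an image measure *)

Section complex_pushforward.
Context d1 d2 (X : measurableType d1) (Y : measurableType d2) (R : realType).
Variables (phi : X -> Y) (mphi : measurable_fun setT phi).
Variables (mu : {measure set X -> \bar R}) (nu : {measure set Y -> \bar R}).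
Hypothesis nuE : forall A, measurable A -> nu A = mu (phi @^-1` A).

(** [nu] is only assumed to agree with the image of [mu] on measurable sets, so that one change of
    variables serves translations, dilations, reflections and the identification of R x R^n with
    R^(n+1). *)
Lemma ge0_integral_image (f : Y -> \bar R) : measurable_fun setT f ->
  (forall y, 0 <= f y)%E -> (\int[nu]_y f y = \int[mu]_x f (phi x))%E.
Proof.
move=> mf f0; rewrite -(@ge0_integral_pushforward _ _ _ _ _ phi mphi mu setT f)//.
by apply: eq_measure_integral => A mA _; rewrite nuE.
Qed.

Lemma integrable_image (f : Y -> \bar R) : measurable_fun setT f ->
  nu.-integrable setT f <-> mu.-integrable setT (f \o phi).
Proof.
move=> mf; have e : (\int[nu]_y `|f y| = \int[mu]_x `|f (phi x)|)%E.
  by rewrite -(@ge0_integral_image (fun y => `|f y|%E))//; exact: measurableT_comp.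
split=> /integrableP[_ foo]; apply/integrableP; split => //.
- exact: measurableT_comp.
- by rewrite -e.
- by rewrite e.
Qed.

Lemma integral_image (f : Y -> \bar R) : measurable_fun setT f ->
  (\int[nu]_y f y = \int[mu]_x f (phi x))%E.
Proof.
move=> mf; rewrite [LHS]integralE [RHS]integralE; congr (_ - _)%E.
  rewrite (ge0_integral_image (measurable_funepos mf) (funepos_ge0 f)).
  by apply: eq_integral => x _; have /(congr1 (@^~ x)) := funepos_comp f phi.
rewrite (ge0_integral_image (measurable_funeneg mf) (funeneg_ge0 f)).
by apply: eq_integral => x _; have /(congr1 (@^~ x)) := funeneg_comp f phi.
Qed.

Lemma cintb_image (f : Y -> R[i]) : cmfun f ->
  cintb nu f <-> cintb mu (fun x => f (phi x)).
Proof.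
move=> [/measurable_EFinP f1 /measurable_EFinP f2].
have h1 := integrable_image f1; have h2 := integrable_image f2.
by split=> -[i1 i2]; split; [exact: h1.1|exact: h2.1|exact: h1.2|exact: h2.2].
Qed.

Lemma cint_image (f : Y -> R[i]) : cmfun f -> cint nu f = cint mu (fun x => f (phi x)).
Proof.
move=> [f1 f2]; rewrite /cint /Rintegral; congr (fine _ +i* fine _);
  by rewrite integral_image//; exact/measurable_EFinP.
Qed.

End complex_pushforward.

Section complex_mscale.
Context d (T : measurableType d) (R : realType).
Variables (m : {measure set T -> \bar R}) (k : {nonneg R}).

Lemma Rintegral_mscale (g : T -> R) : m.-integrable setT (EFin \o g) ->
  \int[mscale k m]_x g x = k%:num * \int[m]_x g x.
Proof.
move=> gi; have mg := measurable_int _ gi.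
have ip := integrable_fin_num measurableT (integrable_funepos measurableT gi).
have iN := integrable_fin_num measurableT (integrable_funeneg measurableT gi).
rewrite /Rintegral integralE [in RHS]integralE.
rewrite ge0_integral_mscale; [|exact: measurableT|exact: (measurable_funepos mg)|by move=> x _; exact: funepos_ge0].
rewrite ge0_integral_mscale; [|exact: measurableT|exact: (measurable_funeneg mg)|by move=> x _; exact: funeneg_ge0].
rewrite -(fineK ip) -(fineK iN).
by rewrite -!EFinM -!EFinB/= mulrBr.
Qed.

Lemma cint_mscale (f : T -> R[i]) : cintb m f ->
  cint (mscale k m) f = k%:num%:C * cint m f.
Proof.
move=> [f1 f2]; apply: complexP; rewrite ?cReM ?cImM /cint/= !mul0r ?subr0 ?addr0;
  exact: Rintegral_mscale.
Qed.

End complex_mscale.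

(** * Fubini's theorem for complex-valued functions *)

Section complex_fubini.
Context d1 d2 (T1 : measurableType d1) (T2 : measurableType d2) (R : realType).
Variable m1 : {sigma_finite_measure set T1 -> \bar R}.
Variable m2 : {sigma_finite_measure set T2 -> \bar R}.
Implicit Types f : T1 * T2 -> R[i].

Lemma cintb_prodP f : cmfun f ->
  cintb (m1 \x m2)%E f <-> (\int[m1]_x \int[m2]_y (normc (f (x, y)))%:E < +oo)%E.
Proof.
move=> mf; have mn := cmfun_normc mf.
have <- : (\int[(m1 \x m2)%E]_z (normc (f z))%:E =
    \int[m1]_x \int[m2]_y (normc (f (x, y)))%:E)%E.
  rewrite fubini_tonelli1//; first exact/measurable_EFinP.
  by move=> z; rewrite lee_fin normc_ge0.
by split; [exact: cintb_lty|exact: lty_cintb].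
Qed.

Lemma ae_cintb1 f : cintb (m1 \x m2)%E f ->
  {ae m1, forall x, cintb m2 (fun y => f (x, y))}.
Proof.
move=> [f1 f2].
by apply: filterS2 (ae_integrable1 f1) (ae_integrable1 f2) => x; split.
Qed.

Lemma cintb_fubini1 f : cintb (m1 \x m2)%E f ->
  cintb m1 (fun x => cint m2 (fun y => f (x, y))).
Proof.
move=> [f1 f2].
have h (g : T1 * T2 -> R) : (m1 \x m2)%E.-integrable setT (EFin \o g) ->
    m1.-integrable setT (fun x => (\int[m2]_y g (x, y))%:E).
  move=> gi; have iF := integrable_fubini_F gi.
  have mF := measurable_int _ iF.
  apply: le_integrable (iF) => //.
    by apply/measurable_EFinP; exact: measurableT_comp.
  move=> x _; rewrite /Rintegral /fubini_F/=.
  (* An infinite inner integral has [fine] value 0, so the bound by its absolute value persists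
     there. *)
  by case: (\int[m2]_y _)%E => //= *; rewrite leey.
by split; [exact: (h _ f1)|exact: (h _ f2)].
Qed.

Lemma cint_fubini1 f : cintb (m1 \x m2)%E f ->
  cint (m1 \x m2)%E f = cint m1 (fun x => cint m2 (fun y => f (x, y))).
Proof.
move=> [f1 f2].
have h (g : T1 * T2 -> R) : (m1 \x m2)%E.-integrable setT (EFin \o g) ->
    \int[(m1 \x m2)%E]_z g z = \int[m1]_x \int[m2]_y g (x, y).
  move=> gi; have iF := integrable_fubini_F gi.
  have mF := measurable_int _ iF.
  rewrite /Rintegral -integral12_prod_meas1//; congr fine.
  apply: ae_eq_integral => //.
    by apply/measurable_EFinP; exact: measurableT_comp.
  have := integrable_ae measurableT iF; apply: filterS => x /(_ I) fx _.
  by rewrite fineK.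
by rewrite /cint !h.
Qed.

Lemma cint_fubini2 f : cintb (m1 \x m2)%E f ->
  cint (m1 \x m2)%E f = cint m2 (fun y => cint m1 (fun x => f (x, y))).
Proof.
move=> [f1 f2].
have h (g : T1 * T2 -> R) : (m1 \x m2)%E.-integrable setT (EFin \o g) ->
    \int[(m1 \x m2)%E]_z g z = \int[m2]_y \int[m1]_x g (x, y).
  move=> gi; have iG := integral21_prod_meas1 gi.
  have mG := measurable_fubini_G gi.
  rewrite /Rintegral -integral21_prod_meas1//; congr fine.
  apply: ae_eq_integral => //.
    by apply/measurable_EFinP; exact: measurableT_comp.
  have := ae_integrable2 gi; apply: filterS => y yi _.
  by rewrite /fubini_G fineK//; exact: integrable_fin_num.
by rewrite /cint !h.
Qed.

End complex_fubini.

(** * Lebesgue measure on row vectors *)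

Section rV_borel.
Variables (R : realType) (n : nat).

(** The sigma-algebra is generated by the coordinates, so an open set is written as the countable
    union of the boxes with rational centre and radius [1/(k+1)] that it contains. *)
Lemma open_measurable_rV (O : set 'rV[R]_n) : open O -> measurable O.
Proof.
move=> oO.
pose B (qk : 'rV[rat]_n * nat) : set 'rV[R]_n :=
  [set x | forall i, `|x ord0 i - ratr (qk.1 ord0 i)| < qk.2.+1%:R^-1].
have mB qk : measurable (B qk).
  rewrite (_ : B qk = \bigcap_(i in [set: 'I_n])
     [set x | `|x ord0 i - ratr (qk.1 ord0 i)| < qk.2.+1%:R^-1]); last first.
    by apply/seteqP; split => x /= h i; [move=> _|]; exact: h.
  apply: fin_bigcap_measurable; first exact: finite_finset.
  move=> i _; rewrite -[X in measurable X]setTI.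
  have mf : measurable_fun [set: 'rV[R]_n]
      (fun x : 'rV[R]_n => `|x ord0 i - ratr (qk.1 ord0 i)|).
    apply: measurableT_comp; first exact: continuous_measurable_fun (@norm_continuous _ R).
    by apply: measurable_funB => //; exact: measurable_rV_coord.
  have := mf measurableT `]-oo, qk.2.+1%:R^-1[%classic (measurable_itv _).
  by congr measurable; apply/seteqP; split => x /=; rewrite in_itv/=.
rewrite (_ : O = \bigcup_qk (if pselect (B qk `<=` O) then B qk else set0)); last first.
  apply/seteqP; split => [x Ox|x [qk _]]; last first.
    by case: pselect => [BO /=|//]; exact: BO.
  have /nbhs_ballP[e /= e0 xeO] := open_nbhs_nbhs (conj oO Ox).
  have [k ke] : exists k : nat, k.+1%:R^-1 < e / 2.
    have [k _ h] := near_infty_natSinv_lt (PosNum (divr_gt0 e0 (ltr0n R 2))).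
    by exists k; apply: h => /=.
  have hq i : exists q : rat, `|x ord0 i - ratr q| < k.+1%:R^-1.
    have k0 : x ord0 i - k.+1%:R^-1 < x ord0 i + k.+1%:R^-1 :> R.
      by rewrite ltrD2l gtrN// invr_gt0.
    have [q] := rat_in_itvoo k0.
    by rewrite in_itv/= => /andP[h1 h2]; exists q; rewrite distrC ltr_distl h1 h2.
  have [q hq'] := choice hq.
  exists (\row_i q i, k) => //; case: pselect => [_ i|/= h]; first by rewrite mxE.
  apply: h => y By; apply: xeO; split => // i j; rewrite (ord1 i).
  have := By j; rewrite mxE /= => yq; rewrite /ball/=.
  rewrite (splitr e) (le_lt_trans (ler_distD (ratr (q j)) _ _))// ltrD//.
    exact: lt_trans (hq' j) ke.
  by rewrite distrC; exact: lt_trans yq ke.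
apply: countable_bigcupT_measurable => // qk.
by case: pselect => //= _; exact: measurable0.
Qed.

Lemma continuous_measurable_rV (f : 'rV[R]_n -> R) : continuous f -> measurable_fun setT f.
Proof.
move=> /continuousP cf; apply: (measurability _ (RGenOpens.measurableE R)).
move=> _ [_ [a [b ->] <-]]; rewrite setTI; apply: open_measurable_rV.
exact/cf/interval_open.
Qed.

Lemma continuous_cmeasurable (f : 'rV[R]_n -> R[i]) :
  continuous (re_fun f) -> continuous (im_fun f) -> cmfun f.
Proof. by move=> h1 h2; split; exact: continuous_measurable_rV. Qed.

Lemma measurable_rV_add (b : 'rV[R]_n) : measurable_fun setT (fun x : 'rV[R]_n => x + b).
Proof.
apply: measurable_fun_rV => i; under eq_fun do rewrite mxE.
by apply: measurable_funD => //; exact: measurable_rV_coord.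
Qed.

Lemma measurable_rV_sub d (T : measurableType d) (f g : T -> 'rV[R]_n) :
  measurable_fun setT f -> measurable_fun setT g -> measurable_fun setT (fun x => f x - g x).
Proof.
move=> mf mg; apply: measurable_fun_rV => i; under eq_fun do rewrite !mxE.
by apply: measurable_funB; apply: measurableT_comp (measurable_rV_coord i) _.
Qed.

Lemma measurable_rV_scale (r : R) : measurable_fun setT (fun x : 'rV[R]_n => r *: x).
Proof.
apply: measurable_fun_rV => i; under eq_fun do rewrite mxE.
by apply: measurable_funM => //; exact: measurable_rV_coord.
Qed.

Lemma measurable_euclid_dot d (T : measurableType d) (f g : T -> 'rV[R]_n) :
  measurable_fun setT f -> measurable_fun setT g ->
  measurable_fun setT (fun x => euclid_dot (f x) (g x)).
Proof.
move=> mf mg; apply: measurable_sum => i.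
by apply: measurable_funM; apply: measurableT_comp (measurable_rV_coord i) _.
Qed.

End rV_borel.

Section lebesgue_affine.
Variable R : realType.

Lemma rVD n (x y : 'rV[R]_n) i : (x + y) ord0 i = x ord0 i + y ord0 i.
Proof. exact: mxE. Qed.

Lemma rVN n (x : 'rV[R]_n) i : (- x) ord0 i = - x ord0 i.
Proof. exact: mxE. Qed.

Lemma rVZ n r (x : 'rV[R]_n) i : (r *: x) ord0 i = r * x ord0 i.
Proof. exact: mxE. Qed.

Local Notation leb := (@lebesgue_measure R).

Lemma lebesgue_measure_translation (b : R) (A : set (measurableTypeR R)) :
  measurable A -> leb A = leb ((fun x => x + b) @^-1` A).
Proof.
have mb : measurable_fun setT ((fun x => x + b) : measurableTypeR R -> measurableTypeR R).
  by apply: measurable_funD.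
move=> mA.
rewrite (@lebesgue_measure_unique R (pushforward leb (fun x : measurableTypeR R => x + b : measurableTypeR R)))//.
move=> _ [[c d]] _ <-; transitivity (leb `]c - b, d - b]%classic).
  by rewrite !lebesgue_measure_itv/= !lte_fin ltrD2r -!EFinB opprB addrA subrK.
rewrite /pushforward; congr (lebesgue_measure _).
by apply/seteqP; split => x /=; rewrite !in_itv/= ltrBlDr lerBrDr.
Qed.

Lemma lebesgue_measure_scale (r : R) (r0 : 0 < r) (A : set (measurableTypeR R)) :
  measurable A -> leb A = (r%:E * leb ((fun x => r * x)%R @^-1` A))%E.
Proof.
have mb : measurable_fun setT ((fun x => r * x) : measurableTypeR R -> measurableTypeR R).
  by apply: measurable_funM.
move=> mA; pose rn : {nonneg R} := NngNum (ltW r0).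
rewrite (@lebesgue_measure_unique R
  (mscale rn (pushforward leb (fun x : measurableTypeR R => r * x : measurableTypeR R))))//.
move=> _ [[c d]] _ <-; transitivity (r%:E * leb [set` `](r^-1 * c)%R, (r^-1 * d)%R]])%E; last first.
  rewrite /mscale/= /pushforward; congr (_ * lebesgue_measure _)%E.
  by apply/seteqP; split => x /=; rewrite !in_itv/= ltr_pdivrMl// ler_pdivlMl.
rewrite !lebesgue_measure_itv/= !lte_fin ltr_pM2l ?invr_gt0//.
case: ifPn => _; last by rewrite mule0.
by rewrite -!EFinB -EFinM -mulrBr mulrA divff ?gt_eqF// mul1r.
Qed.

(** Induction on the dimension: the translate of the product measure agrees with the product measure
    on rectangles, hence everywhere. *)
Lemma lebesgue_rV_translation n (b : 'rV[R]_n) (A : set 'rV[R]_n) :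
  measurable A -> lebesgue_rV R n A = lebesgue_rV R n ((fun x => x + b) @^-1` A).
Proof.
elim: n b A => [|n ih] b A mA.
  by congr (_ _); apply/seteqP; split => x /=; rewrite (_ : x + b = x)//;
    apply/rowP => -[].
rewrite /= /lebesgue_rV_cons /pushforward.
set mu := lebesgue_rV R n.
pose b0 := b ord0 ord0; pose b' : 'rV[R]_n := \row_i b ord0 (lift ord0 i).
pose tau (p : measurableTypeR R * 'rV[R]_n) : measurableTypeR R * 'rV[R]_n :=
  (p.1 + b0, p.2 + b').
have mtau : measurable_fun setT tau.
  apply: measurable_fun_pair => /=.
    exact: (measurable_funD measurable_fst (measurable_cst _)).
  exact: measurableT_comp (measurable_rV_add b') measurable_snd.
have mB : measurable (@rV_cons R n @^-1` A).
  by rewrite -[X in measurable X]setTI; exact: measurable_rV_cons.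
rewrite (@product_measure_unique _ _ _ _ _ _ _
  (pushforward (lebesgue_measure \x mu)%E tau))//.
  have e p : rV_cons (tau p) = rV_cons p + b.
    case: p => x y; apply/rowP => i /=; rewrite rVD.
    case: (unliftP ord0 i) => [j|] ->; last by rewrite !rV_cons0.
    by rewrite !rV_consS /= rVD [b' _ _]mxE.
  suff -> : @rV_cons R n @^-1` ((fun x => x + b) @^-1` A) = tau @^-1` (@rV_cons R n @^-1` A).
    by [].
  by apply/seteqP; split => p /=; rewrite e.
move=> C D mC mD; rewrite /pushforward.
have mC' : measurable ((fun x : measurableTypeR R => x + b0 : measurableTypeR R) @^-1` C).
  rewrite -[X in measurable X]setTI.
  exact: (measurable_funD (@measurable_id _ _ setT) (measurable_cst b0)).
have mD' : measurable ((fun x => x + b') @^-1` D).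
  by rewrite -[X in measurable X]setTI; apply: measurable_rV_add.
transitivity (leb ((fun x : R => (x + b0)%R) @^-1` C) * mu ((fun x => (x + b')%R) @^-1` D))%E.
  exact: (product_measure1E lebesgue_measure mu mC' mD').
by rewrite -(ih b' D mD); congr (_ * _)%E; exact/esym/lebesgue_measure_translation.
Qed.

Definition rV1 (t : measurableTypeR R) : 'rV[R]_1 := rV_cons (t, 0).

Lemma rV1E (t : R) i : rV1 t ord0 i = t.
Proof.
have -> : i = ord0 by apply/val_inj; case: i => -[].
exact: rV_cons0.
Qed.

Lemma rV1K (x : 'rV[R]_1) : rV1 (x ord0 ord0) = x.
Proof. by apply/rowP => i; rewrite rV1E (ord1 i). Qed.

Lemma measurable_rV1 : measurable_fun setT rV1.
Proof.
apply: measurableT_comp; first exact: measurable_rV_cons.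
by apply: measurable_fun_pair.
Qed.

(** In dimension 1 the second factor of the product is a Dirac mass on R^0, so on a rectangle only
    the membership of 0 in the second side matters. *)
Lemma lebesgue_rV1E (A : set 'rV[R]_1) : measurable A ->
  lebesgue_rV R 1 A = leb (rV1 @^-1` A).
Proof.
move=> mA; rewrite /= /lebesgue_rV_cons /pushforward.
have mB : measurable (@rV_cons R 0 @^-1` A).
  by rewrite -[X in measurable X]setTI; exact: measurable_rV_cons.
have mphi : measurable_fun setT (fun t : measurableTypeR R => (t, 0 : 'rV[R]_0)).
  by apply: measurable_fun_pair.
rewrite (@product_measure_unique _ _ _ _ _ _ _ (pushforward leb (fun t : measurableTypeR R => (t, 0 : 'rV[R]_0))))//.
move=> C D mC mD; rewrite /pushforward /= diracE.
have [D0|D0] := boolP (0 \in D).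
  rewrite mule1; congr (lebesgue_measure _).
  apply/seteqP; split => [x []//|x Cx]; split => //.
  by rewrite inE in D0.
rewrite mule0 -(@measure0 _ _ _ (@lebesgue_measure R)); congr (lebesgue_measure _).
by rewrite -subset0 => x [_ /= D0']; move: D0; rewrite notin_setE.
Qed.

Lemma lebesgue_rV1_scale (r : R) (r0 : 0 < r) (A : set 'rV[R]_1) : measurable A ->
  lebesgue_rV R 1 A = (r%:E * lebesgue_rV R 1 ((fun x => r *: x) @^-1` A))%E.
Proof.
move=> mA; have mB : measurable ((fun x => r *: x) @^-1` A).
  by rewrite -[X in measurable X]setTI; exact: measurable_rV_scale.
rewrite lebesgue_rV1E// [in RHS]lebesgue_rV1E//.
rewrite (lebesgue_measure_scale r0); last first.
  by rewrite -[X in measurable X]setTI; exact: measurable_rV1.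
congr (_ * lebesgue_measure _)%E; have e t : rV1 (r * t) = r *: rV1 t.
  by apply/rowP => i; rewrite rVZ !rV1E.
by apply/seteqP; split => t /=; rewrite e.
Qed.

Lemma lebesgue_rV1_opp (A : set 'rV[R]_1) : measurable A ->
  lebesgue_rV R 1 A = lebesgue_rV R 1 ((fun x => - x) @^-1` A).
Proof.
move=> mA; have mo : measurable_fun setT (fun x : 'rV[R]_1 => - x).
  apply: measurable_fun_rV => i; under eq_fun do rewrite mxE.
  by apply: measurableT_comp => //; exact: measurable_rV_coord.
have mB : measurable ((fun x => - x) @^-1` A).
  by rewrite -[X in measurable X]setTI; exact: mo.
rewrite lebesgue_rV1E// [in RHS]lebesgue_rV1E// -lebesgue_measureN; last first.
  by rewrite -[X in measurable X]setTI; exact: measurable_rV1.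
rewrite /pushforward; congr (lebesgue_measure _); have e t : rV1 (- t) = - rV1 t.
  by apply/rowP => i; rewrite rVN !rV1E.
by apply/seteqP; split => t /=; rewrite e.
Qed.

Lemma cint_rV1_scale (r : R) (r0 : 0 < r) (f : 'rV[R]_1 -> R[i]) :
  cmfun f -> cintb (lebesgue_rV R 1) (fun x => f (r *: x)) ->
  cint (lebesgue_rV R 1) f = r%:C * cint (lebesgue_rV R 1) (fun x => f (r *: x)).
Proof.
move=> mf fi; pose rn : {nonneg R} := NngNum (ltW r0).
rewrite -(cint_mscale rn fi).
apply: (cint_image (@measurable_rV_scale R 1 r)) mf => A mA.
by rewrite /mscale/=; exact: lebesgue_rV1_scale.
Qed.

Lemma ge0_integral_rV1_scale (r : R) (r0 : 0 < r) (f : 'rV[R]_1 -> \bar R) :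
  measurable_fun setT f -> (forall x, 0 <= f x)%E ->
  (\int[lebesgue_rV R 1]_x f x = r%:E * \int[lebesgue_rV R 1]_x f (r *: x)%R)%E.
Proof.
move=> mf f0; pose rn : {nonneg R} := NngNum (ltW r0).
have nuE A : measurable A -> lebesgue_rV R 1 A =
    mscale rn (lebesgue_rV R 1) ((fun x => r *: x) @^-1` A).
  by move=> mA; rewrite /mscale/=; exact: lebesgue_rV1_scale.
rewrite (ge0_integral_image (@measurable_rV_scale R 1 r) nuE mf f0).
rewrite ge0_integral_mscale//.
exact: measurableT_comp mf (@measurable_rV_scale R 1 r).
Qed.

Definition box1 (r : R) : set 'rV[R]_1 := [set x | `|x ord0 ord0| <= r].

Lemma measurable_box1 r : measurable (box1 r).
Proof.
have mn : measurable_fun [set: 'rV[R]_1] (fun x : 'rV[R]_1 => `|x ord0 ord0|).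
  apply: measurableT_comp; first exact: continuous_measurable_fun (@norm_continuous _ R).
  exact: measurable_rV_coord.
have := mn measurableT `]-oo, r]%classic (measurable_itv _); rewrite setTI.
by congr measurable; apply/seteqP; split => x /=; rewrite in_itv/=.
Qed.

Lemma lebesgue_box1 (r : R) : 0 < r -> lebesgue_rV R 1 (box1 r) = (2 * r)%:E.
Proof.
move=> r0; rewrite lebesgue_rV1E; last exact: measurable_box1.
rewrite (_ : _ @^-1` _ = `[- r, r]%classic); last first.
  by apply/seteqP; split => x; rewrite /box1 /= rV1E in_itv/= ler_norml.
rewrite lebesgue_measure_itv/= lte_fin gtrN// -EFinB opprK; congr EFin; ring.
Qed.

End lebesgue_affine.

(** * Polynomial growth and an integrable weight *)

Section weight.
Variable R : realType.

(** An l^1 variant of the Japanese bracket: comparable with [1 + euclid_norm x], and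
    submultiplicative under addition with constant 1 ([japD]), which is the form of Peetre's
    inequality used throughout. *)
Definition jap n (x : 'rV[R]_n) : R := 1 + \sum_(i < n) `|x ord0 i|.

Lemma jap_ge1 n (x : 'rV[R]_n) : 1 <= jap x.
Proof. by rewrite lerDl sumr_ge0. Qed.

Lemma jap_gt0 n (x : 'rV[R]_n) : 0 < jap x.
Proof. exact: lt_le_trans (jap_ge1 x). Qed.

Lemma jap_ge0 n (x : 'rV[R]_n) : 0 <= jap x.
Proof. exact/ltW/jap_gt0. Qed.

Lemma coord_le_jap n (x : 'rV[R]_n) i : `|x ord0 i| <= jap x.
Proof.
rewrite /jap (bigD1 i)//= addrCA lerDl addr_ge0// sumr_ge0//.
Qed.

Lemma japD n (x y : 'rV[R]_n) : jap (x + y) <= jap x * jap y.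
Proof.
have : jap (x + y) <= 1 + (\sum_(i < n) `|x ord0 i|) + \sum_(i < n) `|y ord0 i|.
  rewrite /jap -addrA lerD2l -big_split ler_sum// => i _.
  by rewrite mxE; exact: ler_normD.
move=> /le_trans; apply; rewrite /jap mulrDl mul1r mulrDr mulr1.
have : 0 <= (\sum_(i < n) `|x ord0 i|) * \sum_(i < n) `|y ord0 i|.
  by rewrite mulr_ge0 ?sumr_ge0.
set a := \sum_(i < n) _; set b := \sum_(i < n) _; lra.
Qed.

Lemma japN n (x : 'rV[R]_n) : jap (- x) = jap x.
Proof. by congr (_ + _); apply: eq_bigr => i _; rewrite mxE normrN. Qed.

Lemma japB n (x y : 'rV[R]_n) : jap x <= jap (x + y) * jap y.
Proof. by rewrite -(japN y) -{1}(addrK y x); exact: japD. Qed.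

(** A weight in product form, so that its integral factorizes. By [jap_wt] it dominates [jap] to the
    power [-2n], so decay of order [2n] is enough for integrability. *)
Definition wt n (x : 'rV[R]_n) : R := \prod_(i < n) (1 + x ord0 i ^+ 2)^-1.

Lemma wt_ge0 n (x : 'rV[R]_n) : 0 <= wt x.
Proof. by apply: prodr_ge0 => i _; rewrite invr_ge0 addr_ge0 ?sqr_ge0. Qed.

Lemma jap_wt n (x : 'rV[R]_n) : (jap x ^- (n * 2)) <= wt x.
Proof.
rewrite mulnC exprM -exprVn -[X in _ ^+ X](card_ord n) -prodr_const.
apply: ler_prod => i _; rewrite invr_ge0 exprn_ge0 ?jap_ge0//=.
rewrite lef_pV2 ?posrE ?exprn_gt0 ?jap_gt0 ?ltr_wpDr ?sqr_ge0//.
have := coord_le_jap x i; rewrite /jap (bigD1 i)//=.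
have : 0 <= \sum_(j < n | j != i) `|x ord0 j| by rewrite sumr_ge0.
rewrite -[x ord0 i ^+ 2]real_normK ?num_real//.
move: (\sum_(j < n | _) _) `|x ord0 i| (normr_ge0 (x ord0 i)) => s t; nra.
Qed.

Lemma measurable_wt n : measurable_fun setT (@wt n).
Proof.
apply: measurable_prod => i _.
apply: (@measurableT_comp _ _ _ _ _ _ (fun t : R => (1 + t ^+ 2)^-1)).
  exact: continuous_measurable_fun (@continuous_oneDsqrV R).
exact: measurable_rV_coord.
Qed.

Lemma integral_oneDsqrV : (\int[@lebesgue_measure R]_x ((1 + x ^+ 2)^-1)%:E < +oo)%E.
Proof.
rewrite (@ge0_symfun_integralT R (fun x => (1 + x ^+ 2)^-1)).
- have := @integral0y_oneDsqr R; rewrite set_itvcy => -> .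
  by rewrite -EFinM ltry.
- by move=> x; rewrite invr_ge0 addr_ge0 ?sqr_ge0.
- exact: continuous_oneDsqrV.
- by move=> x /=; rewrite sqrrN.
Qed.

Lemma integrable_wt n : (lebesgue_rV R n).-integrable setT (EFin \o @wt n).
Proof.
apply: lty_integrable_ge0; [exact: measurable_wt|exact: wt_ge0|].
elim: n => [|n ih].
  rewrite integral_dirac//; first by rewrite diracT mul1e ltry.
  by apply/measurable_EFinP; exact: measurable_wt.
rewrite (@ge0_integral_image _ _ _ _ _ _ (@measurable_rV_cons R n)
  (lebesgue_measure \x lebesgue_rV R n)%E)//.
- rewrite fubini_tonelli1//=; last 2 first.
  + apply/measurable_EFinP; apply: measurableT_comp (@measurable_wt n.+1) _.
    exact: measurable_rV_cons.
  + by move=> p; rewrite lee_fin wt_ge0.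
  rewrite /fubini_F.
  rewrite (_ : (fun x => _) = (fun x : R => (((1 + x ^+ 2)^-1)%:E *
     \int[lebesgue_rV R n]_y (wt y)%:E)%E)); last first.
    apply/funext => x; rewrite -ge0_integralZl//.
    + apply: eq_integral => y _; rewrite -EFinM; congr EFin.
      rewrite /wt big_ord_recl rV_cons0; congr (_ * _).
      by apply: eq_bigr => i _; rewrite rV_consS.
    + by apply/measurable_EFinP; exact: measurable_wt.
    + by move=> y _; rewrite lee_fin wt_ge0.
    + by rewrite lee_fin invr_ge0 addr_ge0 ?sqr_ge0.
  have I0 : (0 <= \int[lebesgue_rV R n]_y (wt y)%:E)%E.
    by apply: integral_ge0 => y _; rewrite lee_fin wt_ge0.
  rewrite ge0_integralZr//; last 2 first.
  + apply/measurable_EFinP.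
    exact: continuous_measurable_fun (@continuous_oneDsqrV R).
  + by move=> x _; rewrite lee_fin invr_ge0 addr_ge0 ?sqr_ge0.
  rewrite lte_mul_pinfty//.
  + by apply: integral_ge0 => x _; rewrite lee_fin invr_ge0 addr_ge0 ?sqr_ge0.
  + rewrite ge0_fin_numE ?integral_oneDsqrV//.
    by apply: integral_ge0 => x _; rewrite lee_fin invr_ge0 addr_ge0 ?sqr_ge0.
- by apply/measurable_EFinP; exact: measurable_wt.
- by move=> y; rewrite lee_fin wt_ge0.
Qed.

Lemma euclid_norm_jap n (x : 'rV[R]_n) : 1 + euclid_norm x <= jap x.
Proof.
rewrite lerD2l /euclid_norm -[leRHS]ger0_norm ?sumr_ge0// -sqrtr_sqr.
rewrite ler_wsqrtr// /euclid_dot expr2 mulr_suml ler_sum// => i _.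
rewrite (bigD1 i)//= mulrDr -normrM (le_trans (ler_norm _))// lerDl.
by rewrite mulr_ge0// sumr_ge0.
Qed.

Lemma coord_le_euclid n (x : 'rV[R]_n) i : `|x ord0 i| <= euclid_norm x.
Proof.
rewrite /euclid_norm -sqrtr_sqr ler_wsqrtr// /euclid_dot (bigD1 i)//= -expr2 lerDl.
by rewrite sumr_ge0// => j _; rewrite -expr2 sqr_ge0.
Qed.

Lemma jap_euclid_norm n (x : 'rV[R]_n) : jap x <= n.+1%:R * (1 + euclid_norm x).
Proof.
have e0 : 0 <= euclid_norm x by exact: sqrtr_ge0.
have : jap x <= 1 + n%:R * euclid_norm x.
  have -> : n%:R * euclid_norm x = \sum_(i < n) euclid_norm x.
    by rewrite sumr_const card_ord mulr_natl.
  by rewrite lerD2l ler_sum// => i _; rewrite coord_le_euclid.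
move=> /le_trans; apply; rewrite -natr1.
have : 0 <= n%:R :> R by [].
move: (n%:R : R) => m; nra.
Qed.

End weight.

(** * Schwartz functions *)

Section derivative_estimates.
Variable R : realType.

(** Without a quotient the condition can be stated for real and imaginary parts together, see
    [cdiffP]. *)
Lemma is_derive_epsP (V : normedModType R) (f : V -> R) (x v : V) (d : R) :
  is_derive x v f d <-> forall e, 0 < e -> exists2 dl, 0 < dl &
    forall h : R, `|h| <= dl -> `|f (x + h *: v) - f x - h * d| <= e * `|h|.
Proof.
pose q h : R := h^-1 *: ((f \o shift x) (h *: v) - f x).
have qE h : h != 0 -> `|d - q h| * `|h| = `|f (x + h *: v) - f x - h * d|.
  move=> h0; rewrite -normrM -[LHS]normrN /q /= (addrC _ x) /GRing.scale/=.
  by congr (`| _ |); field.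
split=> [[df dE] e e0|H].
  have : q h @[h --> 0^'] --> d by rewrite -dE; exact: df.
  move=> /cvgrPdist_le/(_ _ e0); rewrite near_withinE => /nbhs_ballP[dl /= dl0 H].
  exists (dl / 2) => [|h hdl]; first by rewrite divr_gt0.
  have [->|h0] := eqVneq h 0; first by rewrite scale0r addr0 subrr mul0r subrr normr0 mulr0.
  rewrite -qE// ler_wpM2r//; apply: (H h) h0.
  rewrite /ball/= sub0r normrN (le_lt_trans hdl)//.
  by rewrite ltr_pdivrMr// ltr_pMr// ltr1n.
have qd : q h @[h --> 0^'] --> d.
  apply/cvgrPdist_le => e e0; have [dl dl0 {}H] := H e e0.
  rewrite near_withinE; apply/nbhs_ballP; exists dl => //= h.
  rewrite /ball/= sub0r normrN => /ltW hdl h0.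
  by rewrite -(ler_pM2r (_ : 0 < `|h|)) ?normr_gt0// qE// H.
split; first by apply/cvg_ex; exists d.
exact: cvg_lim qd.
Qed.

Lemma derive_continuous1 (g g' : R -> R) : (forall t : R, is_derive t 1 g (g' t)) -> continuous g.
Proof.
move=> dg t; apply: differentiable_continuous; apply/derivable1_diffP.
by case: (dg t).
Qed.

Lemma mean_value_le (g g' : R -> R) (h M : R) :
  (forall t : R, is_derive t 1 g (g' t)) -> (forall t, `|t| <= `|h| -> `|g' t| <= M) ->
  `|g h - g 0| <= M * `|h|.
Proof.
move=> dg gM; have cg := derive_continuous1 dg.
have cw a b : {within `[a, b], continuous g} by exact: continuous_subspaceT.
have [h0|h0] := leP 0 h.
  have [c + ->] := MVT_segment h0 (fun x _ => dg x) (cw _ _).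
  rewrite in_itv/= => /andP[c0 ch]; rewrite subr0 normrM ler_wpM2r// gM//.
  by rewrite !ger0_norm//; exact: le_trans ch.
have [c + e] := MVT_segment (ltW h0) (fun x _ => dg x) (cw _ _).
rewrite in_itv/= => /andP[ch c0]; rewrite distrC e sub0r normrM normrN ler_wpM2r// gM//.
by rewrite !ler0_norm// ?lerN2// ltW.
Qed.

(** The mean value inequality applied to [g s - s * g' 0], whose derivative is estimated by the mean
    value inequality again; this gives the constant 1 instead of 1/2. *)
Lemma taylor2_le (g g' g'' : R -> R) (h M : R) :
  (forall t : R, is_derive t 1 g (g' t)) -> (forall t : R, is_derive t 1 g' (g'' t)) ->
  (forall t, `|t| <= `|h| -> `|g'' t| <= M) ->
  `|g h - g 0 - h * g' 0| <= M * h ^+ 2.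
Proof.
move=> dg dg' gM.
have d2 (t : R) : is_derive t 1 (fun s => g s - s * g' 0) (g' t - g' 0).
  have := @is_deriveB _ _ _ g (fun s => s * g' 0) t 1 _ _ (dg t) _.
  move=> /(_ (g' 0)); apply.
  have := @is_deriveM _ _ id (cst (g' 0)) t 1 _ _ (is_derive_id _ _) (is_derive_cst _ _ _).
  by rewrite scaler0 add0r /GRing.scale/= mulr1.
have := @mean_value_le (fun s => g s - s * g' 0) (fun t => g' t - g' 0) h (M * `|h|) d2.
rewrite mul0r subr0 -mulrA -expr2 real_normK ?num_real//.
rewrite (_ : g h - h * g' 0 - g 0 = g h - g 0 - h * g' 0); last by ring.
apply => t th; apply: le_trans (_ : M * `|t| <= _).
  by apply: (mean_value_le dg') => s st; apply: gM; exact: le_trans th.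
rewrite ler_wpM2l//; have := gM 0; rewrite normr0 => /(_ (normr_ge0 _)).
exact/le_trans.
Qed.

Lemma sin_le (t : R) : `|sin t| <= `|t|.
Proof.
have := @mean_value_le sin cos t 1 (fun t => is_derive_sin t).
rewrite sin0 subr0 mul1r; apply => s _; exact: cos_max.
Qed.

Lemma cis_taylor2 (t : R) : normc (cis t - 1 - (0 +i* t)) <= 2 * t ^+ 2.
Proof.
have h1 : `|cos t - cos 0 - t * - sin 0| <= 1 * t ^+ 2.
  apply: (@taylor2_le cos (fun t => - sin t) (fun t => - cos t)) => s.
  by move=> _; rewrite normrN cos_max.
have h2 : `|sin t - sin 0 - t * cos 0| <= 1 * t ^+ 2.
  apply: (@taylor2_le sin cos (fun t => - sin t)) => s.
  by move=> _; rewrite normrN sin_max.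
move: h1 h2; rewrite cos0 sin0 oppr0 => h1 h2.
apply: (le_trans (normc_le _)); rewrite /= mulrDl mul1r; apply: lerD.
  by move: h1; rewrite mulr0 mul1r.
by move: h2; rewrite mulr1 mul1r addr0 subr0.
Qed.

Lemma cis_sub1_le (t : R) : normc (cis t - 1) <= 2 * `|t|.
Proof.
apply: (le_trans (normc_le _)); rewrite /= mulrDl mul1r; apply: lerD; last first.
  by rewrite subr0 sin_le.
have := @mean_value_le cos (fun t => - sin t) t 1 (fun t => is_derive_cos t).
by rewrite cos0 mul1r; apply => s _; rewrite normrN sin_max.
Qed.

Lemma cisD (a b : R) : cis (a + b) = cis a * cis b.
Proof. by apply: complexP; rewrite ?cReM ?cImM /= ?cosD ?sinD// addrC mulrC (mulrC (sin b)). Qed.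

Lemma cis0 : cis 0 = 1 :> R[i].
Proof. by rewrite /cis cos0 sin0. Qed.

Lemma conj_cis (a : R) : conjc (cis a) = cis (- a).
Proof. by rewrite /cis/= cosN sinN. Qed.

End derivative_estimates.

Section complex_derivative.
Variables (R : realType) (n : nat).
Implicit Types (u : 'rV[R]_n -> R[i]) (v x : 'rV[R]_n) (d : R[i]).

Definition cdiff u v x d : Prop :=
  is_derive x v (re_fun u) (complex.Re d) /\ is_derive x v (im_fun u) (complex.Im d).

Lemma Re_increment (a b d : R[i]) (h : R) : complex.Re (a - b - h%:C * d) =
  complex.Re a - complex.Re b - h * complex.Re d.
Proof. by case: a b d => ? ? [? ?] [? ?] /=; ring. Qed.

Lemma Im_increment (a b d : R[i]) (h : R) : complex.Im (a - b - h%:C * d) =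
  complex.Im a - complex.Im b - h * complex.Im d.
Proof. by case: a b d => ? ? [? ?] [? ?] /=; ring. Qed.

Lemma cdiffP u v x d : cdiff u v x d <-> forall e, 0 < e -> exists2 dl, 0 < dl &
  forall h : R, `|h| <= dl -> normc (u (x + h *: v) - u x - h%:C * d) <= e * `|h|.
Proof.
have reE h := Re_increment (u (x + h *: v)) (u x) d h.
have imE h := Im_increment (u (x + h *: v)) (u x) d h.
split=> [[/is_derive_epsP h1 /is_derive_epsP h2] e e0|H].
  have e20 : 0 < e / 2 by rewrite divr_gt0.
  have [d1 d10 {}h1] := h1 _ e20; have [d2 d20 {}h2] := h2 _ e20.
  exists (Num.min d1 d2) => [|h]; first by rewrite lt_min d10.
  rewrite le_min => /andP[hd1 hd2]; rewrite (le_trans (normc_le _))//.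
  by rewrite [in leRHS](splitr e) mulrDl reE imE lerD ?h1 ?h2.
split; apply/is_derive_epsP => e e0; have [dl dl0 {}H] := H _ e0; exists dl => // h hd.
  by rewrite -reE (le_trans (normc_Re _))// H.
by rewrite -imE (le_trans (normc_Im _))// H.
Qed.

(** Derivatives of integrals are obtained from a second-order remainder valid for [|h| <= 1]: such a
    bound survives integration, so differentiation under the integral sign needs no limit
    theorem. *)
Lemma cdiff_quadratic u v x d (C : R) :
  (forall h : R, `|h| <= 1 -> normc (u (x + h *: v) - u x - h%:C * d) <= C * h ^+ 2) ->
  cdiff u v x d.
Proof.
move=> H; apply/cdiffP => e e0; exists (Num.min 1 (e / (`|C| + 1))).
  by rewrite lt_min ltr01 divr_gt0// ltr_pwDr.
move=> h; rewrite le_min => /andP[h1 hC]; apply: (le_trans (H _ h1)).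
rewrite -[h ^+ 2]real_normK ?num_real// expr2 mulrA ler_wpM2r//.
apply: le_trans (_ : (`|C| + 1) * `|h| <= _).
  by rewrite ler_wpM2r// (le_trans (ler_norm _))// lerDl.
by rewrite mulrC -ler_pdivlMr// ltr_pwDr.
Qed.

Lemma cdiffM u w v x d d' : cdiff u v x d -> cdiff w v x d' ->
  cdiff (fun y => u y * w y) v x (d * w x + u x * d').
Proof.
move=> [u1 u2] [w1 w2]; split.
  rewrite (_ : re_fun _ = re_fun u * re_fun w - im_fun u * im_fun w); last first.
    by apply/funext => y; rewrite -[RHS]/(complex.Re (u y) * complex.Re (w y) - complex.Im (u y) * complex.Im (w y)) -cReM.
  apply: is_derive_eq; rewrite /re_fun /im_fun /GRing.scale/=.
  by case: (u x) (w x) d d' {u1 u2 w1 w2} => ? ? [? ?] [? ?] [? ?] /=; ring.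
rewrite (_ : im_fun _ = re_fun u * im_fun w + im_fun u * re_fun w); last first.
  by apply/funext => y; rewrite -[RHS]/(complex.Re (u y) * complex.Im (w y) + complex.Im (u y) * complex.Re (w y)) -cImM.
apply: is_derive_eq; rewrite /re_fun /im_fun /GRing.scale/=.
by case: (u x) (w x) d d' {u1 u2 w1 w2} => ? ? [? ?] [? ?] [? ?] /=; ring.
Qed.

Lemma cdiffD u w v x d d' : cdiff u v x d -> cdiff w v x d' ->
  cdiff (fun y => u y + w y) v x (d + d').
Proof.
move=> [u1 u2] [w1 w2]; split.
  rewrite (_ : re_fun _ = re_fun u + re_fun w) ?cReD; last first.
    by apply/funext => y; rewrite -[RHS]/(complex.Re (u y) + complex.Re (w y)) -cReD.
  exact: is_deriveD.
rewrite (_ : im_fun _ = im_fun u + im_fun w) ?cImD; last first.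
  by apply/funext => y; rewrite -[RHS]/(complex.Im (u y) + complex.Im (w y)) -cImD.
exact: is_deriveD.
Qed.

Lemma cdiff_cst a v x : cdiff (fun=> a) v x 0.
Proof. by split; exact: is_derive_cst. Qed.

Lemma cdiff_conj u v x d : cdiff u v x d -> cdiff (fun y => conjc (u y)) v x (conjc d).
Proof.
move=> [u1 u2]; split.
  rewrite (_ : re_fun _ = re_fun u); first by case: d u1 u2.
  by apply/funext => y; rewrite /re_fun; case: (u y).
rewrite (_ : im_fun _ = - im_fun u); last first.
  by apply/funext => y; rewrite -[RHS]/(- complex.Im (u y)) /im_fun; case: (u y).
rewrite (_ : complex.Im _ = - complex.Im d); last by case: d {u1 u2}.
exact: is_deriveN.
Qed.

Lemma cdiff_cpartial u a x d : cdiff u (basis_vec R a) x d -> cpartial a u x = d.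
Proof.
move=> [/@derive_val h1 /@derive_val h2]; rewrite /cpartial h1 h2.
by case: d {h1 h2}.
Qed.

Lemma cdiff_line u v x (u' : R -> R[i]) :
  (forall t, cdiff u v (x + t *: v) (u' t)) ->
  (forall t, is_derive t (1 : R) (fun t => complex.Re (u (x + t *: v))) (complex.Re (u' t))) /\
  (forall t, is_derive t (1 : R) (fun t => complex.Im (u (x + t *: v))) (complex.Im (u' t))).
Proof.
have e1 t h : x + (t + h *: (1 : R)) *: v = x + t *: v + h *: v.
  by rewrite [h *: 1]mulr1 scalerDl addrA.
move=> H; split=> t; apply/is_derive_epsP => e e0.
  have [/is_derive_epsP /(_ _ e0)[dl dl0 h1] _] := H t; exists dl => // h /h1.
  by rewrite /re_fun e1.
have [_ /is_derive_epsP /(_ _ e0)[dl dl0 h1]] := H t; exists dl => // h /h1.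
by rewrite /im_fun e1.
Qed.

Lemma cdiff_taylor2 u v x (u' u'' : 'rV[R]_n -> R[i]) (h M : R) :
  (forall y, cdiff u v y (u' y)) -> (forall y, cdiff u' v y (u'' y)) ->
  (forall t, `|t| <= `|h| -> normc (u'' (x + t *: v)) <= M) ->
  normc (u (x + h *: v) - u x - h%:C * u' x) <= 2 * M * h ^+ 2.
Proof.
move=> du du' uM.
have [r1 i1] := cdiff_line (fun t => du (x + t *: v)).
have [r2 i2] := cdiff_line (fun t => du' (x + t *: v)).
have := taylor2_le (M := M) (h := h) r1 r2; have := taylor2_le (M := M) (h := h) i1 i2.
rewrite scale0r addr0 => hi hr; apply: (le_trans (normc_le _)).
rewrite mulr2n !mulrDl mul1r; apply: lerD.
  rewrite Re_increment; apply: hr => t th; apply: (le_trans (normc_Re _)); exact: uM.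
rewrite Im_increment; apply: hi => t th; apply: (le_trans (normc_Im _)); exact: uM.
Qed.

End complex_derivative.

(** * Uniform families of Schwartz functions and of multipliers *)

Section families.
Variables (R : realType) (n : nat) (I : Type).
Implicit Types (u v : I -> 'rV[R]_n -> R[i]) (eps : I -> R).

(* Families indexed by [I] keep track of constants that are uniform in the index, with weights
   [eps i]; a single Schwartz function is a family over [unit]. *)
Definition bfam (B : (I -> 'rV[R]_n -> R[i]) -> Prop) u : Prop :=
  (forall i, csmooth (u i)) /\ forall l, B (fun i => cpartials l (u i)).

(* Coinduction: iterated partial derivatives are avoided by exhibiting a class of families that is
   stable under taking one partial derivative. *)
Lemma bfam_coind B (P : (I -> 'rV[R]_n -> R[i]) -> Prop) :
  (forall u, P u ->
    [/\ forall i, continuous (re_fun (u i)) /\ continuous (im_fun (u i)), B u &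
        forall a, exists2 u', P u' &
          forall i x, cdiff (u i) (basis_vec R a) x (u' i x)]) ->
  forall u, P u -> bfam B u.
Proof.
move=> H u Pu.
have Pl l : P (fun i => cpartials l (u i)).
  elim: l => [//|a l ih] /=; have [_ _ /(_ a)[u' Pu' du']] := H _ ih.
  rewrite (_ : (fun _ => _) = u')//; apply/funext => i; apply/funext => x.
  exact/cdiff_cpartial.
split=> [i l|l]; last by case: (H _ (Pl l)).
have [/(_ i)[c1 c2] _ d] := H _ (Pl l); split => // a x.
have [u' _ /(_ i x)[d1 d2]] := d a.
by split; [case: d1|case: d2].
Qed.

Lemma bfam_bound B u : bfam B u -> B u.
Proof. by move=> [_ /(_ [::])]. Qed.

Lemma bfam_continuous B u i : bfam B u ->
  continuous (re_fun (u i)) /\ continuous (im_fun (u i)).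
Proof. by move=> [/(_ i [::])[]]. Qed.

Lemma bfam_cdiff B u i a x : bfam B u -> cdiff (u i) (basis_vec R a) x (cpartial a (u i) x).
Proof.
move=> [/(_ i [::])[_ _ /(_ a x)[d1 d2]] _].
by split; exact: derivableP.
Qed.

Lemma cpartials_rcons l a (f : 'rV[R]_n -> R[i]) :
  cpartials (rcons l a) f = cpartials l (cpartial a f).
Proof. by rewrite /cpartials foldr_rcons. Qed.

Lemma bfam_partial B u a : bfam B u -> bfam B (fun i => cpartial a (u i)).
Proof.
move=> [su Bu]; split=> [i l|l]; last by have := Bu (rcons l a);
  under [X in B X]eq_fun do rewrite cpartials_rcons.
by rewrite -cpartials_rcons; exact: su.
Qed.

(** By the Leibniz rule the derivative of a product is a sum of two products of the same kind;
    closing products under sums gives a class to which [bfam_coind] applies. *)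
Inductive prods B1 B2 : (I -> 'rV[R]_n -> R[i]) -> Prop :=
| prods_base u v : bfam B1 u -> bfam B2 v -> prods B1 B2 (fun i x => u i x * v i x)
| prods_add u v : prods B1 B2 u -> prods B1 B2 v -> prods B1 B2 (fun i x => u i x + v i x).

Lemma bfamM B1 B2 B u v :
  (forall u v, B1 u -> B2 v -> B (fun i x => u i x * v i x)) ->
  (forall u v, B u -> B v -> B (fun i x => u i x + v i x)) ->
  bfam B1 u -> bfam B2 v -> bfam B (fun i x => u i x * v i x).
Proof.
move=> BM BD Bu Bv; apply: (@bfam_coind B (prods B1 B2)); last exact: prods_base.
move=> w Hw; elim: Hw => {w Bu Bv u v} [u v Bu Bv|u v _ [c1 b1 d1] _ [c2 b2 d2]].
  split=> [i||a].
  - have [c1 c2] := bfam_continuous i Bu; have [c3 c4] := bfam_continuous i Bv.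
    split => x.
      rewrite (_ : re_fun _ = re_fun (u i) \* re_fun (v i) \- im_fun (u i) \* im_fun (v i)); last first.
        by apply/funext => y; exact: cReM.
      by apply: continuousB; apply: continuousM; [exact: c1|exact: c3|exact: c2|exact: c4].
    rewrite (_ : im_fun _ = re_fun (u i) \* im_fun (v i) \+ im_fun (u i) \* re_fun (v i)); last first.
      by apply/funext => y; exact: cImM.
    by apply: continuousD; apply: continuousM; [exact: c1|exact: c4|exact: c2|exact: c3].
  - by apply: BM; exact: bfam_bound.
  - exists (fun i x => cpartial a (u i) x * v i x + u i x * cpartial a (v i) x).
      apply: prods_add; first exact: prods_base (bfam_partial a Bu) Bv.
      exact: prods_base Bu (bfam_partial a Bv).
    by move=> i x; apply: cdiffM; [exact: bfam_cdiff Bu|exact: bfam_cdiff Bv].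
split=> [i||a].
- have [c11 c12] := c1 i; have [c21 c22] := c2 i; split=> x.
    rewrite (_ : re_fun _ = re_fun (u i) \+ re_fun (v i)); last first.
      by apply/funext => y; exact: cReD.
    by apply: continuousD; [exact: c11|exact: c21].
  rewrite (_ : im_fun _ = im_fun (u i) \+ im_fun (v i)); last first.
    by apply/funext => y; exact: cImD.
  by apply: continuousD; [exact: c12|exact: c22].
- exact: BD.
- have [u' Pu' du'] := d1 a; have [v' Pv' dv'] := d2 a.
  exists (fun i x => u' i x + v' i x); first exact: prods_add.
  by move=> i x; exact: cdiffD.
Qed.

Definition rapid eps u : Prop := forall N : nat, exists2 C : R, 0 <= C &
  forall i x, jap x ^+ N * normc (u i x) <= C * eps i.

Definition moder eps u : Prop := exists N : nat, exists2 C : R, 0 <= C &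
  forall i x, normc (u i x) <= C * eps i * jap x ^+ N.

(** For [eps = 1] this is a bounded subset of the Schwartz space; in general every Schwartz seminorm
    of [u i] is [O(eps i)]. [mfam] is the analogue for smooth multipliers of polynomial growth. *)
Definition sfam eps u : Prop := bfam (rapid eps) u.
Definition mfam eps u : Prop := bfam (moder eps) u.

Lemma rapidD eps u v : rapid eps u -> rapid eps v -> rapid eps (fun i x => u i x + v i x).
Proof.
move=> hu hv N; have [C C0 {}hu] := hu N; have [D D0 {}hv] := hv N.
exists (C + D); first exact: addr_ge0.
move=> i x; rewrite mulrDl (le_trans _ (lerD (hu i x) (hv i x)))// -mulrDr ler_wpM2l ?normcD//.
by rewrite exprn_ge0// jap_ge0.
Qed.

Lemma rapidM eps eps' u v : (forall i, 0 <= eps i) -> (forall i, 0 <= eps' i) ->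
  moder eps u -> rapid eps' v ->
  rapid (fun i => eps i * eps' i) (fun i x => u i x * v i x).
Proof.
move=> e0 e0' [M [C C0 hu]] hv N; have [D D0 {}hv] := hv (N + M)%N.
exists (C * D); first exact: mulr_ge0.
move=> i x; rewrite normcM.
have h0 : 0 <= jap x ^+ N * normc (v i x) by rewrite mulr_ge0 ?normc_ge0// exprn_ge0// jap_ge0.
rewrite mulrCA.
apply: (le_trans (ler_wpM2r h0 (hu i x))).
have -> : C * eps i * jap x ^+ M * (jap x ^+ N * normc (v i x)) =
    C * eps i * (jap x ^+ (N + M) * normc (v i x)).
  by rewrite exprD; ring.
apply: le_trans (ler_wpM2l _ (hv i x)) _; first by rewrite mulr_ge0.
by rewrite le_eqVlt; apply/orP; left; apply/eqP; ring.
Qed.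

Lemma rapid_moder eps u : rapid eps u -> moder eps u.
Proof.
by move=> /(_ 0%N)[C C0 h]; exists 0%N, C => // i x; have := h i x; rewrite !expr0 mul1r mulr1.
Qed.

Lemma bfam_sub B B' u : (forall v, B v -> B' v) -> bfam B u -> bfam B' u.
Proof. by move=> BB' [su Bu]; split => // l; exact: BB'. Qed.

Lemma sfam_mfam eps u : sfam eps u -> mfam eps u.
Proof. exact/bfam_sub/rapid_moder. Qed.

Lemma sfamM eps eps' u v : (forall i, 0 <= eps i) -> (forall i, 0 <= eps' i) ->
  mfam eps u -> sfam eps' v -> sfam (fun i => eps i * eps' i) (fun i x => u i x * v i x).
Proof.
move=> e0 e0'; apply: bfamM; first by move=> *; exact: rapidM.
exact: rapidD.
Qed.

Lemma bfamD B u v : (forall u v, B u -> B v -> B (fun i x => u i x + v i x)) ->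
  bfam B u -> bfam B v -> bfam B (fun i x => u i x + v i x).
Proof.
move=> BD Bu Bv.
apply: (@bfam_coind B (fun w => exists u v, [/\ bfam B u, bfam B v & w = fun i x => u i x + v i x]));
  last by exists u, v.
move=> _ {Bu Bv u v} [u [v [Bu Bv ->]]]; split=> [i||a].
- have [c11 c12] := bfam_continuous i Bu; have [c21 c22] := bfam_continuous i Bv; split=> x.
    rewrite (_ : re_fun _ = re_fun (u i) \+ re_fun (v i)); last first.
      by apply/funext => y; exact: cReD.
    by apply: continuousD; [exact: c11|exact: c21].
  rewrite (_ : im_fun _ = im_fun (u i) \+ im_fun (v i)); last first.
    by apply/funext => y; exact: cImD.
  by apply: continuousD; [exact: c12|exact: c22].
- by apply: BD; exact: bfam_bound.
- exists (fun i x => cpartial a (u i) x + cpartial a (v i) x).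
    by do 2 eexists; split; [exact: bfam_partial Bu|exact: bfam_partial Bv|].
  by move=> i x; apply: cdiffD; [exact: bfam_cdiff Bu|exact: bfam_cdiff Bv].
Qed.

Lemma sfamD eps u v : sfam eps u -> sfam eps v -> sfam eps (fun i x => u i x + v i x).
Proof. exact/bfamD/rapidD. Qed.

Lemma continuous_cstc (a : R[i]) : continuous (re_fun (fun _ : 'rV[R]_n => a)) /\
  continuous (im_fun (fun _ : 'rV[R]_n => a)).
Proof. by split=> x; exact: cst_continuous. Qed.

Lemma mfam_cst eps (a : I -> R[i]) (C : R) : 0 <= C -> (forall i, 0 <= eps i) ->
  (forall i, normc (a i) <= C * eps i) ->
  mfam eps (fun i _ => a i).
Proof.
move=> C0 e0 aC.
apply: (@bfam_coind _ (fun w => exists2 a : I -> R[i], forall i, normc (a i) <= C * eps i & w = fun i _ => a i));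
  last by exists a.
move=> _ {aC a}[a aC ->]; split=> [i||l]; first exact: continuous_cstc.
  by exists 0%N, C => // i x; rewrite expr0 mulr1.
exists (fun _ _ => 0); last by move=> i x; exact: cdiff_cst.
by exists (fun=> 0) => // i; rewrite normc0 mulr_ge0.
Qed.

Lemma sfam_scale eps (a : R[i]) u : (forall i, 0 <= eps i) -> sfam eps u ->
  sfam eps (fun i x => a * u i x).
Proof.
move=> e0 su; have := @sfamM (fun=> 1) eps (fun _ _ => a) u (fun=> ler01) e0 _ su.
rewrite (_ : (fun i => 1 * eps i) = eps); last by apply/funext => i; rewrite mul1r.
by apply; apply: (@mfam_cst _ _ (normc a)) => // [|i]; rewrite ?normc_ge0// mulr1.
Qed.

Lemma continuous_coord (a : 'I_n) : continuous (fun x : 'rV[R]_n => x ord0 a).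
Proof. exact: coord_continuous. Qed.

Lemma mfam_coord (a : 'I_n) : mfam (fun=> 1) (fun (_ : I) (x : 'rV[R]_n) => (x ord0 a)%:C).
Proof.
apply: (@bfam_coind _ (fun w => w = (fun (_ : I) (x : 'rV[R]_n) => (x ord0 a)%:C) \/
   exists2 b : R[i], normc b <= 1 & w = (fun _ _ => b))); last by left.
move=> _ [->|[b b1 ->]].
  split=> [i||c].
  - by split; [exact: continuous_coord|move=> x; exact: cst_continuous].
  - by exists 1%N, 1 => // i x; rewrite expr1 !mul1r normc_real coord_le_jap.
  - exists (fun _ _ => (a == c)%:R).
      by right; exists (a == c)%:R => //; case: (a == c); rewrite ?normc1 ?normc0.
    move=> i x; apply/cdiffP => e e0; exists 1 => // h _.
    rewrite rVD rVZ /basis_vec mxE eqxx/= -!rmorphB/= (addrC (x ord0 a)) addrK.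
    rewrite (_ : _ - _ = 0) ?normc0 ?mulr_ge0 ?(ltW e0)//.
    by case: (a == c); rewrite ?mulr1 ?mulr0 ?subrr.
split=> [i||c]; first exact: continuous_cstc.
  by exists 0%N, 1 => // i x; rewrite expr0 !mulr1.
exists (fun _ _ => 0); last by move=> i x; exact: cdiff_cst.
by right; exists 0 => //; rewrite normc0.
Qed.

End families.

Section schwartz_family.
Variables (R : realType) (n : nat).
Implicit Types (f g : 'rV[R]_n -> R[i]).

Definition sch f : Prop := sfam (fun _ : unit => 1) (fun=> f).

(** There are finitely many words of length at most [N], and [jap] is comparable with
    [1 + euclid_norm]; so bounding each derivative separately amounts to bounding
    [schwartz_norm]. *)
Lemma schP f : schwartz f <-> sch f.
Proof.
split=> [[sf nf]|[sf hf]].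
  split=> // l N.
  (* A single index of [schwartz_norm] governs both the power of the weight and the order of the
     derivatives. *)
  pose M := maxn N (size l).
  have nM := nf M.
  have bM x : (((1 + euclid_norm x) ^+ M * normc (cpartials l f x))%:E <= schwartz_norm M f)%E.
    by apply: ereal_sup_ubound; exists (l, x) => //=; rewrite leq_maxr.
  have s0 : (0 <= schwartz_norm M f)%E.
    apply: le_trans (bM 0); rewrite lee_fin mulr_ge0 ?normc_ge0// exprn_ge0// addr_ge0//.
    exact: sqrtr_ge0.
  have sfin : schwartz_norm M f \is a fin_num by rewrite ge0_fin_numE.
  exists (n.+1%:R ^+ M * fine (schwartz_norm M f)).
    by rewrite mulr_ge0 ?exprn_ge0// fine_ge0.
  move=> _ x; rewrite mulr1.
  have := bM x; rewrite -(fineK sfin) lee_fin => h.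
  have e1 : 1 <= 1 + euclid_norm x by rewrite lerDl sqrtr_ge0.
  apply: le_trans (_ : jap x ^+ M * normc (cpartials l f x) <= _).
    by rewrite ler_wpM2r ?normc_ge0// ler_weXn2l ?jap_ge1// leq_maxl.
  apply: le_trans (ler_wpM2l _ h); last by rewrite exprn_ge0.
  rewrite mulrA ler_wpM2r ?normc_ge0// -exprMn.
  by rewrite lerXn2r ?nnegrE ?jap_ge0 ?mulr_ge0 ?addr_ge0 ?sqrtr_ge0// jap_euclid_norm.
split=> [l|N]; first exact: (sf tt).
have /choice[C HC] : forall l, exists C : R, 0 <= C /\
    forall x, jap x ^+ N * normc (cpartials l f x) <= C.
  by move=> l; have [C C0 h] := hf l N; exists C; split=> // x; have := h tt x; rewrite mulr1.
pose D := \sum_(k < N.+1) \sum_(t : k.-tuple 'I_n) C t.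
apply: (@le_lt_trans _ _ D%:E); last exact: ltry.
apply: ub_ereal_sup => _ [[l x] /= sl <-]; rewrite lee_fin.
apply: le_trans (_ : C l <= D).
  apply: le_trans ((HC l).2 x); rewrite ler_wpM2r ?normc_ge0//.
  by rewrite lerXn2r ?nnegrE ?jap_ge0 ?addr_ge0 ?sqrtr_ge0// euclid_norm_jap.
have sl' : (size l < N.+1)%N by [].
rewrite /D (bigD1 (Ordinal sl'))//= (bigD1 (in_tuple l))//= -addrA lerDl.
rewrite addr_ge0// sumr_ge0//.
  by move=> t _; exact: (HC t).1.
by move=> k _; rewrite sumr_ge0// => t _; exact: (HC t).1.
Qed.

(** Turns uniformity of a family into the seminorm bound in which the continuity of a tempered
    functional is expressed. *)
Lemma sfam_schwartz_norm (I : Type) (eps : I -> R) (u : I -> 'rV[R]_n -> R[i]) N :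
  (forall i, 0 <= eps i) -> sfam eps u ->
  exists2 C : R, 0 <= C & forall i, (schwartz_norm N (u i) <= (C * eps i)%:E)%E.
Proof.
move=> e0 [su hu].
have /choice[C HC] : forall l, exists C : R, 0 <= C /\
    forall i x, jap x ^+ N * normc (cpartials l (u i) x) <= C * eps i.
  by move=> l; have [C C0 h] := hu l N; exists C.
pose D := \sum_(k < N.+1) \sum_(t : k.-tuple 'I_n) C t.
have D0 : 0 <= D by rewrite sumr_ge0// => k _; rewrite sumr_ge0// => t _; exact: (HC t).1.
exists D => // i.
apply: ub_ereal_sup => _ [[l x] /= sl <-]; rewrite lee_fin.
apply: le_trans (_ : C l * eps i <= D * eps i).
  apply: le_trans ((HC l).2 i x); rewrite ler_wpM2r ?normc_ge0//.
  by rewrite lerXn2r ?nnegrE ?jap_ge0 ?addr_ge0 ?sqrtr_ge0// euclid_norm_jap.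
have sl' : (size l < N.+1)%N by [].
rewrite ler_wpM2r//.
rewrite /D (bigD1 (Ordinal sl'))//= (bigD1 (in_tuple l))//= -addrA lerDl.
rewrite addr_ge0// sumr_ge0//.
  by move=> t _; exact: (HC t).1.
by move=> k _; rewrite sumr_ge0// => t _; exact: (HC t).1.
Qed.

Lemma sfam_sch (I : Type) (eps : I -> R) (u : I -> 'rV[R]_n -> R[i]) i :
  sfam eps u -> sch (u i).
Proof.
move=> [su hu]; split=> [_|l N]; first exact: su.
have [C C0 h] := hu l N; exists (C * `|eps i|); first by rewrite mulr_ge0.
by move=> _ x; rewrite mulr1 (le_trans (h i x))// ler_wpM2l// ler_norm.
Qed.

Lemma sch_sfam (I : Type) f : sch f -> sfam (fun _ : I => 1) (fun=> f).
Proof.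
move=> [su hu]; split=> [_|l N]; first exact: (su tt).
by have [C C0 h] := hu l N; exists C => // _ x; exact: (h tt x).
Qed.

Lemma schD f g : sch f -> sch g -> sch (fun x => f x + g x).
Proof. exact: sfamD. Qed.

Lemma schZ a f : sch f -> sch (fun x => a * f x).
Proof. exact: sfam_scale. Qed.

Lemma schM f g : sch f -> sch g -> sch (fun x => f x * g x).
Proof.
move=> sf sg; have := @sfamM _ _ _ _ _ _ _ (fun=> ler01) (fun=> ler01) (sfam_mfam sf) sg.
by rewrite (_ : (fun i => 1 * 1) = (fun=> 1))//; apply/funext => i; rewrite mulr1.
Qed.

Lemma sch0 : sch (fun=> 0).
Proof.
split=> [_ l|l N].
  have -> : cpartials l (fun=> 0 : R[i]) = (fun _ : 'rV[R]_n => 0).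
    elim: l => //= a l ->; apply/funext => x; apply: cdiff_cpartial; exact: cdiff_cst.
  have [? ?] := continuous_cstc n (0 : R[i]); split => // i x.
  by have [[? _] [? _]] := cdiff_cst (0 : R[i]) (basis_vec R i) x.
have -> : cpartials l (fun=> 0 : R[i]) = (fun _ : 'rV[R]_n => 0).
  elim: l => //= a l ->; apply/funext => x; apply: cdiff_cpartial; exact: cdiff_cst.
by exists 0 => // _ x; rewrite normc0 mulr0 mul0r.
Qed.

Lemma sch_sum (J : Type) (r : seq J) (F : J -> 'rV[R]_n -> R[i]) :
  (forall j, sch (F j)) -> sch (fun x => \sum_(j <- r) F j x).
Proof.
move=> sF; elim: r => [|j r ih].
  by under eq_fun do rewrite big_nil; exact: sch0.
by under eq_fun do rewrite big_cons; exact: schD.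
Qed.

Lemma sch_conj f : sch f -> sch (fun x => conjc (f x)).
Proof.
move=> sf; apply: (@bfam_coind _ _ _ _ (fun w => exists2 f, sch f & w = fun _ x => conjc (f x)));
  last by exists f.
move=> _ {sf f}[f sf ->]; split=> [i||a].
- have [c1 c2] := bfam_continuous tt sf; split => x.
    rewrite (_ : re_fun _ = re_fun f); first exact: c1.
    by apply/funext => y; rewrite /re_fun; case: (f y).
  rewrite (_ : im_fun _ = (fun y => - im_fun f y)); last first.
    by apply/funext => y; rewrite /im_fun; case: (f y).
  by apply: continuousN; exact: c2.
- move=> N; have [C C0 h] := bfam_bound sf N.
  by exists C => // i x; rewrite normc_conj; exact: (h i x).
- exists (fun _ x => conjc (cpartial a f x)); first by exists (cpartial a f) => //; exact: (bfam_partial a sf).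
  by move=> i x; apply: cdiff_conj; exact: (bfam_cdiff tt _ _ sf).
Qed.

Lemma sch_affine (r : R) (b : 'rV[R]_n) f : r != 0 -> sch f -> sch (fun x => f (r *: x + b)).
Proof.
move=> r0 sf.
apply: (@bfam_coind _ _ _ _ (fun w => exists2 f, sch f & w = fun _ x => f (r *: x + b)));
  last by exists f.
move=> _ {sf f}[f sf ->]; split=> [i||a].
- have ca : continuous (fun x : 'rV[R]_n => r *: x + b).
    move=> x; apply: continuousD; last exact: cst_continuous.
    by apply: scaler_continuous.
  have [c1 c2] := bfam_continuous tt sf; split => x.
    exact: (continuous_comp (ca x) (c1 _)).
  exact: (continuous_comp (ca x) (c2 _)).
- move=> N; have [C C0 h] := bfam_bound sf N.
  (* [jap x] is at most [1 + |1/r|] times [jap (r *: x)], and undoing the shift by [b] costs a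
     factor [jap b]. *)
  pose D := (1 + `|r^-1|) ^+ N * jap b ^+ N.
  have D0 : 0 <= D by apply: mulr_ge0; apply: exprn_ge0; rewrite ?jap_ge0 ?addr_ge0.
  exists (D * C); first by rewrite mulr_ge0.
  move=> i x; rewrite mulr1.
  have := h tt (r *: x + b); rewrite mulr1 => hx.
  apply: le_trans (ler_wpM2l D0 hx); rewrite mulrA ler_wpM2r ?normc_ge0//.
  have r10 : 0 <= 1 + `|r^-1| by rewrite addr_ge0.
  rewrite /D -!exprMn lerXn2r ?nnegrE ?jap_ge0//; first by rewrite !mulr_ge0 ?jap_ge0.
  have jZ (c : R) (y : 'rV[R]_n) : jap (c *: y) <= (1 + `|c|) * jap y.
    rewrite /jap mulrDr mulr1 lerD ?lerDl// mulr_sumr ler_sum// => j _.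
    by rewrite rVZ normrM ler_wpM2r// lerDr.
  apply: le_trans (_ : (1 + `|r^-1|) * jap (r *: x) <= _).
    by have := jZ r^-1 (r *: x); rewrite scalerA mulVf// scale1r.
  by rewrite -mulrA ler_wpM2l ?addr_ge0// mulrC; exact: japB.
- exists (fun _ x => r%:C * cpartial a f (r *: x + b)).
    exists (fun y => r%:C * cpartial a f y) => //.
    exact/schZ/(bfam_partial a sf).
  move=> i x; have /cdiffP H := bfam_cdiff tt a (r *: x + b) sf.
  apply/cdiffP => e e0.
  have er0 : 0 < e / `|r| by rewrite divr_gt0// normr_gt0.
  have [dl dl0 {}H] := H _ er0; exists (dl / `|r|); first by rewrite divr_gt0// normr_gt0.
  move=> h; rewrite ler_pdivlMr ?normr_gt0// -normrM => hd.
  have -> : r *: (x + h *: basis_vec R a) + b = r *: x + b + (h * r) *: basis_vec R a.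
    by rewrite scalerDr scalerA (mulrC h) addrAC.
  have := H _ hd; rewrite rmorphM/= mulrA => /le_trans; apply.
  by rewrite normrM (mulrC `|h|) mulrA divfK ?normr_eq0.
Qed.

End schwartz_family.

(** * Tensor products of Schwartz functions on the line *)

Section tensor.
Variable R : realType.
Implicit Types (a b : 'rV[R]_1 -> R[i]).

Definition i1 : 'I_2 := lift ord0 ord0.

Definition tens a b (z : 'rV[R]_2) : R[i] := a (rV1 (z ord0 ord0)) * b (rV1 (z ord0 i1)).

Lemma tens_cons a b (x : R) (y : 'rV[R]_1) : tens a b (rV_cons (x, y)) = a (rV1 x) * b y.
Proof. by rewrite /tens rV_cons0 rV_consS rV1K. Qed.

Lemma rV1D (s t : R) : rV1 (s + t) = rV1 s + rV1 t.
Proof. by apply/rowP => i; rewrite rVD !rV1E. Qed.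

Lemma rV1_basis (h : R) : rV1 h = h *: basis_vec R ord0.
Proof. by apply/rowP => i; rewrite rVZ rV1E /basis_vec mxE !ord1 !eqxx mulr1. Qed.

Lemma continuous_rV1 : continuous (@rV1 R : R -> 'rV[R]_1).
Proof.
move=> t; apply/cvg_ballP => e e0; apply/nbhs_ballP; exists e => // s ts.
by split => // i j; rewrite (ord1 i) !rV1E.
Qed.

(** The [+ 1] keeps the denominator positive when [w] vanishes. The factor [h] serves increments; it
    is taken to be 1 for limits. *)
Lemma normc_le_div (z w : R[i]) (e h : R) : 0 <= e -> 0 <= h ->
  normc z <= e / (normc w + 1) * h -> normc (z * w) <= e * h.
Proof.
move=> e0 h0 zh; have w0 := normc_ge0 w; have w1 : 0 < normc w + 1 by rewrite ltr_wpDl.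
rewrite normcM (le_trans (ler_wpM2r w0 zh))// mulrAC ler_wpM2r// -mulrA ler_piMr//.
by rewrite mulrC ler_pdivrMr// mul1r lerDl.
Qed.

(** A partial derivative of a tensor product differentiates one factor only, so the class of all
    tensor products of Schwartz functions is stable under it. *)
Lemma sch_tens a b : sch a -> sch b -> sch (tens a b).
Proof.
move=> sa sb.
apply: (@bfam_coind _ _ _ _ (fun w => exists a b, [/\ sch a, sch b & w = fun _ => tens a b]));
  last by exists a, b.
move=> _ {sa sb a b}[a [b [sa sb ->]]]; split=> [i||c].
- have [a1 a2] := bfam_continuous tt sa; have [b1 b2] := bfam_continuous tt sb.
  have cc (f : 'rV[R]_1 -> R) k : continuous f ->
      continuous (fun z : 'rV[R]_2 => f (rV1 (z ord0 k))).
    move=> cf z; apply: (@continuous_comp _ _ _ (fun z : 'rV[R]_2 => rV1 (z ord0 k)) f).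
      apply: (@continuous_comp _ _ _ (fun z : 'rV[R]_2 => z ord0 k) (@rV1 R)).
        exact: coord_continuous.
      exact: continuous_rV1.
    exact: cf.
  pose a1' (z : 'rV[R]_2) := re_fun a (rV1 (z ord0 ord0)).
  pose a2' (z : 'rV[R]_2) := im_fun a (rV1 (z ord0 ord0)).
  pose b1' (z : 'rV[R]_2) := re_fun b (rV1 (z ord0 i1)).
  pose b2' (z : 'rV[R]_2) := im_fun b (rV1 (z ord0 i1)).
  split => z.
    rewrite (_ : re_fun _ = a1' \* b1' \- a2' \* b2'); last first.
      by apply/funext => y; exact: cReM.
    by apply: continuousB; apply: continuousM; exact: cc.
  rewrite (_ : im_fun _ = a1' \* b2' \+ a2' \* b1'); last first.
    by apply/funext => y; exact: cImM.
  by apply: continuousD; apply: continuousM; exact: cc.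
- move=> N; have [A A0 hA] := bfam_bound sa N; have [B B0 hB] := bfam_bound sb N.
  exists (A * B); first exact: mulr_ge0.
  move=> i z; rewrite /tens normcM mulr1.
  have hA' := hA i (rV1 (z ord0 ord0)); have hB' := hB i (rV1 (z ord0 i1)).
  rewrite mulr1 in hA'; rewrite mulr1 in hB'.
  have jx : jap z <= jap (rV1 (z ord0 ord0)) * jap (rV1 (z ord0 i1)).
    rewrite /jap big_ord_recl !big_ord1 !rV1E.
    have : 0 <= `|z ord0 ord0| * `|z ord0 i1| by rewrite mulr_ge0.
    by rewrite /i1; lra.
  apply: le_trans (ler_pM _ _ hA' hB').
  - rewrite mulrACA ler_wpM2r ?mulr_ge0 ?normc_ge0// -exprMn.
    by rewrite lerXn2r ?nnegrE ?jap_ge0 ?mulr_ge0 ?jap_ge0.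
  - by rewrite mulr_ge0 ?normc_ge0 ?exprn_ge0 ?jap_ge0.
  - by rewrite mulr_ge0 ?normc_ge0 ?exprn_ge0 ?jap_ge0.
- case: (unliftP ord0 c) => [j|] ->.
    exists (fun _ => tens a (cpartial ord0 b)).
      by exists a, (cpartial ord0 b); split => //; exact: (bfam_partial _ sb).
    move=> i z; have /cdiffP H := bfam_cdiff tt ord0 (rV1 (z ord0 i1)) sb.
    apply/cdiffP => e e0.
    have e0' : 0 < e / (normc (a (rV1 (z ord0 ord0))) + 1).
      by rewrite divr_gt0// ltr_wpDl ?normc_ge0.
    have [dl dl0 {}H] := H _ e0'; exists dl => // h /H {}H.
    rewrite (_ : tens _ _ _ - _ - _ = (b (rV1 (z ord0 i1) + h *: basis_vec R ord0) -
      b (rV1 (z ord0 i1)) - h%:C * cpartial ord0 b (rV1 (z ord0 i1))) * a (rV1 (z ord0 ord0))).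
      by apply: normc_le_div H => //; exact: ltW.
    rewrite /tens !rVD !rVZ /basis_vec !mxE /=.
    have -> : (i1 == lift ord0 j) = true by rewrite (ord1 j).
    by rewrite !mulr0 mulr1 addr0 rV1D -rV1_basis; ring.
  exists (fun _ => tens (cpartial ord0 a) b).
    by exists (cpartial ord0 a), b; split => //; exact: (bfam_partial _ sa).
  move=> i z; have /cdiffP H := bfam_cdiff tt ord0 (rV1 (z ord0 ord0)) sa.
  apply/cdiffP => e e0.
  have e0' : 0 < e / (normc (b (rV1 (z ord0 i1))) + 1).
    by rewrite divr_gt0// ltr_wpDl ?normc_ge0.
  have [dl dl0 {}H] := H _ e0'; exists dl => // h /H {}H.
  rewrite (_ : tens _ _ _ - _ - _ = (a (rV1 (z ord0 ord0) + h *: basis_vec R ord0) -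
    a (rV1 (z ord0 ord0)) - h%:C * cpartial ord0 a (rV1 (z ord0 ord0))) * b (rV1 (z ord0 i1))).
    by apply: normc_le_div H => //; exact: ltW.
  rewrite /tens !rVD !rVZ /basis_vec !mxE /=.
  by rewrite !mulr0 mulr1 addr0 rV1D -rV1_basis; ring.
Qed.

End tensor.

(** * Fourier transform *)

Section fourier_transform.
Variables (R : realType) (n : nat).
Local Notation mu := (lebesgue_rV R n).
Implicit Types (f g : 'rV[R]_n -> R[i]) (x xi : 'rV[R]_n) (s : R).

Lemma dotC x xi : euclid_dot x xi = euclid_dot xi x.
Proof. by apply: eq_bigr => i _; rewrite mulrC. Qed.

Lemma dotDr x xi eta : euclid_dot x (xi + eta) = euclid_dot x xi + euclid_dot x eta.
Proof. by rewrite -big_split; apply: eq_bigr => i _; rewrite rVD mulrDr. Qed.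

Lemma dotDl x xi eta : euclid_dot (xi + eta) x = euclid_dot xi x + euclid_dot eta x.
Proof. by rewrite dotC dotDr !(dotC x). Qed.

Lemma dot_basis x (h : R) a : euclid_dot x (h *: basis_vec R a) = h * x ord0 a.
Proof.
rewrite /euclid_dot (bigD1 a)//= big1 ?addr0; last first.
  by move=> i ia; rewrite rVZ /basis_vec mxE eqxx/= (negbTE ia) !mulr0.
by rewrite rVZ /basis_vec mxE !eqxx/= mulr1 mulrC.
Qed.

Lemma dot_le x xi : `|euclid_dot x xi| <= jap x * (jap xi - 1).
Proof.
rewrite /jap [1 + \sum_(i < n) `|xi _ _|]addrC addrK mulr_sumr.
apply: (le_trans (ler_norm_sum _ _ _)); apply: ler_sum => i _.
by rewrite normrM ler_wpM2r//; exact: coord_le_jap.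
Qed.

Definition wtint : R := \int[mu]_x wt x.

Lemma wtint_ge0 : 0 <= wtint.
Proof. by apply: Rintegral_ge0 => x _; exact: wt_ge0. Qed.

Lemma rapid_wt f (C : R) : (forall x, jap x ^+ (n * 2) * normc (f x) <= C) ->
  forall x, normc (f x) <= C * wt x.
Proof.
move=> fC x; have j0 : 0 < jap x ^+ (n * 2) by rewrite exprn_gt0// jap_gt0.
have C0 : 0 <= C by apply: le_trans (fC x); rewrite mulr_ge0 ?normc_ge0 ?ltW.
apply: le_trans (_ : C * jap x ^- (n * 2) <= _); last by rewrite ler_wpM2l ?jap_wt.
by rewrite ler_pdivlMr// mulrC.
Qed.

Lemma integrable_Cwt (C : R) : mu.-integrable setT (EFin \o (fun x => C * wt x)).
Proof.
rewrite (_ : _ \o _ = (fun x => C%:E * (EFin \o @wt R n) x)%E)//.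
by apply: integrableZl => //; exact: integrable_wt.
Qed.

Lemma cint_wt_le f (C : R) : cmfun f -> (forall x, normc (f x) <= C * wt x) ->
  normc (cint mu f) <= 2 * (C * wtint).
Proof.
move=> mf fC; rewrite /wtint -RintegralZl//; last exact: integrable_wt.
by apply: cint_normc_le_bound => //; exact: integrable_Cwt.
Qed.

Lemma cmfun_sch f : sch f -> cmfun f.
Proof. by move=> /(bfam_continuous tt)[]; exact: continuous_cmeasurable. Qed.

Lemma cintb_rapid f (C : R) : cmfun f -> (forall x, normc (f x) <= C * wt x) -> cintb mu f.
Proof. by move=> mf; apply: cintb_le => //; exact: integrable_Cwt. Qed.

Lemma sch_wt f : sch f -> exists2 C : R, 0 <= C & forall x, normc (f x) <= C * wt x.
Proof.
move=> sf; have [C C0 h] := bfam_bound sf (n * 2)%N; exists C => //.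
by apply: rapid_wt => x; have := h tt x; rewrite mulr1.
Qed.

Lemma cintb_sch f : sch f -> cintb mu f.
Proof.
by move=> sf; have [C _ h] := sch_wt sf; apply: (cintb_rapid _ h); exact: cmfun_sch.
Qed.

(* [s = -1] is the Fourier transform and [s = 1] its inverse up to a constant. *)
Definition Fs s f xi : R[i] := cint mu (fun x => cis (s * euclid_dot x xi) * f x).

Lemma cmfun_cis_dot s xi : cmfun (fun x => cis (s * euclid_dot x xi)).
Proof. by apply: cmfun_cis; apply: measurable_funM => //; exact: measurable_euclid_dot. Qed.

Lemma cintb_Fs s f xi : cintb mu f -> cintb mu (fun x => cis (s * euclid_dot x xi) * f x).
Proof.
move=> fi; apply: (cintbM_bounded fi (cmfun_cis_dot s xi)) => x.
by rewrite normc_cis.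
Qed.

Lemma Fs_bound (I : Type) (eps : I -> R) (u : I -> 'rV[R]_n -> R[i]) s :
  (forall i, 0 <= eps i) -> sfam eps u ->
  exists2 C : R, 0 <= C & forall i xi, normc (Fs s (u i) xi) <= C * eps i.
Proof.
move=> e0 su; have [C C0 h] := bfam_bound su (n * 2)%N.
exists (2 * (C * wtint)); first by rewrite !mulr_ge0 ?wtint_ge0.
move=> i xi; rewrite [leRHS](_ : _ = 2 * (C * eps i * wtint)); last by ring.
apply: cint_wt_le.
  by apply: cmfunM (cmfun_cis_dot s xi) _; exact: cmfun_sch (sfam_sch i su).
by move=> x; rewrite normcM normc_cis mul1r; apply: rapid_wt => {}x; exact: h.
Qed.

Lemma sch_coordM a f : sch f -> sch (fun x => (x ord0 a)%:C * f x).
Proof.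
move=> sg; have := @sfamM _ _ _ _ _ _ _ (fun=> ler01) (fun=> ler01) (mfam_coord R unit a) sg.
by rewrite (_ : (fun i => 1 * 1) = (fun=> 1))//; apply/funext => i; rewrite mulr1.
Qed.

(** Differentiation under the integral sign: the remainder of [cis] is quadratic in [h * x_a], and
    [x_a^2 * f] is again a Schwartz function. *)
Lemma Fs_cdiff s f a xi : sch f ->
  cdiff (Fs s f) (basis_vec R a) xi (Fs s (fun x => (0 +i* s) * ((x ord0 a)%:C * f x)) xi).
Proof.
move=> sf; have sxf := @sch_coordM a.
have sxxf := sxf _ (sxf _ sf).
have [C C0 hC] := sch_wt sxxf.
apply: (@cdiff_quadratic _ _ _ _ _ _ (2 * (2 * s ^+ 2 * C * wtint))) => h _.
have i1 := cintb_Fs s (xi + h *: basis_vec R a) (cintb_sch sf).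
have i2 := cintb_Fs s xi (cintb_sch sf).
have i3 := cintb_Fs s xi (cintbZ (0 +i* s) (cintb_sch (sxf _ sf))).
rewrite /Fs -cintZ// -cintB// -cintB//; [|exact: cintbB|exact: cintbZ].
rewrite [leRHS](_ : _ = 2 * (2 * (s * h) ^+ 2 * C * wtint)); last by ring.
apply: cint_wt_le.
  exact: cintb_cmfun (cintbB (cintbB i1 i2) (cintbZ h%:C i3)).
move=> x; rewrite dotDr dot_basis mulrDr cisD.
rewrite (_ : _ - _ - _ = cis (s * euclid_dot x xi) *
   ((cis (s * h * x ord0 a) - 1 - (0 +i* (s * h * x ord0 a))) * f x)); last first.
  rewrite mulrA (_ : 0 +i* (s * h * x ord0 a) = h%:C * (0 +i* s) * (x ord0 a)%:C); last first.
    by apply: complexP; rewrite /=; ring.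
  ring.
rewrite normcM normc_cis mul1r normcM.
apply: le_trans (ler_wpM2r (normc_ge0 _) (cis_taylor2 _)) _.
have := hC x; rewrite !normcM normc_real => hCx.
have -> : 2 * (s * h * x ord0 a) ^+ 2 * normc (f x) =
    2 * (s * h) ^+ 2 * (`|x ord0 a| * (`|x ord0 a| * normc (f x))).
  by rewrite exprMn -[x ord0 a ^+ 2]real_normK ?num_real//; ring.
by rewrite -[leRHS]mulrA ler_wpM2l// mulr_ge0// sqr_ge0.
Qed.

(** The remainder at [x] involves the second derivative at points [x + t v] with [|t| <= 1]. There
    [jap x <= 2 * jap (x + t v)], whence the power [2 ^+ (n * 2)] in the constant. *)
Lemma sch_taylor a f : sch f -> exists2 C : R, 0 <= C & forall h x, `|h| <= 1 ->
  normc (f (x + h *: basis_vec R a) - f x - h%:C * cpartial a f x) <= C * h ^+ 2 * wt x.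
Proof.
move=> sf.
have s2 := bfam_partial a (bfam_partial a sf).
have [C C0 hC] := bfam_bound s2 (n * 2)%N.
exists (2 * (2 ^+ (n * 2) * C)); first by rewrite !mulr_ge0 ?exprn_ge0.
move=> h x h1; set v := basis_vec R a.
rewrite mulrAC.
have -> : 2 * (2 ^+ (n * 2) * C) * wt x * h ^+ 2 = 2 * (2 ^+ (n * 2) * C * wt x) * h ^+ 2.
  by ring.
apply: (@cdiff_taylor2 _ _ f v x (cpartial a f) (cpartial a (cpartial a f))).
- by move=> y; exact: (bfam_cdiff tt a y sf).
- by move=> y; exact: (bfam_cdiff tt a y (bfam_partial a sf)).
move=> t th; have := hC tt (x + t *: v); rewrite mulr1.
have jt : jap (t *: v) <= 2.
  rewrite /jap (bigD1 a)//= big1 => [|i ia].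
    by rewrite rVZ /v /basis_vec mxE !eqxx/= mulr1 addr0 mulr2n lerD2l (le_trans th).
  by rewrite rVZ /v /basis_vec mxE eqxx/= (negbTE ia) mulr0 normr0.
have jx : jap x <= 2 * jap (x + t *: v).
  by rewrite mulrC (le_trans (japB x (t *: v)))// ler_wpM2l ?jap_ge0.
set z := cpartial _ _ _ => hz.
have : jap x ^+ (n * 2) * normc z <= 2 ^+ (n * 2) * C.
  apply: le_trans (ler_wpM2l _ hz); last by rewrite exprn_ge0.
  rewrite mulrA ler_wpM2r ?normc_ge0// -exprMn lerXn2r ?nnegrE ?jap_ge0//.
  by rewrite mulr_ge0 ?jap_ge0.
have j0 : 0 < jap x ^+ (n * 2) by rewrite exprn_gt0// jap_gt0.
rewrite mulrC -ler_pdivlMr// => /le_trans; apply.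
by rewrite ler_wpM2l ?jap_wt// mulr_ge0// exprn_ge0.
Qed.

Lemma Fs_translate s f (b : 'rV[R]_n) xi : cintb mu f ->
  Fs s f xi = cis (s * euclid_dot b xi) * Fs s (fun x => f (x + b)) xi.
Proof.
move=> fi; have mf := cintb_cmfun fi; rewrite /Fs.
have trE A : measurable A -> mu A = mu ((fun x => x + b) @^-1` A) by exact: lebesgue_rV_translation.
rewrite (cint_image (measurable_rV_add b) trE); last first.
  by apply: cmfunM mf; exact: cmfun_cis_dot.
have fbi : cintb mu (fun x => f (x + b)) by apply: (cintb_image (measurable_rV_add b) trE mf).1.
rewrite -cintZ; last exact: cintb_Fs.
by apply: eq_cint => x; rewrite dotDl mulrDr cisD; ring.
Qed.

(** Integration by parts, obtained from translation invariance. Translating [f] by [h] along the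
    [a]-th axis multiplies the transform [w] by [cis (k * h)]. The function [cis (k * h) * w] of [h]
    thus has at 0 the derivative [D], by the Taylor estimate for [f], and also the derivative
    [i k w], by that for [cis]; derivatives are unique. *)
Lemma Fs_partial s f a xi : sch f ->
  Fs s (cpartial a f) xi = - ((0 +i* (s * xi ord0 a)) * Fs s f xi).
Proof.
move=> sf; have [C C0 hC] := sch_taylor a sf.
set v := basis_vec R a; set D := Fs s (cpartial a f) xi; set w := Fs s f xi.
have spf : sch (cpartial a f) by exact: (bfam_partial a sf).
pose k := - (s * xi ord0 a).
have key h : `|h| <= 1 -> normc ((cis (k * h) - 1) * w - h%:C * D) <= 2 * (C * h ^+ 2 * wtint).
  move=> h1.
  have mv := measurable_rV_add (h *: v).
  have trE A : measurable A -> mu A = mu ((fun x => x + h *: v) @^-1` A).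
    exact: lebesgue_rV_translation.
  have mf := cmfun_sch sf.
  have fhi : cintb mu (fun x => f (x + h *: v)).
    by apply: (cintb_image mv trE mf).1; exact: cintb_sch.
  have -> : (cis (k * h) - 1) * w - h%:C * D =
      Fs s (fun x => f (x + h *: v) - f x - h%:C * cpartial a f x) xi.
    have e := Fs_translate s (h *: v) xi (cintb_sch sf).
    have ww : cis (k * h) * w = Fs s (fun x => f (x + h *: v)) xi.
      rewrite /w e mulrA -cisD (dotC (h *: v)) dot_basis (_ : _ + _ = 0) ?cis0 ?mul1r//.
      by rewrite /k; ring.
    rewrite mulrBl mul1r ww /w /D /Fs -cintZ; last exact/cintb_Fs/cintb_sch.
    rewrite -cintB; [|exact: cintb_Fs|exact/cintb_Fs/cintb_sch].
    rewrite -cintB; last 2 first.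
    - by apply: cintbB; [exact: cintb_Fs|exact/cintb_Fs/cintb_sch].
    - exact/cintbZ/cintb_Fs/cintb_sch.
    by apply: eq_cint => x; ring.
  apply: cint_wt_le.
    apply: cmfunM; first exact: cmfun_cis_dot.
    apply: cmfunB; first by apply: cmfunB => //; exact: cintb_cmfun fhi.
    by apply: cmfunM; [exact: cmfun_cst|exact: cmfun_sch].
  by move=> x; rewrite normcM normc_cis mul1r; exact: hC.
have e0 : (0 : 'rV[R]_1) ord0 ord0 = 0 by rewrite mxE.
have eb (h : R) : (0 + h *: basis_vec R ord0 : 'rV[R]_1) ord0 ord0 = h.
  by rewrite add0r rVZ mxE !eqxx mulr1.
(* A function on R^1 stands for the function of the real variable [h], so that [cdiff_cpartial]
   provides uniqueness of the derivative. *)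
have dcis : cdiff (fun y : 'rV[R]_1 => cis (k * y ord0 ord0) * w) (basis_vec R ord0) 0 D.
  apply: (@cdiff_quadratic _ _ _ _ _ _ (2 * (C * wtint))) => h h1.
  rewrite eb e0 mulr0 cis0.
  by rewrite -mulrBl (le_trans (key _ h1))// le_eqVlt; apply/orP; left; apply/eqP; ring.
have dcis' : cdiff (fun y : 'rV[R]_1 => cis (k * y ord0 ord0) * w) (basis_vec R ord0) 0
    ((0 +i* k) * w).
  apply: (@cdiff_quadratic _ _ _ _ _ _ (2 * k ^+ 2 * normc w)) => h h1.
  rewrite eb e0 mulr0 cis0.
  rewrite mulrA -!mulrBl normcM mulrAC ler_wpM2r ?normc_ge0//.
  rewrite (_ : h%:C * (0 +i* k) = 0 +i* (k * h)); last by apply: complexP => /=; ring.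
  by rewrite -mulrA -exprMn; exact: cis_taylor2.
rewrite -(cdiff_cpartial dcis) (cdiff_cpartial dcis') -mulNr; congr (_ * _).
by apply: complexP => /=; rewrite ?oppr0.
Qed.

(** The difference of the phases costs a factor [jap x], hence decay of order [2n + 1] instead of
    [2n]. *)
Lemma Fs_lipschitz s f : sch f -> exists2 C : R, 0 <= C &
  forall xi eta, normc (Fs s f (xi + eta) - Fs s f xi) <= C * (jap eta - 1).
Proof.
move=> sf; have [C C0 hC] := bfam_bound sf (n * 2).+1.
exists (2 * (2 * `|s| * C * wtint)); first by rewrite !mulr_ge0 ?wtint_ge0.
move=> xi eta; rewrite /Fs -cintB; [|exact/cintb_Fs/cintb_sch|exact/cintb_Fs/cintb_sch].
have e0 : 0 <= jap eta - 1 by rewrite subr_ge0 jap_ge1.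
rewrite [leRHS](_ : _ = 2 * ((2 * `|s| * C * (jap eta - 1)) * wtint)); last by ring.
apply: cint_wt_le.
  by apply: cmfunB; apply: cmfunM (cmfun_cis_dot _ _) (cmfun_sch sf).
move=> x; rewrite dotDr mulrDr cisD.
rewrite (_ : _ - _ = cis (s * euclid_dot x xi) * ((cis (s * euclid_dot x eta) - 1) * f x)); last by ring.
rewrite normcM normc_cis mul1r normcM.
apply: le_trans (ler_wpM2r (normc_ge0 _) (cis_sub1_le _)) _.
rewrite normrM; apply: le_trans (_ : 2 * (`|s| * (jap x * (jap eta - 1))) * normc (f x) <= _).
  by rewrite ler_wpM2r ?normc_ge0// ler_wpM2l// ler_wpM2l// dot_le.
have -> : 2 * (`|s| * (jap x * (jap eta - 1))) * normc (f x) =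
  (2 * `|s| * (jap eta - 1)) * (jap x * normc (f x)) by ring.
have -> : 2 * `|s| * C * (jap eta - 1) * wt x = (2 * `|s| * (jap eta - 1)) * (C * wt x) by ring.
rewrite ler_wpM2l ?mulr_ge0//.
have j0 : 0 < jap x ^+ (n * 2) by rewrite exprn_gt0// jap_gt0.
apply: le_trans (_ : C * jap x ^- (n * 2) <= _); last by rewrite ler_wpM2l ?jap_wt.
rewrite ler_pdivlMr//; have := hC tt x; rewrite mulr1 exprS => /(le_trans _); apply.
by rewrite le_eqVlt; apply/orP; left; apply/eqP; ring.
Qed.

Lemma continuous_jap0 (xi : 'rV[R]_n) (e : R) : 0 < e ->
  \forall eta \near xi, jap (eta - xi) - 1 <= e.
Proof.
move=> e0; have en0 : 0 < e / n.+1%:R by rewrite divr_gt0.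
apply/nbhs_ballP; exists (e / n.+1%:R) => //= eta [_ /(_ ord0) h].
rewrite /jap addrC addKr.
apply: le_trans (_ : \sum_(i < n) (e / n.+1%:R) <= _).
  apply: ler_sum => i _; rewrite rVD rVN distrC; exact/ltW/h.
rewrite sumr_const card_ord -[leLHS]mulr_natl mulrCA; apply: ler_piMr; first exact: ltW.
by rewrite ler_pdivrMr// mul1r ler_nat.
Qed.

Lemma lipschitz_continuous f (C : R) : 0 <= C ->
  (forall xi eta, normc (f (xi + eta) - f xi) <= C * (jap eta - 1)) ->
  continuous (re_fun f) /\ continuous (im_fun f).
Proof.
move=> C0 fC; have H xi e : 0 < e -> \forall eta \near xi, normc (f eta - f xi) <= e.
  move=> e0; have eC : 0 < e / (C + 1) by rewrite divr_gt0// ltr_wpDl.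
  apply: filterS (continuous_jap0 xi eC) => eta he.
  have := fC xi (eta - xi); rewrite addrCA subrr addr0 => /le_trans; apply.
  apply: le_trans (_ : (C + 1) * (jap (eta - xi) - 1) <= _).
    by rewrite ler_wpM2r ?subr_ge0 ?jap_ge1// lerDl.
  by rewrite mulrC -ler_pdivlMr// ltr_wpDl.
have cont (g : 'rV[R]_n -> R) : (forall x y, `|g x - g y| <= normc (f x - f y)) -> continuous g.
  move=> gf xi; apply: (@cvgrPdist_le _ _ _ (nbhs xi) _ g (g xi)).2 => e e0.
  by apply: filterS (H xi e e0) => eta; apply: le_trans; rewrite distrC.
split; apply: cont => x y; rewrite /re_fun /im_fun.
  by rewrite (le_trans _ (normc_Re _))// cReD; case: (f y).
by rewrite (le_trans _ (normc_Im _))// cImD; case: (f y).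
Qed.

(** Differentiating the transform multiplies [u] by a coordinate, which preserves the class. Decay
    is proved by induction on the power [N], for all families at once: [jap] expands into 1 and the
    [|x_a|], and multiplying the transform by [x_a] amounts to transforming a partial derivative of
    [u]. *)
Lemma Fs_sfam (I : Type) (eps : I -> R) (u : I -> 'rV[R]_n -> R[i]) s : s != 0 ->
  (forall i, 0 <= eps i) -> sfam eps u -> sfam eps (fun i => Fs s (u i)).
Proof.
move=> s0 e0 su.
apply: (@bfam_coind _ _ _ _ (fun w => exists2 u, sfam eps u & w = fun i => Fs s (u i)));
  last by exists u.
move=> _ {su u}[u su ->]; split=> [i||a].
- have [C C0 h] := Fs_lipschitz s (sfam_sch i su).
  exact: lipschitz_continuous h.
- move=> N; elim: N u su => [|N ih] u su.
    by have [C C0 h] := Fs_bound s e0 su; exists C => // i x; rewrite expr0 mul1r.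
  have [C C0 hC] := ih _ su.
  have /choice[D HD] : forall a : 'I_n, exists D : R, 0 <= D /\ forall i x,
      jap x ^+ N * normc (Fs s (cpartial a (u i)) x) <= D * eps i.
    by move=> a; have [D D0 h] := ih _ (bfam_partial a su); exists D.
  exists (C + `|s|^-1 * \sum_(a < n) D a).
    by rewrite addr_ge0// mulr_ge0 ?invr_ge0// sumr_ge0// => a _; exact: (HD a).1.
  move=> i x; rewrite exprSr -mulrA [X in _ * (X * _)]/jap mulrDl mul1r mulrDr mulrDl.
  rewrite lerD// mulr_suml mulr_sumr mulr_sumr mulr_suml ler_sum// => a _.
  rewrite -mulrA ler_pdivlMl ?normr_gt0//.
  apply: le_trans ((HD a).2 i x); rewrite (Fs_partial s a x (sfam_sch i su)) normcN normcM.
  rewrite (_ : normc (0 +i* _) = `|s| * `|x ord0 a|); last first.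
    by rewrite /= expr0n/= add0r sqrtr_sqr normrM.
  by rewrite le_eqVlt; apply/orP; left; apply/eqP; ring.
- exists (fun i => Fs s (fun x => (0 +i* s) * ((x ord0 a)%:C * u i x))).
    exists (fun i x => (0 +i* s) * ((x ord0 a)%:C * u i x)) => //.
    apply: sfam_scale => //.
    have := @sfamM _ _ _ _ _ _ _ (fun=> ler01) e0 (mfam_coord R I a) su.
    by rewrite (_ : (fun i => 1 * eps i) = eps)//; apply/funext => i; rewrite mul1r.
  by move=> i x; apply: Fs_cdiff; exact: sfam_sch su.
Qed.

Lemma sch_Fs s f : s != 0 -> sch f -> sch (Fs s f).
Proof. by move=> s0 sf; exact: (Fs_sfam s0 (fun=> ler01) sf). Qed.

Lemma fourierE f : fourier f = Fs (-1) f.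
Proof. by apply/funext => xi; apply: eq_cint => x; rewrite mulN1r. Qed.

Lemma ifourierE f : ifourier f = fun x => ((2 * pi) ^- n)%:C * Fs 1 f x.
Proof.
by apply/funext => xi; congr (_ * _); apply: eq_cint => x; rewrite mul1r dotC.
Qed.

Lemma Fs_lin s a f g xi : cintb mu f -> cintb mu g ->
  Fs s (fun x => a * f x + g x) xi = a * Fs s f xi + Fs s g xi.
Proof.
move=> fi gi; rewrite /Fs -cintZ; last exact: cintb_Fs.
rewrite -cintD; [|exact/cintbZ/cintb_Fs|exact: cintb_Fs].
by apply: eq_cint => x; ring.
Qed.

Lemma FsZ s a f xi : cintb mu f -> Fs s (fun x => a * f x) xi = a * Fs s f xi.
Proof.
move=> fi; rewrite /Fs -cintZ; last exact: cintb_Fs.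
by apply: eq_cint => x; ring.
Qed.

End fourier_transform.

Section product_functions.
Context d1 d2 (T1 : measurableType d1) (T2 : measurableType d2) (R : realType).
Variable m1 : {sigma_finite_measure set T1 -> \bar R}.
Variable m2 : {sigma_finite_measure set T2 -> \bar R}.
Implicit Types (f : T1 -> R[i]) (g : T2 -> R[i]).

Lemma cmfun_fst f : cmfun f -> cmfun (fun z : T1 * T2 => f z.1).
Proof. by move=> mf; exact: cmfun_comp mf measurable_fst. Qed.

Lemma cmfun_snd g : cmfun g -> cmfun (fun z : T1 * T2 => g z.2).
Proof. by move=> mg; exact: cmfun_comp mg measurable_snd. Qed.

Lemma cintb_tensor f g : cintb m1 f -> cintb m2 g ->
  cintb (m1 \x m2)%E (fun z => f z.1 * g z.2).
Proof.
move=> fi gi; have mf := cintb_cmfun fi; have mg := cintb_cmfun gi.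
apply/cintb_prodP; first exact: cmfunM (cmfun_fst mf) (cmfun_snd mg).
rewrite (_ : (fun x => _) = (fun x => ((normc (f x))%:E * \int[m2]_y (normc (g y))%:E)%E)); last first.
  apply/funext => x /=; rewrite -ge0_integralZl//.
  - by apply: eq_integral => y _; rewrite normcM EFinM.
  - by apply/measurable_EFinP; exact: cmfun_normc.
  - by move=> y _; rewrite lee_fin normc_ge0.
  - by rewrite lee_fin normc_ge0.
have g0 : (0 <= \int[m2]_y (normc (g y))%:E)%E.
  by apply: integral_ge0 => y _; rewrite lee_fin normc_ge0.
have f0 : (0 <= \int[m1]_y (normc (f y))%:E)%E.
  by apply: integral_ge0 => y _; rewrite lee_fin normc_ge0.
rewrite ge0_integralZr//.
- by rewrite lte_mul_pinfty// ?ge0_fin_numE//; exact: cintb_lty.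
- by apply/measurable_EFinP; exact: cmfun_normc.
- by move=> y _; rewrite lee_fin normc_ge0.
Qed.

Lemma cint_tensor f g : cintb m1 f -> cintb m2 g ->
  cint (m1 \x m2)%E (fun z => f z.1 * g z.2) = cint m1 f * cint m2 g.
Proof.
move=> fi gi; rewrite cint_fubini1; last exact: cintb_tensor.
rewrite (mulrC (cint m1 f)) -cintZ//.
by apply: eq_cint => x /=; rewrite cintZ// mulrC.
Qed.

End product_functions.

Lemma conjcM (R : realType) (a b : R[i]) : conjc (a * b) = conjc a * conjc b.
Proof. exact: rmorphM. Qed.

Section conjugation.
Context d (T : measurableType d) (R : realType) (mu : {measure set T -> \bar R}).

Lemma cint_conj (f : T -> R[i]) : cintb mu f ->
  cint mu (fun x => conjc (f x)) = conjc (cint mu f).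
Proof.
move=> [f1 f2]; apply: complexP; rewrite /cint/=.
  by apply: eq_Rintegral => x _; case: (f x).
rewrite -mulN1r -RintegralZl//; apply: eq_Rintegral => x _.
by rewrite mulN1r; case: (f x).
Qed.

End conjugation.

(** * Multiplication formula, conjugation, shift and modulation *)

Section multiplication_formula.
Variables (R : realType) (n : nat).
Local Notation mu := (lebesgue_rV R n).
Implicit Types (f g : 'rV[R]_n -> R[i]).

Lemma Fs_mult s f g : cintb mu f -> cintb mu g ->
  cint mu (fun xi => Fs s f xi * g xi) = cint mu (fun x => f x * Fs s g x).
Proof.
move=> fi gi.
pose k (z : 'rV[R]_n * 'rV[R]_n) := cis (s * euclid_dot z.1 z.2) * (f z.1 * g z.2).
have ki : cintb (mu \x mu)%E k.
  apply: (@cintbM_bounded _ _ _ _ _ _ 1 (cintb_tensor fi gi)); last first.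
    by move=> z; rewrite normc_cis.
  apply: cmfun_cis; apply: measurable_funM => //.
  exact: measurable_euclid_dot measurable_fst measurable_snd.
have := cint_fubini2 ki; rewrite (cint_fubini1 ki) => e.
transitivity (cint mu (fun y => cint mu (fun x => k (x, y)))).
  apply: eq_cint => y; rewrite mulrC /Fs -cintZ; last exact: cintb_Fs.
  by apply: eq_cint => x; rewrite /k/=; ring.
rewrite -e; apply: eq_cint => x; rewrite /Fs -cintZ; last exact: cintb_Fs.
by apply: eq_cint => y; rewrite /k/= dotC; ring.
Qed.

Lemma conj_Fs s f xi : cintb mu f ->
  conjc (Fs s f xi) = Fs (- s) (fun x => conjc (f x)) xi.
Proof.
move=> fi; rewrite /Fs -cint_conj; last exact: cintb_Fs.
by apply: eq_cint => x; rewrite conjcM conj_cis mulNr.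
Qed.

Lemma Fs_shift s f (b : 'rV[R]_n) xi : cintb mu f ->
  Fs s (fun x => f (x + b)) xi = cis (- s * euclid_dot b xi) * Fs s f xi.
Proof.
move=> fi; rewrite (Fs_translate s b xi fi).
by rewrite mulrA -cisD -mulrDl addNr mul0r cis0 mul1r.
Qed.

Lemma Fs_modulate s t f (y xi : 'rV[R]_n) :
  Fs s (fun x => cis (s * t * euclid_dot x y) * f x) xi = Fs s f (xi + t *: y).
Proof.
apply: eq_cint => x; rewrite mulrA -cisD dotDr mulrDr; congr (cis (_ + _) * _).
rewrite -mulrA; congr (_ * _); rewrite /euclid_dot mulr_sumr.
by apply: eq_bigr => i _; rewrite rVZ; ring.
Qed.

End multiplication_formula.

(** * Fourier inversion on the line, up to a nonzero constant *)

Section inversion.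
Variable R : realType.
Local Notation mu := (lebesgue_rV R 1).
Implicit Types (f g w : 'rV[R]_1 -> R[i]) (s : R).

Lemma sch_near f (x : 'rV[R]_1) : sch f -> exists2 C : R, 0 <= C &
  forall h, `|h| <= 1 -> normc (f (x + rV1 h) - f x) <= C * `|h|.
Proof.
move=> sf; have [C C0 hC] := sch_taylor ord0 sf.
exists (C * wt x + normc (cpartial ord0 f x)); first by rewrite addr_ge0 ?mulr_ge0 ?wt_ge0 ?normc_ge0.
move=> h h1; have := hC h x h1; rewrite -rV1_basis => H.
rewrite -[X in normc X](subrK (h%:C * cpartial ord0 f x)) (le_trans (normcD _ _))// mulrDl lerD//.
  apply: (le_trans H); rewrite mulrAC ler_wpM2l ?mulr_ge0 ?wt_ge0//.
  by rewrite -[h ^+ 2]real_normK ?num_real// expr2 ler_piMl.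
by rewrite normcM normc_real mulrC.
Qed.

Lemma normc_lim_unique (u : nat -> R[i]) a b :
  (forall e, 0 < e -> \forall n \near \oo, normc (u n - a) <= e) ->
  (forall e, 0 < e -> \forall n \near \oo, normc (u n - b) <= e) -> a = b.
Proof.
move=> ua ub; apply/eqP; rewrite -subr_eq0 -normc_eq0.
rewrite eq_le normc_ge0 andbT; apply/ler_addgt0Pr => e e0; rewrite add0r.
have e20 : 0 < e / 2 by rewrite divr_gt0.
have [n [na nb]] : exists n, normc (u n - a) <= e / 2 /\ normc (u n - b) <= e / 2.
  have : \forall n \near \oo, normc (u n - a) <= e / 2 /\ normc (u n - b) <= e / 2.
    by apply: filterS2 (ua _ e20) (ub _ e20).
  by move=> /filter_ex.
rewrite (_ : a - b = (u n - b) - (u n - a)); last by ring.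
by rewrite (le_trans (normcB _ _))// (splitr e) lerD.
Qed.

Lemma sch_scale_cvg f (x : 'rV[R]_1) e : sch f -> 0 < e ->
  \forall n \near \oo, normc (f (n.+1%:R^-1 *: x) - f 0) <= e.
Proof.
move=> sf e0; have [C C0 hC] := sch_near 0 sf.
pose r := Num.min 1 (e / (C + 1)) / (`|x ord0 ord0| + 1).
have r0 : 0 < r by rewrite divr_gt0 ?lt_min ?ltr01 ?divr_gt0// ltr_wpDl.
have := near_infty_natSinv_lt (PosNum r0); apply: filterS => n /= nr.
have -> : n.+1%:R^-1 *: x = 0 + rV1 (n.+1%:R^-1 * x ord0 ord0).
  by apply/rowP => i; rewrite add0r rVZ rV1E (ord1 i).
have : `|n.+1%:R^-1 * x ord0 ord0| <= Num.min 1 (e / (C + 1)).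
  rewrite normrM ger0_norm ?invr_ge0// (le_trans (ler_wpM2r _ (ltW nr)))//.
  rewrite /r mulrAC ler_pdivrMr ?ltr_wpDl// ler_wpM2l ?lerDl//.
  by rewrite le_min ler01 divr_ge0 ?addr_ge0// ltW.
rewrite le_min => /andP[h1 hC']; apply: (le_trans (hC _ h1)).
apply: le_trans (_ : (C + 1) * `|n.+1%:R^-1 * x ord0 ord0| <= _).
  by rewrite ler_wpM2r// lerDl.
by rewrite mulrC -ler_pdivlMr// ltr_wpDl.
Qed.

Lemma sch_bounded m (f : 'rV[R]_m -> R[i]) : sch f -> exists2 C : R, 0 <= C & forall x, normc (f x) <= C.
Proof.
move=> sf; have [C C0 h] := bfam_bound sf 0%N; exists C => // x.
by have := h tt x; rewrite expr0 mul1r mulr1.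
Qed.

Lemma Fs_scale s w (N : R) (x : 'rV[R]_1) : 0 < N -> sch w ->
  Fs s (fun xi => w (N^-1 *: xi)) x = N%:C * Fs s w (N *: x).
Proof.
move=> N0 sw; have Nneq0 : N != 0 by rewrite gt_eqF.
have sw' : sch (fun xi => w (N^-1 *: xi)).
  have := @sch_affine R 1 N^-1 0 w _ sw; rewrite invr_eq0 => /(_ Nneq0).
  by under eq_fun do rewrite addr0.
have e xi : cis (s * euclid_dot (N *: xi) x) * w (N^-1 *: (N *: xi)) =
    cis (s * euclid_dot xi (N *: x)) * w xi.
  rewrite scalerA mulVf// scale1r /euclid_dot !big_ord1 !rVZ.
  by congr (cis _ * _); ring.
rewrite /Fs (cint_rV1_scale N0).
- by congr (_ * _); apply: eq_cint => xi; exact: e.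
- by apply: cmfunM (cmfun_cis_dot _ _) _; exact: cmfun_sch.
- rewrite (_ : (fun _ => _) = (fun xi => cis (s * euclid_dot xi (N *: x)) * w xi)); last first.
    by apply/funext => xi; exact: e.
  exact/cintb_Fs/cintb_sch.
Qed.

(* The multiplication formula for [w (x / N)] and [g], in the limit of large [N]. Applied to one
   fixed [w] it yields the inversion formula with an unevaluated constant, so that no Gaussian
   integral is needed. *)
Lemma inversion_symmetry s w g : s != 0 -> sch w -> sch g ->
  w 0 * cint mu (Fs s g) = g 0 * cint mu (Fs s w).
Proof.
move=> s0 sw sg; have sFg := sch_Fs s0 sg; have sFw := sch_Fs s0 sw.
have [Cg Cg0 hg] := sch_bounded sg; have [Cw Cw0 hw] := sch_bounded sw.
have sN (u : 'rV[R]_1 -> R[i]) (N : nat) : sch u -> sch (fun x => u (N.+1%:R^-1 *: x)).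
  move=> su; have Nneq0 : N.+1%:R^-1 != 0 :> R by rewrite invr_eq0.
  by have := @sch_affine R 1 _ 0 u Nneq0 su; under eq_fun do rewrite addr0.
have H (u v : 'rV[R]_1 -> R[i]) (C : R) : sch u -> (forall x, normc (u x) <= C) -> sch v ->
    forall e, 0 < e -> \forall N \near \oo,
    normc (cint mu (fun x => u (N.+1%:R^-1 *: x) * v x) - u 0 * cint mu v) <= e.
  move=> su hu sv.
  have C0 : 0 <= C by exact: le_trans (normc_ge0 _) (hu 0).
  have [|||||_] := @cint_dominated _ _ _ mu (fun N x => u (N.+1%:R^-1 *: x) * v x)
    (fun x => u 0 * v x) (fun x => C * normc (v x)).
  - by move=> N; apply: cmfunM (cmfun_sch (sN _ _ su)) (cmfun_sch sv).
  - by apply: cmfunM; [exact: cmfun_cst|exact: cmfun_sch].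
  - apply: (@integrableZl _ _ _ mu _ measurableT C (fun x => (normc (v x))%:E)).
    exact/cintb_normc/cintb_sch.
  - apply: nearW => x e e0.
    have e0' : 0 < e / (normc (v x) + 1) by rewrite divr_gt0// ltr_wpDl ?normc_ge0.
    apply: filterS (sch_scale_cvg x su e0') => N h.
    rewrite -mulrBl; have := @normc_le_div R (u (N.+1%:R^-1 *: x) - u 0) (v x) e 1 (ltW e0) ler01.
    by rewrite !mulr1; exact.
  - by move=> N; apply: nearW => x; rewrite normcM ler_wpM2r ?normc_ge0.
  by rewrite cintZ//; exact: cintb_sch.
have eN N : cint mu (fun xi => w (N.+1%:R^-1 *: xi) * Fs s g xi) =
    cint mu (fun x => g (N.+1%:R^-1 *: x) * Fs s w x).
  transitivity (cint mu (fun xi => Fs s g xi * w (N.+1%:R^-1 *: xi))).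
    by apply: eq_cint => x; rewrite mulrC.
  rewrite (Fs_mult s (cintb_sch sg) (cintb_sch (sN _ _ sw))).
  have N0 : 0 < N.+1%:R :> R by [].
  have N0' : 0 < N.+1%:R^-1 :> R by rewrite invr_gt0.
  rewrite (cint_rV1_scale N0').
  - rewrite -cintZ.
      apply: eq_cint => x; rewrite Fs_scale// scalerA divff ?gt_eqF// scale1r.
      have e : (N.+1%:R^-1)%:C * (N.+1%:R)%:C = 1 :> R[i].
        by rewrite -(rmorphM (real_complex R)) mulVf ?gt_eqF.
      by rewrite mulrCA; congr (_ * _); rewrite mulrA e mul1r.
    rewrite (_ : (fun _ => _) = (fun x => N.+1%:R%:C * (g (N.+1%:R^-1 *: x) * Fs s w x))).
      apply/cintbZ/(cintbM_bounded (cintb_sch sFw) (cmfun_sch (sN _ N sg)) (M := Cg)).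
      by move=> x; exact: hg.
    apply/funext => x; rewrite Fs_scale// scalerA divff ?gt_eqF// scale1r; ring.
  - apply: cmfunM (cmfun_sch sg) _; apply: cmfun_sch.
    exact/sch_Fs/sN.
  - apply: (cintbM_bounded _ (cmfun_sch (sN _ N sg)) (M := Cg)); last by move=> x; exact: hg.
    exact/cintb_sch/(sN _ N)/sch_Fs/sN.
apply: (@normc_lim_unique (fun N => cint mu (fun xi => w (N.+1%:R^-1 *: xi) * Fs s g xi))).
  exact: H hw sFg.
by move=> e e0; apply: filterS (H _ _ _ sg hg sFw e e0) => N; rewrite eN.
Qed.

(** Translating [g] moves the point of evaluation to 0, where [inversion_symmetry] applies; on the
    Fourier side the translation becomes the phase of the second transform. *)
Lemma Fs_inversion s w g (y : 'rV[R]_1) : s != 0 -> sch w -> w 0 = 1 -> sch g ->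
  Fs (- s) (Fs s g) y = cint mu (Fs s w) * g y.
Proof.
move=> s0 sw w1 sg.
have sgy : sch (fun x => g (x + y)).
  have := @sch_affine R 1 1 y g (oner_neq0 _) sg.
  by under eq_fun do rewrite scale1r.
have := inversion_symmetry s0 sw sgy; rewrite w1 mul1r add0r mulrC => <-.
apply: eq_cint => xi; rewrite Fs_shift; last exact: cintb_sch.
by rewrite dotC.
Qed.

(** If [f 0] were nonzero, [normc f] would stay above half of [normc (f 0)] on an interval around 0,
    and the integral of its square would be positive. *)
Lemma sch_square_eq0 f : sch f -> cint mu (fun x => f x * conjc (f x)) = 0 -> f 0 = 0.
Proof.
move=> sf f0; apply: contrapT => /eqP; rewrite -normc_eq0 => nf0.
have {nf0} p0 : 0 < normc (f 0) by rewrite lt0r nf0 normc_ge0.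
set m := normc (f 0) in p0.
have [C C0 hC] := sch_near 0 sf.
pose r := Num.min 1 (m / 2 / (C + 1)).
have r0 : 0 < r by rewrite lt_min ltr01 !divr_gt0// ltr_wpDl.
pose A := @box1 R r.
have mA : measurable A by exact: measurable_box1.
have muA : mu A = (2 * r)%:E by exact: lebesgue_box1.
have lb x : A x -> (m / 2) ^+ 2 <= normc (f x * conjc (f x)).
  move=> Ax; rewrite normcM normc_conj -expr2 lerXn2r ?nnegrE ?normc_ge0 ?divr_ge0 ?(ltW p0)//.
  move: Ax; rewrite /A /box1 /= /r le_min => /andP[x1 xC].
  have := hC _ x1; rewrite add0r rV1K => h.
  have : normc (f x - f 0) <= m / 2.
    apply: (le_trans h); apply: le_trans (_ : (C + 1) * `|x ord0 ord0| <= _).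
      by rewrite ler_wpM2r// lerDl.
    by rewrite mulrC -ler_pdivlMr// ltr_wpDl.
  have : m <= normc (f x) + normc (f x - f 0).
    by rewrite /m -{1}(_ : f x - (f x - f 0) = f 0) ?normcB//; ring.
  by move: (normc (f x)) (normc (f x - f 0)) => a b; lra.
have fi : cintb mu (fun x => f x * conjc (f x)).
  by apply: cintb_sch; exact: schM (sch_conj sf).
have : (((m / 2) ^+ 2 * (2 * r))%:E <= \int[mu]_x (normc (f x * conjc (f x)))%:E)%E.
  rewrite EFinM -muA -integral_cst//; rewrite [leLHS]integral_mkcond.
  apply: ge0_le_integral => //.
  - by move=> x _; rewrite /patch; case: ifP => // _; rewrite lee_fin sqr_ge0.
  - by apply/(measurable_restrictT _ mA); exact: measurable_cst.
  - by apply/measurable_EFinP/cmfun_normc; exact: cintb_cmfun fi.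
  - move=> x _; rewrite /patch; case: ifPn => [|_]; last by rewrite lee_fin normc_ge0.
    by rewrite inE lee_fin => /lb.
rewrite (_ : \int[mu]_x _ = 0)%E; last first.
  have e x : normc (f x * conjc (f x)) = complex.Re (f x * conjc (f x)).
    case: (f x) => a b /=; rewrite (_ : a * - b + b * a = 0); last by ring.
    rewrite expr0n/= addr0 sqrtr_sqr ger0_norm; first by ring.
    by rewrite mulrN opprK -!expr2 addr_ge0 ?sqr_ge0.
  under eq_integral do rewrite e.
  rewrite -[LHS]fineK; last exact: (integrable_fin_num measurableT fi.1).
  by have := congr1 (@complex.Re R) f0; rewrite /cint/= /Rintegral => ->.
rewrite lee_fin leNgt; apply/negP; rewrite negbK.
by rewrite !mulr_gt0 ?exprn_gt0 ?divr_gt0.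
Qed.

(** With a zero constant, [Fs (- s)] after [Fs s] vanishes. For the real function [b = |w|^2] the
    integral of [|Fs s b|^2] equals, by the multiplication formula, that of [b * Fs (- s) (Fs s b)],
    which is 0. Hence [Fs s b 0], the integral of [|w|^2], is 0, and so is [w 0]. *)
Lemma inversion_constant_neq0 s w : s != 0 -> sch w -> w 0 = 1 -> cint mu (Fs s w) != 0.
Proof.
move=> s0 sw w1; apply/eqP => c0.
pose b x := w x * conjc (w x).
have sb : sch b by exact: schM (sch_conj sw).
have sFb := sch_Fs s0 sb.
have bi := cintb_sch sb.
have : Fs s b 0 = 0.
  apply: sch_square_eq0 => //.
  have cb : (fun x => conjc (b x)) = b.
    by apply/funext => x; rewrite /b rmorphM/= conjcK mulrC.
  transitivity (cint mu (fun xi => Fs (- s) b xi * Fs s b xi)).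
    by apply: eq_cint => xi; rewrite conj_Fs// cb mulrC.
  rewrite Fs_mult//; last exact: cintb_sch.
  transitivity (cint mu (fun=> 0)); last exact: cint0.
  by apply: eq_cint => x; rewrite (Fs_inversion _ s0 sw)// c0 mul0r mulr0.
rewrite /Fs => F0.
have : w 0 = 0.
  apply: sch_square_eq0 => //; rewrite -[RHS]F0.
  apply: eq_cint => x; rewrite (_ : euclid_dot x 0 = 0) ?mulr0 ?cis0 ?mul1r//.
  by rewrite /euclid_dot big1// => i _; rewrite mxE mulr0.
by rewrite w1 => /eqP; rewrite oner_eq0.
Qed.

End inversion.

(** * Fourier transform of tensor products *)

Section tensor_fourier.
Variable R : realType.
Local Notation mu1 := (lebesgue_rV R 1).
Local Notation mu2 := (lebesgue_rV R 2).
Local Notation leb := (@lebesgue_measure R).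
Implicit Types a b : 'rV[R]_1 -> R[i].

Lemma mu2E (A : set 'rV[R]_2) : measurable A ->
  mu2 A = (leb \x mu1)%E (@rV_cons R 1 @^-1` A).
Proof. by []. Qed.

Lemma cint_mu2 (f : 'rV[R]_2 -> R[i]) : cmfun f ->
  cint mu2 f = cint (leb \x mu1)%E (fun z => f (rV_cons z)).
Proof. exact: (cint_image (@measurable_rV_cons R 1) mu2E). Qed.

Lemma cintb_mu2 (f : 'rV[R]_2 -> R[i]) : cmfun f ->
  cintb mu2 f <-> cintb (leb \x mu1)%E (fun z => f (rV_cons z)).
Proof. exact: (cintb_image (@measurable_rV_cons R 1) mu2E). Qed.

Lemma cint_mu1 (f : 'rV[R]_1 -> R[i]) : cmfun f ->
  cint mu1 f = cint leb (fun t => f (rV1 t)).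
Proof. exact: (cint_image (@measurable_rV1 R) (@lebesgue_rV1E R)). Qed.

Lemma cintb_mu1 (f : 'rV[R]_1 -> R[i]) : cmfun f ->
  cintb mu1 f <-> cintb leb (fun t => f (rV1 t)).
Proof. exact: (cintb_image (@measurable_rV1 R) (@lebesgue_rV1E R)). Qed.

Lemma dot_cons (x : R) (y : 'rV[R]_1) (xi : 'rV[R]_2) :
  euclid_dot (rV_cons (x, y)) xi =
  euclid_dot (rV1 x) (rV1 (xi ord0 ord0)) + euclid_dot y (rV1 (xi ord0 i1)).
Proof.
by rewrite /euclid_dot big_ord_recl !big_ord1 rV_cons0 rV_consS !rV1E.
Qed.

Lemma Fs_tens s a b : sch a -> sch b -> Fs s (tens a b) = tens (Fs s a) (Fs s b).
Proof.
move=> sa sb; apply/funext => xi; rewrite /tens.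
have ai := cintb_Fs s (rV1 (xi ord0 ord0)) (cintb_sch sa).
have bi := cintb_Fs s (rV1 (xi ord0 i1)) (cintb_sch sb).
rewrite [X in X * _]/Fs cint_mu1; last exact: cintb_cmfun ai.
rewrite -cint_tensor//; last exact: ((cintb_mu1 (cintb_cmfun ai)).1 ai).
rewrite /Fs cint_mu2; last first.
  by apply: cmfunM (cmfun_cis_dot _ _) _; exact: cmfun_sch (sch_tens sa sb).
apply: eq_cint => -[x y]; rewrite dot_cons mulrDr cisD.
rewrite rV_cons0 rV_consS rV1K /=; ring.
Qed.

End tensor_fourier.

(** * Dyadic resolutions *)

Section dyadic.
Variables (R : realType) (n : nat) (phi : nat -> 'rV[R]_n -> R[i]).
Hypothesis hphi : dyadic_resolution phi.

Lemma dyadic_sch j : sch (phi j).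
Proof. by case: hphi => h _ _ _ _; apply/schP. Qed.

Lemma dyadic_supp0 x : phi 0%N x != 0 -> euclid_norm x < 2.
Proof. by case: hphi => _ h _ _ _ px; apply: h; exact: subset_closure. Qed.

Lemma dyadic_suppS j x : phi j.+1 x != 0 -> 2 ^+ j <= euclid_norm x < 2 ^+ j.+2.
Proof.
case: hphi => _ _ h _ _ px; have := h j x.
case=> [|h1 h2]; first exact: subset_closure.
by rewrite h1 andbT leNgt; apply/negP.
Qed.

Lemma dyadic_supp j x : phi j x != 0 -> euclid_norm x < 2 ^+ j.+1.
Proof. by case: j => [/dyadic_supp0|j /dyadic_suppS/andP[]//]; rewrite expr1. Qed.

Lemma dyadic_far j J x : (J < j)%N -> euclid_norm x < 2 ^+ J -> phi j x = 0.
Proof.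
case: j => // j; rewrite ltnS => Jj xJ; apply/eqP; apply: contraTT xJ => /dyadic_suppS/andP[h _].
by rewrite -leNgt (le_trans _ h)// ler_weXn2l// ler1n.
Qed.

Definition partial_sum (J : nat) (x : 'rV[R]_n) : R[i] := \sum_(j < J.+1) phi j x.

(** On this ball every [phi j] with [J < j] vanishes, so the series is eventually constant and the
    partial sum is its limit. *)
Lemma partial_sum1 J x : euclid_norm x < 2 ^+ J -> partial_sum J x = 1.
Proof.
move=> xJ; case: hphi => _ _ _ _ /(_ x)[sre sim].
have tail N : (J < N)%N -> \sum_(j < N) phi j x = partial_sum J x.
  move=> /subnK <-; elim: (N - J.+1)%N => [|m ih]; first by rewrite add0n.
  by rewrite addSn big_ord_recr/= ih (dyadic_far _ xJ) ?addr0// ltn_addl.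
have lim (h : R[i] -> R) (l : R) : (forall z w, h (z + w) = h z + h w) -> h 0 = 0 ->
    series (fun j => h (phi j x)) @ \oo --> l -> h (partial_sum J x) = l.
  move=> hD h0 hl; rewrite -(cvg_lim _ hl)//; apply/esym; apply: lim_near_cst => //.
  near=> N; rewrite /series/= big_mkord.
  have -> : \sum_(k < N) h (phi k x) = h (\sum_(k < N) phi k x).
    by apply/esym; apply: (big_morph h).
  rewrite tail//; near: N; exact: nbhs_infty_gt.
by apply: complexP; [apply: (lim (@complex.Re R)) sre => //; exact: cReD|
  apply: (lim (@complex.Im R)) sim => //; exact: cImD].
Unshelve. all: by end_near. Qed.

(** Supplies the Schwartz function with value 1 at the origin from which both the inversion formula
    and the construction of test functions start. *)
Lemma dyadic00 : phi 0%N 0 = 1.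
Proof.
have n0 : euclid_norm (0 : 'rV[R]_n) < 2 ^+ 0.
  rewrite expr0 /euclid_norm (_ : euclid_dot _ _ = 0) ?sqrtr0//.
  by rewrite /euclid_dot big1// => i _; rewrite mxE mulr0.
by rewrite -(partial_sum1 n0) /partial_sum big_ord1.
Qed.

(** The sign of [s] covers two kinds of regions: [s = 1] describes an open ball, [s = -1] the
    exterior of a closed one. Both are open, which is why the derivative vanishes there. *)
Lemma cdiff_vanish (s t : R) (u : 'rV[R]_n -> R[i]) a x :
  (forall y, s * euclid_dot y y < t -> u y = 0) -> s * euclid_dot x x < t ->
  cdiff u (basis_vec R a) x 0.
Proof.
move=> u0 xt; apply/cdiffP => e e0.
(* For [|h| <= 1] the change of [s] times the squared norm, from [x] to [x + h *: basis_vec R a], is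
   at most [|h| * M]. *)
pose M := `|s| * (2 * `|x ord0 a| + 1) + 1.
have M0 : 0 < M by rewrite ltr_wpDl// mulr_ge0// addr_ge0// mulr_ge0.
exists (Num.min 1 ((t - s * euclid_dot x x) / 2 / M)).
  by rewrite lt_min ltr01 !divr_gt0// subr_gt0.
move=> h; rewrite le_min => /andP[h1 hM].
have -> : u (x + h *: basis_vec R a) = 0.
  apply: u0.
  have -> : euclid_dot (x + h *: basis_vec R a) (x + h *: basis_vec R a) =
      euclid_dot x x + 2 * (h * x ord0 a) + h * h.
    rewrite dotDr !dotDl !dot_basis (dotC (h *: _)) dot_basis rVZ /basis_vec mxE !eqxx/=.
    by rewrite mulr1; ring.
  have : s * (2 * (h * x ord0 a) + h * h) <= `|h| * M.
    rewrite (le_trans (ler_norm _))// normrM.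
    apply: le_trans (_ : `|s| * (`|h| * (2 * `|x ord0 a| + 1)) <= _).
      rewrite ler_wpM2l// (le_trans (ler_normD _ _))// !normrM (ger0_norm (_ : 0 <= 2))//.
      by rewrite mulrDr mulr1 mulrCA lerD2l ler_piMr.
    by rewrite /M mulrCA ler_wpM2l// lerDl.
  move: hM; rewrite ler_pdivlMr// => hM hs.
  have : s * (2 * (h * x ord0 a) + h * h) <= (t - s * euclid_dot x x) / 2 by exact: le_trans hM.
  rewrite -addrA (mulrDr s (euclid_dot x x)).
  move: (s * (_ + _)) (s * euclid_dot x x) xt => A B; lra.
by rewrite (u0 _ xt) mulr0 !subr0 normc0 mulr_ge0// ltW.
Qed.

Lemma cdiff_sum (J : Type) (r : seq J) (F : J -> 'rV[R]_n -> R[i]) v x (D : J -> R[i]) :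
  (forall j, cdiff (F j) v x (D j)) ->
  cdiff (fun y => \sum_(j <- r) F j y) v x (\sum_(j <- r) D j).
Proof.
move=> dF; elim: r => [|j r ih].
  rewrite big_nil; under [X in cdiff X]eq_fun do rewrite big_nil; exact: cdiff_cst.
rewrite big_cons; under [X in cdiff X]eq_fun do rewrite big_cons.
exact: cdiffD.
Qed.

Lemma cdiffB (u w : 'rV[R]_n -> R[i]) v x d d' : cdiff u v x d -> cdiff w v x d' ->
  cdiff (fun y => u y - w y) v x (d - d').
Proof.
move=> du dw; have := cdiffD du (cdiffM (cdiff_cst (-1) v x) dw).
rewrite mul0r add0r mulN1r; congr cdiff; apply/funext => y.
by rewrite mulN1r.
Qed.

Lemma euclid_norm_lt (r : R) (x : 'rV[R]_n) : 0 <= r ->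
  (euclid_norm x < r) = (euclid_dot x x < r ^+ 2).
Proof.
move=> r0; have d0 : 0 <= euclid_dot x x by rewrite sumr_ge0// => i _; rewrite -expr2 sqr_ge0.
rewrite /euclid_norm -{1}(ger0_norm r0) -sqrtr_sqr; have [r1|r1] := ltP 0 (r ^+ 2).
  by rewrite ltr_sqrt.
have -> : r ^+ 2 = 0 by apply/eqP; rewrite eq_le r1 sqr_ge0.
by rewrite sqrtr0 ltNge sqrtr_ge0/= ltNge d0.
Qed.

(* The tail and its derivatives vanish for [|x| < 2 ^+ J], and elsewhere [2 ^+ J] is bounded by
   [2 ^- J * jap x ^+ 2]: polynomial growth is traded for the decaying weight. *)
Lemma mfam_tail : mfam (fun J : nat => 2 ^- J) (fun J x => 1 - partial_sum J x).
Proof.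
pose P (w : nat -> 'rV[R]_n -> R[i]) := exists b l, [/\ normc b <= 1,
  forall J x, 1 * euclid_dot x x < (2 ^+ J) ^+ 2 -> w J x = 0 &
  w = fun J x => b - \sum_(j < J.+1) cpartials l (phi j) x].
apply: (@bfam_coind _ _ _ _ P); last first.
  exists 1, [::]; split => //; first by rewrite normc1.
  move=> J x; rewrite mul1r -euclid_norm_lt ?exprn_ge0// => xJ.
  by rewrite partial_sum1// subrr.
move=> w [b [l [b1 w0 wE]]]; rewrite {}wE in w0 *.
have schl j : sch (cpartials l (phi j)).
  elim: l {w0} => [|a l ih] /=; first exact: dyadic_sch.
  exact: (bfam_partial a ih).
split=> [J||a].
- have := bfam_continuous tt (sch_sum (index_enum 'I_J.+1) (fun j => schl j)) => -[c1 c2].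
  split=> x.
    rewrite (_ : re_fun _ = (fun=> complex.Re b) \- re_fun (fun x => \sum_(j < J.+1) cpartials l (phi j) x)); last first.
      by apply/funext => y; rewrite /re_fun/= cReD; case: (\sum_(_ < _) _).
    by apply: continuousB; [exact: cst_continuous|exact: c1].
  rewrite (_ : im_fun _ = (fun=> complex.Im b) \- im_fun (fun x => \sum_(j < J.+1) cpartials l (phi j) x)); last first.
    by apply/funext => y; rewrite /im_fun/= cImD; case: (\sum_(_ < _) _).
  by apply: continuousB; [exact: cst_continuous|exact: c2].
- have [c hc] : exists c, forall j x, normc (cpartials l (phi j) x) <= c * 2 ^- (j * size l).
    by case: hphi => _ _ _ /(_ l).
  exists 2%N, (2 * (1 + `|c|)); first by rewrite mulr_ge0// addr_ge0.
  move=> J x; have [xJ|xJ] := ltP (euclid_dot x x) ((2 ^+ J) ^+ 2).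
    have := w0 J x; rewrite mul1r => ->//; rewrite normc0.
    by rewrite !mulr_ge0 ?invr_ge0 ?exprn_ge0 ?jap_ge0// addr_ge0.
  have jx : 2 ^+ J <= jap x.
    apply: le_trans (euclid_norm_jap x); apply: le_trans (_ : euclid_norm x <= _); last by rewrite lerDr.
    by rewrite leNgt euclid_norm_lt ?exprn_ge0// -leNgt.
  apply: le_trans (_ : (1 + `|c|) * J.+2%:R <= _).
    rewrite (le_trans (normcB _ _))// mulrDl mul1r lerD//; first by rewrite (le_trans b1)// ler1n.
    apply: (le_trans (normc_sum _ _ _)); apply: le_trans (_ : \sum_(j < J.+1) `|c| <= _).
      apply: ler_sum => j _; apply: (le_trans (hc j x)); apply: le_trans (_ : `|c| * 2 ^- (j * size l) <= _).
        by rewrite ler_wpM2r ?invr_ge0 ?exprn_ge0// ler_norm.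
      by rewrite ler_piMr// invf_le1 ?exprn_gt0// exprn_ege1// ler1n.
    by rewrite sumr_const card_ord -[leLHS]mulr_natr ler_wpM2l// ler_nat.
  have h1 : J.+2%:R <= 2 * 2 ^+ J :> R.
    by rewrite -exprS -natrX ler_nat ltn_expl.
  have h2 : 2 ^+ J <= 2 ^- J * jap x ^+ 2.
    rewrite mulrC ler_pdivlMr ?exprn_gt0// -expr2.
    by rewrite lerXn2r ?nnegrE ?jap_ge0 ?exprn_ge0.
  rewrite (_ : 2 * (1 + `|c|) * 2 ^- J * jap x ^+ 2 = (1 + `|c|) * (2 * (2 ^- J * jap x ^+ 2))); last by ring.
  by rewrite ler_wpM2l ?addr_ge0// (le_trans h1)// ler_wpM2l.
- exists (fun J x => 0 - \sum_(j < J.+1) cpartials (a :: l) (phi j) x).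
    exists 0, (a :: l); split => //; first by rewrite normc0.
    move=> J x xJ.
    have h1 := @cdiff_vanish _ _ _ a x (w0 J) xJ.
    have h2 : cdiff (fun x => b - \sum_(j < J.+1) cpartials l (phi j) x) (basis_vec R a) x
        (0 - \sum_(j < J.+1) cpartials (a :: l) (phi j) x).
      apply: cdiffB; first exact: cdiff_cst.
      by apply: cdiff_sum => j; exact: (bfam_cdiff tt a x (schl j)).
    by rewrite -(cdiff_cpartial h2) (cdiff_cpartial h1).
  move=> J x; apply: cdiffB; first exact: cdiff_cst.
  by apply: cdiff_sum => j; exact: (bfam_cdiff tt a x (schl j)).
Qed.

(** * Dyadic decomposition of a tempered distribution *)

Section tempered_functional.
Variable T : functional R n.
Hypothesis hT : tempered T.

Lemma tempered0 : T (fun=> 0) = 0.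
Proof.
have s0 : schwartz (fun _ : 'rV[R]_n => 0 : R[i]) by exact/schP/sch0.
have := hT.1 1 _ _ s0 s0; rewrite !mul1r !addr0.
by move/eqP; rewrite -{1}[T _]addr0 (inj_eq (addrI _)) eq_sym => /eqP.
Qed.

Lemma temperedD u v : sch u -> sch v -> T (fun x => u x + v x) = T u + T v.
Proof.
move=> /schP su /schP sv; have := hT.1 1 _ _ su sv; rewrite mul1r => <-.
by under [X in _ = T X]eq_fun do rewrite mul1r.
Qed.

Lemma temperedZ a u : sch u -> T (fun x => a * u x) = a * T u.
Proof.
move=> /schP su; have s0 : schwartz (fun _ : 'rV[R]_n => 0 : R[i]) by exact/schP/sch0.
have := hT.1 a _ _ su s0; rewrite tempered0 addr0 => <-.
by under [X in _ = T X]eq_fun do rewrite addr0.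
Qed.

Lemma tempered_sum (J : Type) (r : seq J) (F : J -> 'rV[R]_n -> R[i]) :
  (forall j, sch (F j)) -> T (fun x => \sum_(j <- r) F j x) = \sum_(j <- r) T (F j).
Proof.
move=> sF; elim: r => [|j r ih].
  by rewrite big_nil; under [X in T X]eq_fun do rewrite big_nil; exact: tempered0.
rewrite big_cons -ih -temperedD//; last exact: sch_sum.
by under [X in T X]eq_fun do rewrite big_cons.
Qed.

(** The error is, up to sign, [T] applied to the transform of [(1 - partial_sum J) * g]. By
    [mfam_tail] and the uniformity of [Fs_sfam] each Schwartz seminorm of that transform is
    [O(2^-J)], so the continuity of [T] concludes. *)
Lemma tempered_dyadic_sum (g : 'rV[R]_n -> R[i]) : sch g -> forall e, 0 < e ->
  \forall J \near \oo,
    normc (\sum_(j < J.+1) T (Fs (-1) (fun x => phi j x * g x)) - T (Fs (-1) g)) <= e.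
Proof.
move=> sg.
have sj j : sch (fun x => phi j x * g x) by apply: schM => //; exact: dyadic_sch.
have m1 : -1 != 0 :> R by rewrite oppr_eq0 oner_eq0.
have tailE J : \sum_(j < J.+1) T (Fs (-1) (fun x => phi j x * g x)) - T (Fs (-1) g) =
    - T (Fs (-1) (fun x => (1 - partial_sum J x) * g x)).
  have sS : sch (fun x => partial_sum J x * g x).
    rewrite (_ : (fun _ => _) = (fun x => \sum_(j < J.+1) phi j x * g x)); first exact: sch_sum.
    by apply/funext => x; rewrite /partial_sum mulr_suml.
  rewrite -tempered_sum; last by move=> j; exact: sch_Fs.
  rewrite (_ : (fun x => \sum_(j < J.+1) _) = Fs (-1) (fun x => partial_sum J x * g x)); last first.
    apply/funext => xi; rewrite /Fs -cint_sum; last by move=> j; exact/cintb_Fs/cintb_sch.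
    by apply: eq_cint => x; rewrite /partial_sum mulr_suml mulr_sumr.
  rewrite (_ : Fs _ (fun x => (1 - _) * _) =
      (fun xi => -1 * Fs (-1) (fun x => partial_sum J x * g x) xi + Fs (-1) g xi)); last first.
    apply/funext => xi; rewrite -Fs_lin; [|exact: cintb_sch|exact: cintb_sch].
    by congr Fs; apply/funext => x; ring.
  rewrite temperedD; [|exact/schZ/sch_Fs|exact: sch_Fs].
  by rewrite temperedZ; [ring|exact: sch_Fs].
have e0 (J : nat) : 0 <= 2 ^- J :> R by rewrite invr_ge0 exprn_ge0.
have sf : sfam (fun J : nat => 2 ^- J) (fun J => Fs (-1) (fun x => (1 - partial_sum J x) * g x)).
  apply: Fs_sfam => //.
  have := @sfamM _ _ _ _ _ _ _ e0 (fun=> ler01) mfam_tail (sch_sfam nat sg).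
  by rewrite (_ : (fun i => 2 ^- i * 1) = (fun J : nat => 2 ^- J))//; apply/funext => i; rewrite mulr1.
have [N [c hc]] := hT.2.
have [C C0 hC] := sfam_schwartz_norm N e0 sf.
move=> e e_gt0.
pose F J := Fs (-1) (fun x => (1 - partial_sum J x) * g x).
have bound J : normc (T (F J)) <= `|c| * C * 2 ^- J.
  have sJ : schwartz (F J) by apply/schP; exact: sfam_sch J sf.
  rewrite -lee_fin (le_trans (hc _ sJ))//.
  have s0 : (0 <= schwartz_norm N (F J))%E.
    apply: le_trans (ereal_sup_ubound _); last by exists ([::], 0).
    by rewrite lee_fin mulr_ge0 ?normc_ge0// exprn_ge0// addr_ge0// sqrtr_ge0.
  apply: le_trans (_ : (`|c|%:E * schwartz_norm N (F J) <= _)%E).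
    by rewrite lee_wpmul2r// lee_fin ler_norm.
  by rewrite -mulrA EFinM lee_wpmul2l//; exact: hC.
have : (fun J : nat => (2 ^-1) ^+ J : R) @ \oo --> (0 : R).
  by apply: cvg_expr; rewrite ger0_norm ?invr_ge0// invf_lt1// ltr1n.
have eD : 0 < e / (`|c| * C + 1) by rewrite divr_gt0// ltr_wpDl// mulr_ge0.
move=> /cvgrPdist_le/(_ _ eD); apply: filterS => J; rewrite sub0r normrN exprVn ger0_norm// => hJ.
rewrite tailE normcN (le_trans (bound J))//.
apply: le_trans (_ : (`|c| * C + 1) * 2 ^- J <= _); first by rewrite ler_wpM2r// lerDl.
by rewrite mulrC -ler_pdivlMr// ltr_wpDl// mulr_ge0.
Qed.

End tempered_functional.

End dyadic.

(** * Convolution kernels of the one-dimensional blocks *)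

Section dyadic_kernel.
Variables (R : realType) (phi : nat -> 'rV[R]_1 -> R[i]).
Hypothesis hphi : dyadic_resolution phi.
Local Notation mu := (lebesgue_rV R 1).

(* The convolution kernel of the [k]-th block, i.e., the inverse Fourier transform of [phi k]. *)
Definition kernel (k : nat) (x : 'rV[R]_1) : R[i] := ((2 * pi) ^- 1)%:C * Fs 1 (phi k) x.

Lemma sch_kernel k : sch (kernel k).
Proof. by apply: schZ; apply: sch_Fs; [exact: oner_neq0|exact: dyadic_sch]. Qed.

(** The transpose of the [k]-th block: [dyadic_block phi k T psi] unfolds to [T (Pblock k psi)]. *)
Definition Pblock (k : nat) (psi : 'rV[R]_1 -> R[i]) : 'rV[R]_1 -> R[i] :=
  fourier (fun x => phi k x * ifourier psi x).

Lemma PblockE k psi : Pblock k psi =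
  Fs (-1) (fun x => ((2 * pi) ^- 1)%:C * (phi k x * Fs 1 psi x)).
Proof.
by rewrite /Pblock fourierE ifourierE; congr Fs; apply/funext => x; ring.
Qed.

Lemma sch_Pblock k psi : sch psi -> sch (Pblock k psi).
Proof.
move=> sp; rewrite PblockE; apply: sch_Fs; first by rewrite oppr_eq0 oner_eq0.
apply: schZ; apply: schM; first exact: dyadic_sch.
by apply: sch_Fs => //; exact: oner_neq0.
Qed.

(** The multiplication formula, with the modulation at [y] turned into a shift. The kernel is taken
    at [z - y], not at [y - z], because [Pblock] is the transpose of the convolution with
    [kernel k]. *)
Lemma Pblock_kernel k psi y : sch psi ->
  Pblock k psi y = cint mu (fun z => kernel k (z - y) * psi z).
Proof.
move=> sp; have sk := dyadic_sch hphi k.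
have s1 : sch (Fs 1 psi) by apply: sch_Fs => //; exact: oner_neq0.
rewrite PblockE FsZ; last exact/cintb_sch/schM.
pose g x := cis (-1 * euclid_dot x y) * phi k x.
have gi : cintb mu g by exact/cintb_Fs/cintb_sch.
have := Fs_mult 1 (cintb_sch sp) gi.
rewrite (_ : cint mu (fun xi => Fs 1 psi xi * g xi) = Fs (-1) (fun x => phi k x * Fs 1 psi x) y); last first.
  by apply: eq_cint => x; rewrite /g; ring.
have sky : sch (fun z => psi z * Fs 1 (phi k) (z - y)).
  apply: schM => //.
  have := @sch_affine R 1 1 (- y) (Fs 1 (phi k)) (oner_neq0 _) (sch_Fs (oner_neq0 _) sk).
  by under eq_fun do rewrite scale1r.
have gE x : Fs 1 g x = Fs 1 (phi k) (x - y).
  by have := Fs_modulate 1 (-1) (phi k) y x; rewrite scaleN1r mul1r.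
under [in X in _ = X -> _]eq_fun do rewrite gE.
move=> ->; rewrite -cintZ; last exact: cintb_sch.
by apply: eq_cint => z; rewrite /kernel; ring.
Qed.

(** The constant 4 is the 2 of [cint_normc_le] times the 2 in the length [2 * r] of the interval. *)
Lemma Fs_compact_bound (u : 'rV[R]_1 -> R[i]) (M r : R) (x : 'rV[R]_1) : sch u -> 0 < r -> 0 <= M ->
  (forall x, normc (u x) <= M) ->
  (forall x : 'rV[R]_1, r < `|x ord0 ord0| -> u x = 0) ->
  normc (Fs 1 u x) <= 4 * (M * r).
Proof.
move=> su r0 M0 uM u0; have ui := cintb_Fs 1 x (cintb_sch su).
rewrite -lee_fin (le_trans (cint_normc_le ui))//.
under eq_integral do rewrite normcM normc_cis mul1r.
rewrite (_ : 4 * (M * r) = 2 * (M * (2 * r))); last by ring.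
rewrite 2!EFinM lee_wpmul2l// -lebesgue_box1// -integral_cst//; last exact: measurable_box1.
rewrite [leRHS]integral_mkcond; apply: ge0_le_integral => //.
- by move=> y _; rewrite lee_fin normc_ge0.
- by apply/measurable_EFinP/cmfun_normc; exact: cmfun_sch.
- by apply/(measurable_restrictT _ (measurable_box1 _)); exact: measurable_cst.
- move=> y _; rewrite /patch; case: ifPn => [_|]; first by rewrite lee_fin.
  by rewrite notin_setE /box1 /= => /negP; rewrite -ltNge => /u0 ->; rewrite normc0.
Qed.

Lemma euclid_norm1 (x : 'rV[R]_1) : euclid_norm x = `|x ord0 ord0|.
Proof. by rewrite /euclid_norm /euclid_dot big_ord1 -expr2 sqrtr_sqr. Qed.

(** Uniformity in [k] is a matter of scaling: [phi k] lives on an interval of length comparable with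
    [2^k], where it is bounded and its second derivative is [O(2^(-2k))]. Two integrations by parts
    then bound [(2^k x)^2] times the kernel, like the kernel itself, by a multiple of [2^k]. *)
Lemma kernel_bound : exists2 C : R, 0 <= C & forall k x,
  normc (kernel k x) <= C * (2 ^+ k * wt (2 ^+ k *: x)).
Proof.
have [c0 h0] : exists c, forall j x, normc (cpartials [::] (phi j) x) <= c * 2 ^- (j * 0).
  by case: hphi => _ _ _ /(_ [::]).
have [c2 h2] : exists c, forall j x,
    normc (cpartials [:: ord0; ord0] (phi j) x) <= c * 2 ^- (j * 2).
  by case: hphi => _ _ _ /(_ [:: ord0; ord0]).
(* 8 is the 4 of [Fs_compact_bound] times the 2 in the radius [2 ^+ k.+1]. *)
pose D := 8 * (`|c0| + `|c2|).
exists (`|(2 * pi) ^- 1| * D) => [|k x]; first by rewrite !mulr_ge0// addr_ge0.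
have r0 : 0 < 2 ^+ k.+1 :> R by rewrite exprn_gt0.
have sk := dyadic_sch hphi k.
have s1 := bfam_partial ord0 sk; have s2 := bfam_partial ord0 s1.
(* The exterior of the support is described by a strict inequality of the form required by
   [cdiff_vanish] with [s = -1], so that the vanishing passes to the two derivatives. *)
have v0 (y : 'rV[R]_1) : -1 * euclid_dot y y < - (2 ^+ k.+1) ^+ 2 -> phi k y = 0.
  rewrite mulN1r ltrN2 => hy; apply/eqP; apply: contraTT hy => /(dyadic_supp hphi).
  by rewrite euclid_norm_lt ?exprn_ge0// -leNgt => /ltW.
have v1 y : -1 * euclid_dot y y < - (2 ^+ k.+1) ^+ 2 -> cpartial ord0 (phi k) y = 0.
  by move=> hy; apply: cdiff_cpartial; exact: (@cdiff_vanish R 1 _ _ _ ord0 y v0 hy).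
have v2 y : -1 * euclid_dot y y < - (2 ^+ k.+1) ^+ 2 ->
    cpartial ord0 (cpartial ord0 (phi k)) y = 0.
  by move=> hy; apply: cdiff_cpartial; exact: (@cdiff_vanish R 1 _ _ _ ord0 y v1 hy).
have vE (y : 'rV[R]_1) : 2 ^+ k.+1 < `|y ord0 ord0| ->
    -1 * euclid_dot y y < - (2 ^+ k.+1) ^+ 2.
  rewrite mulN1r ltrN2 /euclid_dot big_ord1 -expr2 -[y ord0 ord0 ^+ 2]real_normK ?num_real//.
  by move=> h; rewrite ltrXn2r ?nnegrE ?exprn_ge0.
have b0 := @Fs_compact_bound (phi k) `|c0| (2 ^+ k.+1) x sk r0 (normr_ge0 _).
have b2 := @Fs_compact_bound _ (`|c2| * 2 ^- (k * 2)) (2 ^+ k.+1) x s2 r0.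
have {}b0 : normc (Fs 1 (phi k) x) <= 4 * (`|c0| * 2 ^+ k.+1).
  apply: b0 => [y|y /vE/v0//].
  by have := h0 k y; rewrite muln0 expr0 invr1 mulr1 => /le_trans; apply; exact: ler_norm.
have {}b2 : x ord0 ord0 ^+ 2 * normc (Fs 1 (phi k) x) <=
    4 * (`|c2| * 2 ^- (k * 2) * 2 ^+ k.+1).
  have -> : x ord0 ord0 ^+ 2 * normc (Fs 1 (phi k) x) =
      normc (Fs 1 (cpartial ord0 (cpartial ord0 (phi k))) x).
    rewrite (Fs_partial _ _ _ s1) (Fs_partial _ _ _ sk) normcN normcM normcN normcM mulrA.
    congr (_ * _); rewrite /= expr0n/= add0r sqrtr_sqr mul1r -normrM -expr2.
    by rewrite ger0_norm// sqr_ge0.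
  apply: b2 => [|y|y /vE/v2//]; first by rewrite mulr_ge0// invr_ge0 exprn_ge0.
  by apply: (le_trans (h2 k y)); rewrite ler_wpM2r ?invr_ge0 ?exprn_ge0// ler_norm.
rewrite /kernel normcM normc_real -mulrA ler_wpM2l//.
rewrite /wt big_ord1 rVZ mulrA ler_pdivlMr ?ltr_pwDl ?sqr_ge0//.
rewrite mulrDr mulr1 exprMn.
have -> : D * 2 ^+ k = 4 * (`|c0| * 2 ^+ k.+1) + (2 ^+ k) ^+ 2 * (4 * (`|c2| * 2 ^- (k * 2) * 2 ^+ k.+1)).
  rewrite -exprM /D !exprS; have k0 : 2 ^+ (k * 2) != 0 :> R by rewrite expf_neq0.
  by field.
by rewrite lerD// mulrCA (mulrC (normc _)) ler_wpM2l ?sqr_ge0.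
Qed.

(** The majorant of [kernel_bound] is a dilation that preserves the integral, so its integral does
    not depend on [k]. *)
Lemma kernel_int : exists2 C : R, 0 <= C & forall k,
  (\int[mu]_x (normc (kernel k x))%:E <= C%:E)%E.
Proof.
have [C C0 hC] := kernel_bound.
exists (C * wtint R 1) => [|k]; first by rewrite mulr_ge0 ?wtint_ge0.
have k0 : 0 < 2 ^+ k :> R by rewrite exprn_gt0.
have mw : measurable_fun setT (fun x : 'rV[R]_1 => (wt x)%:E).
  by apply/measurable_EFinP; exact: measurable_wt.
have w0 (x : 'rV[R]_1) : (0 <= (wt x)%:E)%E by rewrite lee_fin wt_ge0.
apply: le_trans (_ : (\int[mu]_x (C%:E * ((2 ^+ k)%:E * (wt (2 ^+ k *: x)%R)%:E)) <= _)%E).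
  apply: ge0_le_integral => //.
  - by move=> x _; rewrite lee_fin normc_ge0.
  - by apply/measurable_EFinP/cmfun_normc/cmfun_sch; exact: sch_kernel.
  - do 2 apply: emeasurable_funM => //.
    exact: measurableT_comp mw (@measurable_rV_scale R 1 _).
  - by move=> x _; rewrite -!EFinM lee_fin.
have m2 : measurable_fun setT (fun x : 'rV[R]_1 => (wt (2 ^+ k *: x))%:E).
  exact: measurableT_comp mw (@measurable_rV_scale R 1 _).
have -> : (\int[mu]_x (C%:E * ((2 ^+ k)%:E * (wt (2 ^+ k *: x)%R)%:E)) =
    \int[mu]_x ((C * 2 ^+ k)%:E * (wt (2 ^+ k *: x)%R)%:E))%E.
  by apply: eq_integral => x _; rewrite muleA EFinM.
rewrite ge0_integralZl//; last by rewrite lee_fin mulr_ge0// ltW.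
rewrite EFinM -muleA -(ge0_integral_rV1_scale k0 mw w0) EFinM lee_wpmul2l ?lee_fin//.
by rewrite /wtint /Rintegral fineK//; exact: integrable_fin_num (integrable_wt R 1).
Qed.

End dyadic_kernel.

(** * Separation by Schwartz test functions *)

Section smooth_step.
Variables (R : realType) (w : 'rV[R]_1 -> R[i]).
Hypotheses (sw : sch w) (w1 : w 0 = 1)
  (w0 : forall x : 'rV[R]_1, 2 <= `|x ord0 ord0| -> w x = 0).
Local Notation leb := (@lebesgue_measure R).

(** The squared modulus makes a nonnegative real density out of the complex-valued [w]. *)
Let b (x : 'rV[R]_1) : R[i] := w x * conjc (w x).
Let beta (t : R) : R := complex.Re (b (rV1 t)).

Let sb : sch b. Proof. exact: schM (sch_conj sw). Qed.

Let bE x : b x = (complex.Re (b x))%:C.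
Proof.
rewrite /b; case: (w x) => a c /=; apply: complexP => //=; ring.
Qed.

Let beta_ge0 t : 0 <= beta t.
Proof.
rewrite /beta /b; case: (w (rV1 t)) => a c /=.
by rewrite mulrN opprK addr_ge0// -expr2 sqr_ge0.
Qed.

Let beta_out t : 2 <= `|t| -> beta t = 0.
Proof. by move=> t2; rewrite /beta /b w0 ?rV1E// mul0r. Qed.

Let beta_continuous : continuous beta.
Proof.
move=> t; apply: (@continuous_comp _ _ _ (@rV1 R) (re_fun b)); first exact: continuous_rV1.
by have [h _] := bfam_continuous tt sb; exact: h.
Qed.

Let beta_near0 : exists2 dl, 0 < dl <= 1 & forall t, `|t| <= dl -> 2^-1 <= beta t.
Proof.
have [C C0 hC] := sch_near 0 sb.
have b0 : b 0 = 1 by rewrite /b w1 rmorph1 mulr1.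
exists (Num.min 1 (2^-1 / (C + 1))).
  by rewrite lt_min ltr01 divr_gt0 ?invr_gt0 ?ltr_wpDl//= ge_min lexx.
move=> t; rewrite le_min => /andP[t1 tC].
have := hC _ t1; rewrite add0r b0 => h.
have : normc (b (rV1 t) - 1) <= 2^-1.
  apply: (le_trans h); apply: le_trans (_ : (C + 1) * `|t| <= _).
    by rewrite ler_wpM2r// lerDl.
  by rewrite mulrC -ler_pdivlMr// ltr_wpDl.
move=> /(le_trans (normc_Re _)); rewrite cReD /= ler_norml => /andP[+ _].
by rewrite /beta; lra.
Qed.

Let beta_integrable : leb.-integrable setT (EFin \o beta).
Proof.
have bi := cintb_sch sb.
by have [h _] := (cintb_mu1 (cintb_cmfun bi)).1 bi.
Qed.

Lemma antiderivative_beta : exists G : R -> R, forall t : R, is_derive t 1 G (beta t).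
Proof.
exists (fun t => \int[leb]_(x in `]-oo, t]) beta x) => t.
have ti : leb.-integrable `]-oo, t + 1] (EFin \o beta) by exact: integrableS beta_integrable.
have t1 : t < t + 1 by rewrite ltrDl.
have [|d1 d2] := @continuous_FTC1 R beta -oo%O t (t + 1) t1 ti _ (@beta_continuous t).
  by rewrite ltNyr.
by split => //; rewrite -d2 derive1E.
Qed.

Section antiderivative.
Variable G : R -> R.
Hypothesis dG : forall t : R, is_derive t 1 G (beta t).

Let G_mvt (s t : R) : s <= t -> exists2 c, s <= c <= t & G t - G s = beta c * (t - s).
Proof.
move=> st; have [c] := MVT_segment st (fun x _ => dG x)
  (continuous_subspaceT (derive_continuous1 dG)).
by rewrite in_itv/= => cst e; exists c.
Qed.

Let G_nd (s t : R) : s <= t -> G s <= G t.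
Proof.
by move=> st; rewrite -subr_ge0; have [c _ ->] := G_mvt st; rewrite mulr_ge0// subr_ge0.
Qed.

Let G_left (t : R) : t <= -2 -> G t = G (-2).
Proof.
move=> t2; have [c /andP[_ c2] e] := G_mvt t2.
have bc : beta c = 0.
  have c0 : c <= 0 by lra.
  by apply: beta_out; rewrite (ler0_norm c0); lra.
by move: e; rewrite bc mul0r => /eqP; rewrite subr_eq0 => /eqP ->.
Qed.

Let G_right (t : R) : 2 <= t -> G t = G 2.
Proof.
move=> t2; have [c /andP[c2 _] e] := G_mvt t2.
have bc : beta c = 0.
  have c0 : 0 <= c by lra.
  by apply: beta_out; rewrite (ger0_norm c0); lra.
by move: e; rewrite bc mul0r => /eqP; rewrite subr_eq0 => /eqP ->.
Qed.

Let Z : R := G 2 - G (-2).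

Let Z_gt0 : 0 < Z.
Proof.
have [dl /andP[dl0 dl1] h] := beta_near0.
have ndl : - dl <= dl by rewrite ge0_cp// ltW.
have [c /andP[c1 c2] e] := G_mvt ndl.
have : 0 < G dl - G (- dl).
  rewrite e mulr_gt0//; last by rewrite opprK addr_gt0.
  by apply: lt_le_trans (h _ _); [rewrite invr_gt0|rewrite ler_norml c1].
have := @G_nd dl 2; have := @G_nd (-2) (- dl).
rewrite /Z lerN2 => h1 h2; have dl2 : dl <= 2 by rewrite (le_trans dl1)// ler1n.
by move: (h1 dl2) (h2 dl2); lra.
Qed.

(** [beta] vanishes outside [[-2, 2]] and has total mass [Z]; the shift by 2 puts the transition
    from 0 to 1 into [[0, 4]]. *)
Definition step (t : R) : R := Z^-1 * (G (t - 2) - G (-2)).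

Lemma step_left t : t <= 0 -> step t = 0.
Proof. by move=> t0; rewrite /step G_left ?subrr ?mulr0// lerBlDr addNr. Qed.

Lemma step_right t : 4 <= t -> step t = 1.
Proof.
by move=> t4; rewrite /step G_right ?mulVf ?gt_eqF// lerBrDr (le_trans _ t4)//; lra.
Qed.

Lemma step_bound t : 0 <= step t <= 1.
Proof.
have [t0|t0] := leP t 0; first by rewrite step_left// lexx ler01.
have [t4|t4] := leP 4 t; first by rewrite step_right// ler01 lexx.
rewrite /step mulr_ge0 ?invr_ge0 ?(ltW Z_gt0) ?subr_ge0 ?G_nd//=; last by lra.
by rewrite ler_pdivrMl// mulr1 /Z lerD2r G_nd//; lra.
Qed.

Lemma step_derive (t : R) : is_derive t 1 step (Z^-1 * beta (t - 2)).
Proof.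
apply/is_derive_epsP => e e0; have e0' : 0 < e * Z by rewrite mulr_gt0.
have /is_derive_epsP/(_ _ e0')[dl dl0 h] := dG (t - 2).
exists dl => // x /h H; rewrite /step (addrAC t).
rewrite (_ : _ - _ - _ = Z^-1 * (G (t - 2 + x *: 1) - G (t - 2) - x * beta (t - 2))); last by ring.
rewrite normrM ger0_norm ?invr_ge0 ?(ltW Z_gt0)//.
by rewrite ler_pdivrMl// (le_trans H)// le_eqVlt; apply/orP; left; apply/eqP; ring.
Qed.

End antiderivative.

Lemma smooth_step_exists : exists step : R -> R,
  [/\ forall t, t <= 0 -> step t = 0, forall t, 4 <= t -> step t = 1,
      forall t, 0 <= step t <= 1 &
      exists Z, forall t : R, is_derive t 1 step
        (Z * complex.Re (w (rV1 (t - 2)) * conjc (w (rV1 (t - 2)))))].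
Proof.
have [G dG] := antiderivative_beta.
exists (step G); split; [exact: step_left|exact: step_right|exact: step_bound|].
by exists (G 2 - G (-2))^-1 => t; exact: step_derive.
Qed.

End smooth_step.

(** Made for antiderivatives: only the decay of [u] itself is to be checked by hand, all its
    derivatives are controlled through [v]. *)
Lemma sch_of_partial (R : realType) (u v : 'rV[R]_1 -> R[i]) :
  continuous (re_fun u) -> continuous (im_fun u) -> rapid (fun _ : unit => 1) (fun=> u) ->
  (forall x, cdiff u (basis_vec R ord0) x (v x)) -> sch v -> sch u.
Proof.
move=> c1 c2 ru du sv.
apply: (@bfam_coind _ _ _ _ (fun z => z = (fun _ : unit => u) \/ sfam (fun _ : unit => 1) z)); last by left.
move=> z [->|sz].
  split => // a; exists (fun=> v); first by right.
  by move=> i x; rewrite (ord1 a); exact: du.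
split=> [i||a]; [exact: bfam_continuous sz|exact: bfam_bound sz|].
exists (fun i => cpartial a (z i)); last by move=> i x; exact: bfam_cdiff sz.
by right; exact: bfam_partial sz.
Qed.

Section bump.
Variables (R : realType) (w : 'rV[R]_1 -> R[i]) (step : R -> R) (Z : R).
Local Notation leb := (@lebesgue_measure R).
Hypotheses (sw : sch w) (step_left : forall t, t <= 0 -> step t = 0)
  (step_right : forall t, 4 <= t -> step t = 1) (step_bound : forall t, 0 <= step t <= 1)
  (step_derive : forall t : R, is_derive t 1 step
        (Z * complex.Re (w (rV1 (t - 2)) * conjc (w (rV1 (t - 2)))))).

Let b (x : 'rV[R]_1) : R[i] := w x * conjc (w x).

Let sb : sch b. Proof. exact: schM (sch_conj sw). Qed.

Let bE x : b x = (complex.Re (b x))%:C.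
Proof.
rewrite /b; case: (w x) => a c /=; apply: complexP => //=; ring.
Qed.

Lemma step_continuous : continuous step.
Proof. exact: derive_continuous1 step_derive. Qed.

(* As [N] grows this tends to the indicator of [`]c, d]]; no compactly supported smooth function has
   to be constructed from scratch, since [w] is cut out of the dyadic resolution. *)
Definition bump (N : nat) (c d : R) (x : 'rV[R]_1) : R[i] :=
  (step (N.+1%:R * (x ord0 ord0 - c)) - step (N.+1%:R * (x ord0 ord0 - d)))%:C.

Lemma bump_le1 N c d x : normc (bump N c d x) <= 1.
Proof.
rewrite normc_real ler_norml.
have /andP[h1 h2] := step_bound (N.+1%:R * (x ord0 ord0 - c)).
by have /andP[h3 h4] := step_bound (N.+1%:R * (x ord0 ord0 - d)); lra.
Qed.

Lemma bump_left N c d (x : 'rV[R]_1) : x ord0 ord0 <= c -> x ord0 ord0 <= d -> bump N c d x = 0.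
Proof.
move=> xc xd; rewrite /bump !step_left ?subrr// mulr_ge0_le0// subr_le0//.
Qed.

Lemma bump_right N c d (x : 'rV[R]_1) : c + 4 <= x ord0 ord0 -> d + 4 <= x ord0 ord0 -> bump N c d x = 0.
Proof.
move=> xc xd; have N1 : 1 <= N.+1%:R :> R by rewrite ler1n.
by rewrite /bump !step_right ?subrr//;
  apply: le_trans (ler_peMl _ N1); lra.
Qed.

Lemma bump_one N c d (x : 'rV[R]_1) : c + 4 <= x ord0 ord0 -> x ord0 ord0 <= d -> bump N c d x = 1.
Proof.
move=> xc xd; have N1 : 1 <= N.+1%:R :> R by rewrite ler1n.
rewrite /bump step_right; last by apply: le_trans (ler_peMl _ N1); lra.
by rewrite step_left ?subr0// mulr_ge0_le0// subr_le0.
Qed.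

Lemma sch_bump N c d : sch (bump N c d).
Proof.
have cs e : continuous (fun x : 'rV[R]_1 => step (N.+1%:R * (x ord0 ord0 - e))).
  move=> x; apply: (@continuous_comp _ _ _ (fun x : 'rV[R]_1 => N.+1%:R * (x ord0 ord0 - e)) step);
    last exact: step_continuous.
  apply: continuousM; first exact: cst_continuous.
  by apply: continuousB; [exact: coord_continuous|exact: cst_continuous].
(* The derivative of [step (N.+1%:R * (x - e))], written as an affine image of [b]. *)
pose v e x := (N.+1%:R * Z)%:C * b (N.+1%:R *: x + rV1 (- (N.+1%:R * e) - 2)).
have sv e : sch (v e).
  apply: schZ; apply: (@sch_affine R 1 N.+1%:R (rV1 (- (N.+1%:R * e) - 2)) b) => //.
apply: (@sch_of_partial R _ (fun x => v c x + -1 * v d x)).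
- by move=> x; apply: continuousB; exact: cs.
- by move=> x; exact: cst_continuous.
- move=> M; exists ((1 + (`|c| + `|d| + 4)) ^+ M); first by rewrite exprn_ge0// !addr_ge0.
  move=> _ x; rewrite mulr1.
  have [xr|xr] := leP `|x ord0 ord0| (`|c| + `|d| + 4).
    apply: le_trans (_ : jap x ^+ M * 1 <= _).
      by rewrite ler_wpM2l ?bump_le1 ?exprn_ge0 ?jap_ge0.
    by rewrite mulr1 lerXn2r ?nnegrE ?jap_ge0 ?addr_ge0// /jap big_ord1 lerD2l.
  have := ler_norm c; have := ler_norm d; have := ler_norm (- c); have := ler_norm (- d).
  rewrite !normrN => nd nc d' c'.
  suff -> : bump N c d x = 0 by rewrite normc0 mulr0 exprn_ge0// !addr_ge0.
  by move: xr; rewrite ltr_normr => /orP[xr|xr]; [apply: bump_right; lra|apply: bump_left; lra].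
- move=> x.
  have N0 : 0 < N.+1%:R :> R by [].
  have ds e : cdiff (fun x : 'rV[R]_1 => (step (N.+1%:R * (x ord0 ord0 - e)))%:C) (basis_vec R ord0) x (v e x).
    have /is_derive_epsP H := step_derive (N.+1%:R * (x ord0 ord0 - e)).
    apply/cdiffP => ee ee0.
    have e0' : 0 < ee / N.+1%:R by rewrite divr_gt0.
    have [dl dl0 h] := H _ e0'; exists (dl / N.+1%:R); first by rewrite divr_gt0.
    move=> k; rewrite ler_pdivlMr// -{1}(ger0_norm (ltW N0)) -normrM => /h.
    rewrite normrM (ger0_norm (ltW N0)) [ee / _ * _]mulrCA mulfVK ?gt_eqF// => {}h.
    rewrite /v bE -!(rmorphM (real_complex R)) -!(rmorphB (real_complex R)) normc_real.
    have e1 : rV1 (N.+1%:R * (x ord0 ord0 - e) - 2) = N.+1%:R *: x + rV1 (- (N.+1%:R * e) - 2).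
      by apply/rowP => i; rewrite rVD rVZ !rV1E (ord1 i); ring.
    move: h; rewrite e1 -/(b _) => h.
    rewrite (_ : N.+1%:R * ((x + k *: basis_vec R ord0) ord0 ord0 - e) =
      N.+1%:R * (x ord0 ord0 - e) + k * N.+1%:R *: 1); last first.
      by rewrite rVD rVZ /basis_vec mxE !eqxx/= mulr1 [_ *: 1]mulr1; ring.
    by rewrite [leRHS]mulrC; apply: le_trans h; rewrite le_eqVlt; apply/orP; left; apply/eqP; congr (`|_ - _|); ring.
  have := cdiffB (ds c) (ds d); rewrite mulN1r; congr cdiff.
  by apply/funext => y; rewrite /bump rmorphB.
- by apply: schD => //; exact: schZ.
Qed.

(** The endpoints [cn], [dn] approach from the right, at distance below [1/(n+1)]. For [t <= c] the
    step at [cn] is then 0 for every [n]; for [t > c] its argument is at least [(n+1)(t - c) - 1],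
    which eventually exceeds 4. The same holds at [d], so the limit is attained and is the indicator
    of an interval open on the left and closed on the right. *)
Lemma bump_cvg (c d : R) (cn dn : nat -> R) (t : R) : c < d ->
  (forall n, c < cn n < c + n.+1%:R^-1) -> (forall n, d < dn n < d + n.+1%:R^-1) ->
  \forall n \near \oo, bump n (cn n) (dn n) (rV1 t) = ((c < t <= d)%R%:R).
Proof.
move=> cd hc hd.
have stepE e (en : nat -> R) : (forall n, e < en n < e + n.+1%:R^-1) ->
    \forall n \near \oo, step (n.+1%:R * (t - en n)) = (e < t)%R%:R.
  move=> he; have [et|te] := ltP e t; last first.
    near=> n; rewrite step_left//; apply: mulr_ge0_le0 => //; rewrite subr_le0.
    by have /andP[h _] := he n; exact: le_trans te (ltW h).
  near=> n; rewrite step_right//; have /andP[_ h] := he n.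
  have n0 : 0 < n.+1%:R :> R by [].
  apply: le_trans (_ : n.+1%:R * (t - e) - 1 <= _); last first.
    rewrite lerBlDr -[X in _ <= _ + X](divff (lt0r_neq0 n0)) -mulrDr ler_wpM2l//.
    by move: h; set i := _^-1; lra.
  rewrite lerBrDr -ler_pdivrMr ?subr_gt0//.
  near: n; exists (Num.trunc ((4 + 1) / (t - e))).+1 => // n /= hn.
  apply: le_trans (ltW (truncnS_gt _)) _.
  by rewrite ler_nat; exact: leq_trans hn (leqnSn n).
have h1 := stepE c cn hc; have h2 := stepE d dn hd.
near=> n; rewrite /bump rV1E.
rewrite (_ : step (_ * (t - cn n)) = (c < t)%R%:R); last by near: n; exact: h1.
rewrite (_ : step (_ * (t - dn n)) = (d < t)%R%:R); last by near: n; exact: h2.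
have [ct|tc] := ltP c t; have [td|dt] := leP t d => /=.
- by rewrite subr0.
- by rewrite subrr.
- by rewrite subr0.
- by have := lt_le_trans dt (le_trans tc (ltW cd)); rewrite ltxx.
Unshelve. all: by end_near. Qed.

End bump.

(** * The du Bois-Reymond lemma for countably many test functions *)

Section du_bois_reymond.
Variables (R : realType).
Local Notation leb := (@lebesgue_measure R).

(** Lebesgue differentiation of the indefinite integral from [-k], which is identically 0; then [k]
    runs through the natural numbers. *)
Lemma ae_eq0_of_itv (g : R -> R) : measurable_fun setT g ->
  (forall M : R, leb.-integrable `[- M, M] (EFin \o g)) ->
  (forall c d : R, c < d -> \int[leb]_(t in `]c, d]) g t = 0) ->
  {ae leb, forall t, g t = 0}.
Proof.
move=> mg gi g0.
have lg : locally_integrable [set: R] g.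
  split => //; first exact: openT.
  move=> K _ cK; have [M [_ HM]] := compact_bounded cK.
  have KM : K `<=` `[- (`|M| + 1), `|M| + 1].
    move=> x Kx; rewrite /= in_itv/= -ler_norml.
    by apply: HM Kx; rewrite (le_lt_trans (ler_norm _))// ltrDl.
  suff /integrableP[] : leb.-integrable K (EFin \o g) by [].
  move: (gi (`|M| + 1)); apply: integrableS => //.
  exact: compact_measurable.
have gk (k : nat) : {ae leb, forall t, - k%:R < t -> g t = 0}.
  have := @FTC1 R g (BRight (- k%:R)).
  have int y : leb.-integrable `]- k%:R, y] (EFin \o g).
    apply: integrableS (gi (k%:R + `|y|)) => //.
    move=> x /=; rewrite !in_itv/= => /andP[h1 h2]; have := ler_norm y; have := normr_ge0 y.
    by have : 0 <= k%:R :> R by []; move: h1 h2; lra.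
  move=> /(_ int lg) /=.
  apply: (@filterS _ _ (ae_filter_ringOfSetsType leb)) => x H kx.
  have [_ <-] := H kx.
  rewrite (_ : (fun _ => _) = cst 0) ?derive1_cst//.
  apply/funext => y; have [ky|yk] := ltP (- k%:R) y; first exact: g0.
  rewrite set_itv_ge ?Rintegral_set0//.
  by rewrite bnd_simp -leNgt.
have : {ae leb, forall t (k : nat), - k%:R < t -> g t = 0} by exact/ae_foralln.
apply: (@filterS _ _ (ae_filter_ringOfSetsType leb)) => t H; apply: (H (Num.trunc `|t|).+1).
by rewrite ltrNl (le_lt_trans (ler_norm _))// normrN truncnS_gt.
Qed.

Variables (w : 'rV[R]_1 -> R[i]) (step : R -> R) (Z : R).
Hypotheses (sw : sch w) (step_left : forall t, t <= 0 -> step t = 0)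
  (step_right : forall t, 4 <= t -> step t = 1) (step_bound : forall t, 0 <= step t <= 1)
  (step_derive : forall t : R, is_derive t 1 step
        (Z * complex.Re (w (rV1 (t - 2)) * conjc (w (rV1 (t - 2)))))).

(** Rational endpoints suffice: by dominated convergence the bumps recover the integrals of [h] over
    all intervals with real endpoints. *)
Lemma ae_eq0_of_bump (h : R -> R[i]) : cmfun h ->
  (forall N (c d : rat), cintb leb (fun t => h t * bump step N (ratr c) (ratr d) (rV1 t)) /\
     cint leb (fun t => h t * bump step N (ratr c) (ratr d) (rV1 t)) = 0) ->
  {ae leb, forall t, h t = 0}.
Proof.
move=> mh H.
have ratlt (x y : R) : x < y -> exists q : rat, x < ratr q < y.
  by move=> /rat_in_itvoo[q]; rewrite in_itv/=; exists q.
have hi (M : R) : leb.-integrable setT (EFin \o (fun t => normc (h t) * (`|t| <= M)%R%:R)).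
  (* A bump that is 1 on [[-|M|, |M|]], since it equals 1 from [c + 4] to [d]; its integrability
     against [h] gives local integrability of [h]. *)
  have [c /andP[_ hc]] := ratlt (- `|M| - 5) (- `|M| - 4) ltac:(lra).
  have [d /andP[hd _]] := ratlt `|M| (`|M| + 1) ltac:(lra).
  have [hi _] := H 0%N c d.
  apply: le_integrable (cintb_normc hi) => //.
    apply/measurable_EFinP; apply: measurable_funM; first exact: cmfun_normc.
    rewrite (_ : (fun t => _) = \1_(`[- M, M]%classic)); first exact: measurable_indic.
    by apply/funext => t; rewrite indicE mem_setE in_itv/= ler_norml.
  move=> t _ /=; rewrite lee_fin [leLHS]ger0_norm ?mulr_ge0 ?normc_ge0// [leRHS]ger0_norm ?normc_ge0//.
  rewrite normcM ler_wpM2l ?normc_ge0//.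
  have [tM|_] := boolP (`|t| <= M); last by rewrite normc_ge0.
  have := le_trans tM (ler_norm M); rewrite ler_norml => /andP[t1 t2].
  by rewrite (bump_one step_left step_right) ?rV1E ?normc1//; lra.
have h0 (c d : R) : c < d -> cint leb (fun t => h t * (c < t <= d)%R%:R) = 0.
  move=> cd.
  have /choice[cn hc] : forall n : nat, exists q : rat, c < ratr q < c + n.+1%:R^-1.
    by move=> n; apply: ratlt; rewrite ltrDl invr_gt0.
  have /choice[dn hd] : forall n : nat, exists q : rat, d < ratr q < d + n.+1%:R^-1.
    by move=> n; apply: ratlt; rewrite ltrDl invr_gt0.
  (* Covers the supports of all the bumps involved: a bump reaches at most 4 beyond an endpoint, and
     the rational endpoints exceed [c] and [d] by less than 1. *)
  pose M := `|c| + `|d| + 5.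
  have mind : cmfun (fun t : R => (c < t <= d)%R%:R : R[i]).
    rewrite (_ : (fun t => _) = (fun t => (\1_(`]c, d]%classic) t)%:C)).
      by apply: cmfun_real; exact: measurable_indic.
    by apply/funext => t; rewrite indicE mem_setE in_itv/=; case: (_ && _).
  have [|||||_] := @cint_dominated _ _ _ leb
    (fun n t => h t * bump step n (ratr (cn n)) (ratr (dn n)) (rV1 t))
    (fun t => h t * (c < t <= d)%R%:R) (fun t => normc (h t) * (`|t| <= M)%R%:R).
  - by move=> n; exact: cintb_cmfun (H n (cn n) (dn n)).1.
  - exact: cmfunM.
  - exact: hi.
  - apply: nearW => t e e0; apply: filterS (bump_cvg step_left step_right t cd hc hd) => n ->.
    by rewrite subrr normc0 ltW.
  - move=> n; apply: nearW => t; rewrite normcM ler_wpM2l ?normc_ge0//.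
    have [_|Mt] := boolP (`|t| <= M); first exact: (bump_le1 step_bound).
    rewrite -ltNge in Mt.
    have /andP[c1 c2] := hc n; have /andP[d1 d2] := hd n.
    have n1 : n.+1%:R^-1 <= 1 :> R by rewrite invf_le1// ler1n.
    have := ler_norm c; have := ler_norm d; have := ler_norm (- c); have := ler_norm (- d).
    rewrite !normrN => e1 e2 e3 e4; set i := n.+1%:R^-1 in c2 d2 n1.
    rewrite (_ : bump _ _ _ _ _ = 0) ?normc0//.
    move: Mt; rewrite /M ltr_normr => /orP[Mt|Mt].
      by apply: (bump_right step_right); rewrite ?rV1E//; lra.
    by apply: (bump_left step_left); rewrite ?rV1E//; lra.
  move=> lim; apply/esym; apply: (@normc_lim_unique _ (fun=> 0)) => e e0.
    by apply: nearW => n; rewrite subrr normc0 ltW.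
  by apply: filterS (lim e e0) => n; rewrite (H n (cn n) (dn n)).2.
have key (g : R -> R) : measurable_fun setT g -> (forall t, `|g t| <= normc (h t)) ->
    (forall c d : R, c < d -> \int[leb]_t (g t * (c < t <= d)%R%:R) = 0) ->
    {ae leb, forall t, g t = 0}.
  move=> mg gh g0; apply: ae_eq0_of_itv => //.
    move=> M; have hM : leb.-integrable `[- M, M] (EFin \o (fun t => normc (h t) * (`|t| <= M)%R%:R)).
      exact: integrableS (hi M).
    apply: le_integrable hM => //.
      by apply/measurable_EFinP; exact: measurable_funS mg.
    move=> t /=; rewrite in_itv/= -ler_norml => ->.
    by rewrite lee_fin mulr1 (ger0_norm (normc_ge0 _)).
  move=> c d cd; rewrite -(g0 c d cd) [LHS]Rintegral_mkcond; apply: eq_Rintegral => t _.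
  rewrite patchE; case: ifPn => [|].
    by rewrite inE/= in_itv/= => ->; rewrite mulr1.
  by rewrite notin_setE/= in_itv/= => /negP/negbTE ->; rewrite mulr0.
have hre (c d : R) : c < d ->
    \int[leb]_t (complex.Re (h t) * (c < t <= d)%R%:R) = 0.
  move=> cd; have /(congr1 (@complex.Re R)) := h0 c d cd.
  rewrite /cint /= => <-; apply: eq_Rintegral => t _.
  by case: (_ && _); rewrite ?mulr1// !mulr0.
have him (c d : R) : c < d ->
    \int[leb]_t (complex.Im (h t) * (c < t <= d)%R%:R) = 0.
  move=> cd; have /(congr1 (@complex.Im R)) := h0 c d cd.
  rewrite /cint /= => <-; apply: eq_Rintegral => t _.
  by case: (_ && _); rewrite ?mulr1// !mulr0.
have h1 := key _ mh.1 (fun t => normc_Re (h t)) hre.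
have h2 := key _ mh.2 (fun t => normc_Im (h t)) him.
apply: (@filterS2 _ _ (ae_filter_ringOfSetsType leb) _ _ _ _ h1 h2) => t.
by move=> r i; exact: complexP.
Qed.

End du_bois_reymond.

(** * Separation by tensor products, slice by slice *)

Section test_functions.
Variables (R : realType) (phi : nat -> 'rV[R]_1 -> R[i]).
Hypothesis hphi : dyadic_resolution phi.
Local Notation leb := (@lebesgue_measure R).
Local Notation mu1 := (lebesgue_rV R 1).

(** The bumps with rational endpoints, enumerated. Countability allows the exceptional null sets to
    be merged; the second property allows a factor [e k] to be removed at a given point. *)
Lemma separating_test_functions : exists e : nat -> 'rV[R]_1 -> R[i],
  [/\ forall k, sch (e k),
      forall x, exists k, e k x = 1 &
      forall h : R -> R[i], cmfun h ->
        (forall k, cintb leb (fun t => h t * e k (rV1 t)) /\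
                   cint leb (fun t => h t * e k (rV1 t)) = 0) ->
        {ae leb, forall t, h t = 0}].
Proof.
have [||step [sl sr sb [Z sd]]] := @smooth_step_exists R (phi 0%N) (dyadic_sch hphi 0%N).
- exact: dyadic00.
- move=> x x2; apply/eqP; apply: contraTT x2 => /(dyadic_supp0 hphi).
  by rewrite euclid_norm1 -ltNge.
have sw := dyadic_sch hphi 0%N.
pose E (k : nat) : nat * rat * rat := odflt (0%N, 0, 0) (unpickle k).
exists (fun k => bump step (E k).1.1 (ratr (E k).1.2) (ratr (E k).2)); split.
- by move=> k; exact: (sch_bump sw sl sr sb sd).
- move=> x; have [c] : exists q : rat, x ord0 ord0 - 5 < ratr q < x ord0 ord0 - 4.
    have /rat_in_itvoo[q] : x ord0 ord0 - 5 < x ord0 ord0 - 4 by lra.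
    by rewrite in_itv/=; exists q.
  move=> /andP[_ c4]; have [d] : exists q : rat, x ord0 ord0 < ratr q < x ord0 ord0 + 1.
    have /rat_in_itvoo[q] : x ord0 ord0 < x ord0 ord0 + 1 by lra.
    by rewrite in_itv/=; exists q.
  move=> /andP[d0 _]; exists (pickle (0%N, c, d)); rewrite /E pickleK/=.
  by apply: (bump_one sl sr); lra.
- move=> h mh H; apply: (ae_eq0_of_bump sl sr sb mh) => N c d.
  by have := H (pickle (N, c, d)); rewrite /E pickleK.
Qed.

Lemma ae_rV1 (P : 'rV[R]_1 -> Prop) : {ae leb, forall t, P (rV1 t)} -> {ae mu1, forall y, P y}.
Proof.
move=> [A [mA A0 PA]]; exists ((fun y : 'rV[R]_1 => y ord0 ord0) @^-1` A); split.
- by rewrite -[X in measurable X]setTI; apply: measurable_rV_coord.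
- rewrite lebesgue_rV1E.
    by rewrite (_ : @rV1 R @^-1` _ = A)//; apply/seteqP; split => t /=; rewrite rV1E.
  by rewrite -[X in measurable X]setTI; apply: measurable_rV_coord.
- by move=> y /= ny; apply: PA => /=; rewrite rV1K.
Qed.

(** The pairing with [b] in the second variable need not be integrable in [x], so it is first
    multiplied by [e k]; the products [e k * e m] then play the role of [a]. At a given [x] the
    factor is removed by choosing [k] with [e k (rV1 x) = 1]. *)
Lemma slice_cint_eq0 (g : measurableTypeR R * 'rV[R]_1 -> R[i]) (b : 'rV[R]_1 -> R[i]) :
  (forall a, sch a ->
     cintb (leb \x mu1)%E (fun z => g z * (a (rV1 z.1) * b z.2)) /\
     cint (leb \x mu1)%E (fun z => g z * (a (rV1 z.1) * b z.2)) = 0) ->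
  {ae leb, forall x, cintb mu1 (fun y => g (x, y) * b y) /\ cint mu1 (fun y => g (x, y) * b y) = 0}.
Proof.
move=> H; have [e [se e1 He]] := separating_test_functions.
have i1 k : {ae leb, forall x, cintb mu1 (fun y => g (x, y) * (e k (rV1 x) * b y))}.
  exact: ae_cintb1 (H _ (se k)).1.
have i2 k : {ae leb, forall x, cint mu1 (fun y => g (x, y) * (e k (rV1 x) * b y)) = 0}.
  apply: He; first exact: (cintb_cmfun (cintb_fubini1 (H _ (se k)).1)).
  move=> m; have [h1 h2] := H _ (schM (se k) (se m)).
  have ea : {ae leb, forall x, cint mu1 (fun y => g (x, y) * (e k (rV1 x) * e m (rV1 x) * b y)) =
      cint mu1 (fun y => g (x, y) * (e k (rV1 x) * b y)) * e m (rV1 x)}.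
    apply: (@filterS _ _ (ae_filter_ringOfSetsType leb)) (i1 k) => x ix.
    by rewrite [RHS]mulrC -cintZ//; apply: eq_cint => y; ring.
  have m1 := cintb_fubini1 h1.
  have m2 : cmfun (fun x : measurableTypeR R =>
      cint mu1 (fun y => g (x, y) * (e k (rV1 x) * b y)) * e m (rV1 x)).
    apply: cmfunM; first exact: (cintb_cmfun (cintb_fubini1 (H _ (se k)).1)).
    apply: cmfun_comp (@measurable_rV1 R); exact: cmfun_sch.
  split; first exact: ae_cintb ea m1.
  by rewrite -(ae_eq_cint (cintb_cmfun m1) m2 ea) -h2 (cint_fubini1 h1).
have : {ae leb, forall x, forall k, cintb mu1 (fun y => g (x, y) * (e k (rV1 x) * b y)) /\
    cint mu1 (fun y => g (x, y) * (e k (rV1 x) * b y)) = 0}.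
  apply/ae_foralln => k.
  exact: (@filterS2 _ _ (ae_filter_ringOfSetsType leb) _ _ _ _ (i1 k) (i2 k)).
apply: (@filterS _ _ (ae_filter_ringOfSetsType leb)) => x Hx.
have [k ek] := e1 (rV1 x); have := Hx k.
suff -> : (fun y => g (x, y) * (e k (rV1 x) * b y)) = (fun y => g (x, y) * b y) by [].
by apply/funext => y; rewrite ek mul1r.
Qed.

(** The separating family is used a second time, in [y], for almost every fixed [x]. *)
Lemma slice_eq0_of_tens (g : measurableTypeR R * 'rV[R]_1 -> R[i]) : cmfun g ->
  (forall a b, sch a -> sch b ->
     cintb (leb \x mu1)%E (fun z => g z * (a (rV1 z.1) * b z.2)) /\
     cint (leb \x mu1)%E (fun z => g z * (a (rV1 z.1) * b z.2)) = 0) ->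
  {ae leb, forall x, {ae mu1, forall y, g (x, y) = 0}}.
Proof.
move=> mg H; have [e [se _ He]] := separating_test_functions.
have : {ae leb, forall x, forall l, cintb mu1 (fun y => g (x, y) * e l y) /\
    cint mu1 (fun y => g (x, y) * e l y) = 0}.
  by apply/ae_foralln => l; apply: slice_cint_eq0 => a sa; exact: H.
apply: (@filterS _ _ (ae_filter_ringOfSetsType leb)) => x Hx; apply: ae_rV1.
have mgx : cmfun (fun t => g (x, rV1 t)).
  apply: (cmfun_comp mg); apply: measurable_fun_pair => //.
  exact: measurable_rV1.
apply: He => // l; have [h1 h2] := Hx l; have mh := cintb_cmfun h1.
by split; [exact: ((cintb_mu1 mh).1 h1)|rewrite -(cint_mu1 mh)].
Qed.

End test_functions.

(** * Power inequalities and sums *)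

Section power_bounds.
Variable R : realType.
Implicit Types (p r a v t : R).

(* Optimizing over [a] turns this linearization of the power function into Jensen's inequality. *)
Lemma le_powR_linear p a v : 1 <= p -> 0 < a -> 0 <= v -> v <= a + a `^ (1 - p) * v `^ p.
Proof.
move=> p1 a0 v0; have [va|av] := leP v a.
  by rewrite (le_trans va)// lerDl mulr_ge0 ?powR_ge0.
have v0' := lt_trans a0 av.
have e : v `^ (1 - p) * v `^ p = v.
  by rewrite -powRD ?subrK ?powRr1// gt_eqF// implybT.
rewrite -{1}e (le_trans _ (_ : a `^ (1 - p) * v `^ p <= _))//; last by rewrite lerDr ltW.
rewrite ler_wpM2r ?powR_ge0//.
rewrite -opprB !powRN lef_pV2 ?posrE ?powR_gt0//.
by rewrite ge0_ler_powR ?nnegrE ?subr_ge0// ltW.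
Qed.

(** The best [a] balances the two terms, that is [a^p = Y / W]. For [Y = 0] there is no positive
    such [a], and [a] tends to 0 instead. *)
Lemma powR_le_of_linear p t W Y : 1 <= p -> 0 <= t -> 0 < W -> 0 <= Y ->
  (forall a, 0 < a -> t <= a * W + a `^ (1 - p) * Y) -> t `^ p <= 2 `^ p * (W `^ (p - 1) * Y).
Proof.
move=> p1 t0 W0 Y0 H; have p0 : 0 < p by exact: lt_le_trans p1.
have [Y_gt0|] := ltP 0 Y; last first.
  move=> Yle; have Ye : Y = 0 by apply/eqP; rewrite eq_le Yle.
  have te : t = 0.
    apply/eqP; rewrite eq_le t0 andbT; apply/ler_addgt0Pl => e e0; rewrite addr0.
    have := H (e / W); rewrite divr_gt0// Ye mulr0 addr0 divfK ?gt_eqF//; exact.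
  by rewrite te powR0 ?gt_eqF// Ye !mulr0.
pose a := (Y / W) `^ p^-1.
have YW : 0 < Y / W by rewrite divr_gt0.
have a0 : 0 < a by rewrite powR_gt0.
have ap : a `^ p = Y / W by rewrite -powRrM mulVf ?gt_eqF// powRr1// ltW.
have e1 : a `^ (1 - p) * Y = a * W.
  rewrite powRD; last by rewrite (gt_eqF a0) implybT.
  rewrite powRr1 ?(ltW a0)// powRN ap invf_div -mulrA; congr (_ * _).
  by rewrite divfK ?gt_eqF.
have := H _ a0; rewrite e1 => h.
apply: (@le_trans _ _ ((2 * (a * W)) `^ p)).
  rewrite ge0_ler_powR ?nnegrE ?(ltW p0)//; first by rewrite !mulr_ge0 ?(ltW a0) ?(ltW W0).
  by rewrite mulr_natl mulr2n.
rewrite !powRM ?mulr_ge0 ?(ltW a0) ?(ltW W0)// ap.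
rewrite ler_wpM2l ?powR_ge0// le_eqVlt; apply/orP; left; apply/eqP.
have -> : W `^ p = W `^ (p - 1) * W.
  by rewrite -{3}(powRr1 (ltW W0)) -powRD ?subrK// gt_eqF// implybT.
by rewrite mulrCA divfK// gt_eqF.
Qed.

(** Below [A] the constant term suffices; above it [(t / A)^r <= t / A]. *)
Lemma powR_le_affine r A t : 0 < r <= 1 -> 0 < A -> 0 <= t -> t `^ r <= A `^ r * (1 + t / A).
Proof.
move=> /andP[r0 r1] A0 t0; have tA : 0 <= t / A by rewrite divr_ge0// ltW.
have -> : t = A * (t / A) by rewrite mulrCA divff ?mulr1 ?gt_eqF.
rewrite (mulrC A (t / A)) mulfK ?gt_eqF// powRM ?(ltW A0)// mulrC ler_wpM2l ?powR_ge0//.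
have [x1|x1] := leP 1 (t / A).
  by rewrite (le_trans (ler_powR x1 r1))// powRr1// lerDr.
apply: (@le_trans _ _ 1); last by rewrite lerDl.
have p1 : 1 `^ r = 1 :> R by rewrite powR1.
by rewrite -p1 ge0_ler_powR ?nnegrE// ltW.
Qed.

End power_bounds.

(** * Subadditivity of powers and a discrete Hardy inequality *)

Section ereal_sums.
Variable R : realType.

(** For [u] equal to [x] or [y], [u / (x + y) <= (u / (x + y))^r], and the two fractions add up to
    1. *)
Lemma powRD_le (r x y : R) : 0 < r <= 1 -> 0 <= x -> 0 <= y ->
  (x + y) `^ r <= x `^ r + y `^ r.
Proof.
move=> /andP[r0 r1] x0 y0.
have [s0|] := ltP 0 (x + y); last first.
  move=> s0; have -> : x + y = 0 by apply/eqP; rewrite eq_le s0 addr_ge0.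
  by rewrite powR0 ?gt_eqF// addr_ge0 ?powR_ge0.
have key (u : R) : 0 <= u -> u <= x + y -> u / (x + y) * (x + y) `^ r <= u `^ r.
  rewrite le_eqVlt => /predU1P[<-|u0] us; first by rewrite !mul0r powR_ge0.
  have us' : 0 < u / (x + y) by rewrite divr_gt0.
  rewrite -{2}(divfK (lt0r_neq0 s0) u) powRM ?(ltW s0)// ?(ltW us')// ler_wpM2r ?powR_ge0//.
  by rewrite ger1_powR// us' ler_pdivrMr// mul1r.
apply: le_trans (lerD (key x x0 _) (key y y0 _)); rewrite ?lerDl ?lerDr//.
by rewrite -mulrDl -mulrDl divff ?mul1r// gt_eqF.
Qed.

Local Open Scope ereal_scope.

Lemma ge0_le_poweR (r : R) (x y : \bar R) : (0 <= r)%R -> 0 <= x -> x <= y -> x `^ r <= y `^ r.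
Proof.
move=> r0 x0 xy; apply: gt0_ler_poweR => //; rewrite in_itv/= leey andbT//.
exact: le_trans xy.
Qed.

Lemma poweRD_le (r : R) (x y : \bar R) : (0 < r <= 1)%R -> 0 <= x -> 0 <= y ->
  (x + y) `^ r <= x `^ r + y `^ r.
Proof.
move=> r01 x0 y0; have /andP[r0 r1] := r01.
move: x x0 => [x x0| _|//]; last first.
  rewrite (@poweRyr _ r) ?gt_eqF// [leRHS]addye ?leey// gt_eqF// (lt_le_trans _ (poweR_ge0 _ _))//.
move: y y0 => [y y0| _|//]; last first.
  by rewrite [X in _ <= _ + X]poweRyr ?gt_eqF// addey ?leey.
by rewrite -EFinD !poweR_EFin -EFinD lee_fin powRD_le.
Qed.

Lemma poweR_nneseries_le (r : R) (v : nat -> \bar R) : (0 < r <= 1)%R -> (forall n, 0 <= v n) ->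
  (\sum_(j <oo) v j) `^ r <= \sum_(j <oo) (v j) `^ r.
Proof.
move=> r01 v0; have /andP[r0 r1] := r01.
have fin n : (\sum_(0 <= j < n) v j) `^ r <= \sum_(0 <= j < n) (v j) `^ r.
  elim: n => [|n IH]; first by rewrite !big_nil poweR0r// gt_eqF.
  rewrite !big_nat_recr//=; apply: le_trans (poweRD_le _ _ _) _ => //.
    by apply: sume_ge0 => i _.
  exact: leeD.
have S0 : 0 <= \sum_(j <oo) (v j) `^ r by apply: nneseries_ge0 => n _ _; exact: poweR_ge0.
(* The inequality is raised to the power [1 / r] before the limit is taken, so that no continuity of
   the power function is involved. *)
rewrite -[leRHS]poweRe1// -(mulVf (lt0r_neq0 r0)) poweRrM.
apply: ge0_le_poweR; [exact: ltW|exact: nneseries_ge0|].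
apply: lime_le; first exact: is_cvg_nneseries.
apply: nearW => n.
rewrite -[leLHS]poweRe1; last by apply: sume_ge0 => i _.
rewrite -(mulfV (lt0r_neq0 r0)) poweRrM.
apply: ge0_le_poweR; [by rewrite invr_ge0 ltW|exact: poweR_ge0|].
apply: le_trans (fin n) _.
by apply: nneseries_lim_ge => k _ _; exact: poweR_ge0.
Qed.

Lemma le_term_nneseries (v : nat -> \bar R) j : (forall n, 0 <= v n) -> v j <= \sum_(n <oo) v n.
Proof.
move=> v0; apply: le_trans (nneseries_lim_ge j.+1 (fun n _ _ => v0 n)).
by rewrite big_nat_recr//= leeDr// sume_ge0.
Qed.

Lemma nneseries_le_bound (u : nat -> R) (c : R) : (forall j, (0 <= u j)%R) ->
  (forall n, (\sum_(j < n) u j <= c)%R) -> \sum_(j <oo) (u j)%:E <= c%:E.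
Proof.
move=> u0 H; apply: lime_le.
  by apply: is_cvg_nneseries => n _ _; rewrite lee_fin.
by apply: nearW => n; rewrite sumEFin lee_fin big_mkord.
Qed.

(* The weight of the [j]-th piece in the bound of the [k]-th block, zero for [j + 2 <= k]. *)
Definition shift_wt (b : R) (k j : nat) : R := if (k <= j.+1)%N then (b ^+ (j.+1 - k))%R else 0%R.

Lemma shift_wt_ge0 b k j : (0 <= b)%R -> (0 <= shift_wt b k j)%R.
Proof. by rewrite /shift_wt => b0; case: ifP => // _; rewrite exprn_ge0. Qed.

Lemma shift_wt_sumr (x : R) k : (0 <= x < 1)%R ->
  \sum_(j <oo) (shift_wt x k j)%:E <= ((1 - x)^-1)%:E.
Proof.
move=> /andP[x0 x1]; have d0 : (0 < 1 - x)%R by rewrite subr_gt0.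
apply: nneseries_le_bound => [j|n]; first exact: shift_wt_ge0.
apply: (@le_trans _ _ (\sum_(i < n.+1 - k) x ^+ i)%R).
  elim: n => [|n IH]; first by rewrite big_ord0 sumr_ge0// => i _; rewrite exprn_ge0.
  rewrite big_ord_recr/= /shift_wt; case: leqP => kn.
    by rewrite (subSn kn) big_ord_recr/= lerD2r.
  have e2 : (n.+2 - k = 0)%N by apply/eqP; rewrite subn_eq0.
  have e1 : (n.+1 - k = 0)%N by apply/eqP; rewrite subn_eq0 ltnW.
  by move: IH; rewrite addr0 e1 e2.
rewrite -[leRHS]mul1r ler_pdivlMr//.
suff -> : ((\sum_(i < n.+1 - k) x ^+ i) * (1 - x) = 1 - x ^+ (n.+1 - k))%R.
  by rewrite lerBlDr lerDl exprn_ge0.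
by rewrite mulrC -opprB mulNr -subrX1 opprB.
Qed.

Lemma shift_wt_suml (x : R) j : (0 <= x < 1)%R ->
  \sum_(k <oo) (shift_wt x k j)%:E <= ((1 - x)^-1)%:E.
Proof.
move=> /andP[x0 x1]; have d0 : (0 < 1 - x)%R by rewrite subr_gt0.
apply: nneseries_le_bound => [k|n]; first exact: shift_wt_ge0.
rewrite -[leRHS]mul1r ler_pdivlMr//.
(* Strengthened so as to be inductive: the increments telescope, and truncated subtraction makes the
   bound 1 from [n = j + 2] on. *)
apply: (@le_trans _ _ (x ^+ (j.+2 - n))%R); last by rewrite exprn_ile1// ltW.
elim: n => [|n IH]; first by rewrite big_ord0 mul0r exprn_ge0.
rewrite big_ord_recr/= mulrDl /shift_wt; case: leqP => nj.
  apply: (@le_trans _ _ (x ^+ (j.+2 - n) + x ^+ (j.+1 - n) * (1 - x))%R); first by rewrite lerD2r.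
  by rewrite subSS (subSn nj) exprS le_eqVlt; apply/orP; left; apply/eqP; ring.
rewrite mul0r addr0 (le_trans IH)// subSS.
have -> : (j.+1 - n = 0)%N by apply/eqP; rewrite subn_eq0 ltnW.
by rewrite expr0 exprn_ile1// ltW.
Qed.

(** Since [b^(2k) * b^(j+1-k) = b^2 * b^(2j) * b^-(j+1-k)], the weight with exponent [2k] turns the
    growing factor of the hypothesis into a decaying one. After the power [r] it becomes [x^(j+1-k)]
    with [x = b^-r < 1], whose sum over [k] is bounded uniformly in [j]. *)
Lemma discrete_hardy (r b C : R) (U B : nat -> \bar R) : (0 < r <= 1)%R -> (1 < b)%R -> (0 <= C)%R ->
  (forall j, 0 <= U j) -> (forall j, 0 <= B j) ->
  (forall k, B k <= C%:E * \sum_(j <oo) (shift_wt b k j)%:E * U j) ->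
  \sum_(j <oo) ((b ^+ (2 * j))%:E * U j) `^ r < +oo ->
  \sum_(k <oo) ((b ^+ (2 * k))%:E * B k) `^ r < +oo.
Proof.
move=> r01 b1 C0 U0 B0 BU fin; have /andP[r0 r1] := r01.
have b0 : (0 < b)%R by exact: lt_trans b1.
have be0 n : (0 <= b ^+ n)%R by rewrite exprn_ge0 ?ltW.
pose x := (b^-1 `^ r)%R.
have x01 : (0 <= x < 1)%R.
  have p1 : (1 `^ r = 1 :> R)%R by rewrite powR1.
  rewrite powR_ge0 /x -[X in (_ < X)%R]p1 gt0_ltr_powR ?nnegrE ?invr_ge0 ?(ltW b0)//.
  by rewrite invf_lt1.
have x0 : (0 <= x)%R by case/andP: x01.
have swE k j : ((b ^+ (2 * k))%:E * ((shift_wt b k j)%:E * U j)) `^ r =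
    ((b ^+ 2) `^ r)%:E * ((shift_wt x k j)%:E * ((b ^+ (2 * j))%:E * U j) `^ r).
  rewrite /shift_wt; case: leqP => kj; last first.
    by rewrite !mul0e !mule0 poweR0r// gt_eqF.
  have -> : (x ^+ (j.+1 - k))%:E = ((b^-1 ^+ (j.+1 - k))%:E) `^ r.
    by rewrite poweR_EFin -!powR_mulrn ?invr_ge0 ?(ltW b0) ?powR_ge0// /x -!powRrM mulrC.
  rewrite -[((b ^+ 2) `^ r)%:E]poweR_EFin.
  rewrite -!poweRM ?mule_ge0 ?lee_fin ?exprn_ge0 ?invr_ge0 ?(ltW b0)//.
  congr (_ `^ r); rewrite !muleA -!EFinM; congr (_%:E * _).
  have -> : (b^-1 ^+ (j.+1 - k) = b ^+ (2 * k) * b ^+ (j.+1 - k) / (b ^+ 2 * b ^+ (2 * j)))%R.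
    apply: (canRL (mulfK _)); first by rewrite mulf_neq0// expf_neq0// gt_eqF.
    rewrite exprVn -exprD mulrC; apply: (canLR (mulfK _)); first by rewrite expf_neq0// gt_eqF.
    by rewrite -!exprD; congr (GRing.exp b _); lia.
  have h1 : (b ^+ 2 != 0)%R by rewrite expf_neq0// gt_eqF.
  have h2 : (b ^+ (2 * j) != 0)%R by rewrite expf_neq0// gt_eqF.
  move: (b ^+ 2)%R (b ^+ (2 * j))%R (b ^+ (2 * k) * b ^+ (j.+1 - k))%R h1 h2 => u v z h1 h2.
  by field; rewrite h1 h2.
have step1 k : ((b ^+ (2 * k))%:E * B k) `^ r <= (C `^ r)%:E * (((b ^+ 2) `^ r)%:E *
    \sum_(j <oo) (shift_wt x k j)%:E * ((b ^+ (2 * j))%:E * U j) `^ r).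
  apply: (@le_trans _ _ ((C%:E * \sum_(j <oo) (b ^+ (2 * k))%:E * ((shift_wt b k j)%:E * U j)) `^ r)).
    apply: ge0_le_poweR; [exact: ltW|by rewrite mule_ge0// lee_fin|].
    rewrite nneseriesZl; last by move=> j _; rewrite mule_ge0 ?lee_fin ?shift_wt_ge0 ?(ltW b0).
    by rewrite muleCA lee_wpmul2l// lee_fin.
  have t0 j : 0 <= (b ^+ (2 * k))%:E * ((shift_wt b k j)%:E * U j).
    by rewrite !mule_ge0 ?lee_fin ?shift_wt_ge0 ?(ltW b0).
  rewrite poweRM; [|by rewrite lee_fin|exact: nneseries_ge0].
  rewrite poweR_EFin; apply: lee_wpmul2l; first by rewrite lee_fin powR_ge0.
  apply: (le_trans (poweR_nneseries_le r01 t0)).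
  rewrite -nneseriesZl; last by move=> j _; rewrite mule_ge0 ?lee_fin ?shift_wt_ge0 ?poweR_ge0.
  by rewrite (eq_eseriesr (fun j _ => swE k j)).
apply: (@le_lt_trans _ _ ((C `^ r * (b ^+ 2) `^ r * (1 - x)^-1)%:E *
    \sum_(j <oo) ((b ^+ (2 * j))%:E * U j) `^ r)); last first.
  apply: lte_mul_pinfty => //; rewrite lee_fin !mulr_ge0 ?powR_ge0// invr_ge0 subr_ge0 ltW//.
  by case/andP: x01.
apply: le_trans (lee_nneseries _ (fun k _ => step1 k)) _; first by move=> *; exact: poweR_ge0.
have s0 k : 0 <= \sum_(j <oo) (shift_wt x k j)%:E * ((b ^+ (2 * j))%:E * U j) `^ r.
  by apply: nneseries_ge0 => j _ _; rewrite mule_ge0 ?lee_fin ?shift_wt_ge0 ?poweR_ge0.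
rewrite nneseriesZl; last by move=> k _; rewrite mule_ge0 ?lee_fin ?powR_ge0.
rewrite nneseriesZl//.
rewrite nneseries_interchange; last by move=> i j; rewrite mule_ge0 ?lee_fin ?shift_wt_ge0 ?poweR_ge0.
rewrite muleA -EFinM [leRHS](_ : _ = (C `^ r * (b ^+ 2) `^ r)%:E * (((1 - x)^-1)%:E *
    \sum_(j <oo) ((b ^+ (2 * j))%:E * U j) `^ r)); last by rewrite muleA -EFinM.
apply: lee_wpmul2l; first by rewrite lee_fin mulr_ge0 ?powR_ge0.
rewrite -nneseriesZl; last by move=> j _; exact: poweR_ge0.
apply: lee_nneseries => [j _ _|j _].
  by apply: nneseries_ge0 => k _ _; rewrite mule_ge0 ?lee_fin ?shift_wt_ge0 ?poweR_ge0.
have Vfin : ((b ^+ (2 * j))%:E * U j) `^ r \is a fin_num.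
  by rewrite ge0_fin_numE ?poweR_ge0// (le_lt_trans _ fin)// le_term_nneseries// => i; exact: poweR_ge0.
rewrite -(fineK Vfin) (eq_eseriesr (fun k _ => muleC _ _)) nneseriesZl; last first.
  by move=> k _; rewrite lee_fin shift_wt_ge0.
by rewrite muleC lee_wpmul2r ?shift_wt_suml// fineK// poweR_ge0.
Qed.

End ereal_sums.

(** * Series of functions and actions on Schwartz functions *)

Section series_limit.
Context d (T : measurableType d) (R : realType).
Implicit Types F : nat -> T -> R[i].

Lemma measurable_series_limit (u : nat -> T -> R) : (forall j, measurable_fun setT (u j)) ->
  exists2 v : T -> R, measurable_fun setT v & forall x,
    (\sum_(j <oo) `|u j x|%:E < +oo)%E -> (\sum_(j < n) u j x) @[n --> \oo] --> v x.
Proof.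
move=> mu; pose S n x := \sum_(j < n) u j x.
exists (fun x => fine (limn_esup (fun n => (S n x)%:E))).
  apply: (measurableT_comp (@fine_measurable R setT measurableT)).
  apply: measurable_fun_limn_esup => n; apply/measurable_EFinP.
  by apply: measurable_sum => j; exact: mu.
move=> x xoo.
have cS : cvgn (series (fun j => u j x)).
  apply: normed_cvg; apply: nondecreasing_is_cvgn.
    by apply: nondecreasing_series => n _ _; exact: normr_ge0.
  exists (fine (\sum_(j <oo) `|u j x|%:E)) => _ [n _ <-].
  rewrite -lee_fin fineK; last by rewrite ge0_fin_numE// nneseries_ge0.
  by rewrite /series/= -sumEFin; apply: nneseries_lim_ge.
have SE : (fun n => S n x) = series (fun j => u j x).
  by apply/funext => n; rewrite /S /series/= big_mkord.
have cE : (S n x)%:E @[n --> \oo] --> (limn (series (fun j => u j x)))%:E.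
  by apply/cvg_EFin; [exact: nearW|rewrite -[X in X @ _ --> _]/(fun n => S n x) SE].
have -> : limn_esup (fun n => (S n x)%:E) = (limn (series (fun j => u j x)))%:E.
  by rewrite is_cvg_limn_esupE; [exact/cvg_lim|apply/cvg_ex; eexists; exact: cE].
by rewrite /= -/(S _ _) SE.
Qed.

Lemma cmfun_series_limit F : (forall j, cmfun (F j)) ->
  exists2 G : T -> R[i], cmfun G & forall x, (\sum_(j <oo) (normc (F j x))%:E < +oo)%E ->
    forall e, 0 < e -> \forall n \near \oo, normc (\sum_(j < n) F j x - G x) <= e.
Proof.
move=> mF.
have [a ma Ha] := measurable_series_limit (fun j => (mF j).1).
have [b mb Hb] := measurable_series_limit (fun j => (mF j).2).
exists (fun x => a x +i* b x) => // x xoo e e0; have e20 : 0 < e / 2 by rewrite divr_gt0.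
have h (k : R[i] -> R) : (forall z, `|k z| <= normc z) -> (\sum_(j <oo) `|k (F j x)|%:E < +oo)%E.
  move=> kn; apply: le_lt_trans xoo; apply: lee_nneseries => // j _.
  by rewrite lee_fin.
have /cvgrPdist_le/(_ _ e20) h1 := Ha x (h _ (@normc_Re R)).
have /cvgrPdist_le/(_ _ e20) h2 := Hb x (h _ (@normc_Im R)).
near=> n; apply: le_trans (normc_le _) _.
have reS : complex.Re (\sum_(j < n) F j x) = \sum_(j < n) complex.Re (F j x).
  exact: raddf_sum.
have imS : complex.Im (\sum_(j < n) F j x) = \sum_(j < n) complex.Im (F j x).
  exact: raddf_sum.
rewrite cReD cImD reS imS /= [leRHS](splitr e); apply: lerD; rewrite distrC; near: n; [exact: h1|exact: h2].
Unshelve. all: by end_near. Qed.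

End series_limit.

Section measurable_cint.
Context d1 d2 (T1 : measurableType d1) (T2 : measurableType d2) (R : realType).
Variable m2 : {sigma_finite_measure set T2 -> \bar R}.

(** No integrability is assumed: positive and negative parts are integrated by Tonelli, and [fine]
    is measurable. *)
Lemma cmfun_cint1 (f : T1 * T2 -> R[i]) : cmfun f -> cmfun (fun x => cint m2 (fun y => f (x, y))).
Proof.
have key (g : T1 * T2 -> R) : measurable_fun setT g ->
    measurable_fun setT (fun x => \int[m2]_y g (x, y)).
  move=> mg; apply: (measurableT_comp (@fine_measurable R setT measurableT)).
  pose ge := EFin \o g.
  have mge : measurable_fun setT ge by exact/measurable_EFinP.
  have mp := @measurable_fun_fubini_tonelli_F _ _ _ _ R m2 _ (measurable_funepos mge) (fun=> funepos_ge0 _ _).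
  have mn := @measurable_fun_fubini_tonelli_F _ _ _ _ R m2 _ (measurable_funeneg mge) (fun=> funeneg_ge0 _ _).
  rewrite (_ : (fun x => _) = fun x =>
    (fubini_F m2 ge^\+ x - fubini_F m2 ge^\- x)%E); first exact: emeasurable_funB.
  apply/funext => x; rewrite integralE; congr (_ - _)%E.
    apply: eq_integral => y _.
    by have /(congr1 (@^~ y)) := funepos_comp ge (fun y => (x, y)).
  apply: eq_integral => y _.
  by have /(congr1 (@^~ y)) := funeneg_comp ge (fun y => (x, y)).
by move=> [f1 f2]; split; [exact: (key (fun z => complex.Re (f z)))|exact: (key (fun z => complex.Im (f z)))].
Qed.

End measurable_cint.

(** * Functions integrable against the weight *)

Section weighted.
Variables (R : realType) (n : nat).
Local Notation mu := (lebesgue_rV R n).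
Implicit Types (g h psi : 'rV[R]_n -> R[i]).

(* Such [g] act on Schwartz functions, which are dominated by the weight [wt]. *)
Definition wtb g := cmfun g /\ (\int[mu]_x (normc (g x) * wt x)%:E < +oo)%E.

Lemma wt_le1 (x : 'rV[R]_n) : wt x <= 1.
Proof.
apply: prodr_ile1 => i _; rewrite invr_ge0 addr_ge0 ?sqr_ge0//=.
by rewrite invf_le1 ?lerDl ?sqr_ge0// ltr_pwDl// sqr_ge0.
Qed.

Lemma wtb_integrable g : wtb g -> mu.-integrable setT (EFin \o (fun x => normc (g x) * wt x)).
Proof.
move=> [mg ig]; apply: lty_integrable_ge0 => // [|x].
  by apply: measurable_funM; [exact: cmfun_normc|exact: measurable_wt].
by rewrite mulr_ge0 ?normc_ge0 ?wt_ge0.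
Qed.

Lemma wtb_cintb g h (C : R) : wtb g -> cmfun h -> (forall x, normc (h x) <= C * wt x) ->
  cintb mu (fun x => g x * h x).
Proof.
move=> wg mh hC; apply: (@cintb_le _ _ _ _ _ (fun x => C * (normc (g x) * wt x))).
- exact: cmfunM wg.1 mh.
- have := integrableZl measurableT C (wtb_integrable wg).
  by apply: eq_integrable => // x _; rewrite /= EFinM.
- by move=> x; rewrite normcM mulrCA ler_wpM2l ?normc_ge0.
Qed.

Lemma wtb_cint_le g h (C : R) : wtb g -> cmfun h -> (forall x, normc (h x) <= C * wt x) ->
  normc (cint mu (fun x => g x * h x)) <= 2 * (C * \int[mu]_x (normc (g x) * wt x)).
Proof.
move=> wg mh hC; rewrite -RintegralZl//; last exact: wtb_integrable.
apply: cint_normc_le_bound.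
- exact: cmfunM wg.1 mh.
- have := integrableZl measurableT C (wtb_integrable wg).
  by apply: eq_integrable => // x _; rewrite /= EFinM.
- by move=> x; rewrite normcM mulrCA ler_wpM2l ?normc_ge0.
Qed.

Lemma wtb_cintb_sch g psi : wtb g -> sch psi -> cintb mu (fun x => g x * psi x).
Proof.
by move=> wg sp; have [C _ hC] := sch_wt sp; apply: wtb_cintb wg (cmfun_sch sp) hC.
Qed.

Definition int_functional g : functional R n := fun psi => cint mu (fun x => g x * psi x).

Lemma represents_wtb g : wtb g -> represents g (int_functional g).
Proof.
move=> wg; split; first exact: wg.1.
by move=> psi /schP sp; split => //; exact: wtb_cintb_sch.
Qed.

Lemma schwartz_norm_wt psi : sch psi -> forall x,
  normc (psi x) <= (n.+1%:R ^+ (n * 2) * fine (schwartz_norm (n * 2) psi)) * wt x.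
Proof.
move=> sp; apply: rapid_wt => x.
have /schP[_ /(_ (n * 2)%N) fin] := sp.
have le0 : (0 <= schwartz_norm (n * 2) psi)%E.
  apply: (@le_trans _ _ ((1 + euclid_norm (0 : 'rV[R]_n)) ^+ (n * 2) * normc (psi 0))%:E).
    by rewrite lee_fin mulr_ge0 ?normc_ge0// exprn_ge0// addr_ge0// sqrtr_ge0.
  by apply: ereal_sup_ubound; exists ([::], 0).
have h : (1 + euclid_norm x) ^+ (n * 2) * normc (psi x) <= fine (schwartz_norm (n * 2) psi).
  rewrite -lee_fin fineK ?ge0_fin_numE//.
  by apply: ereal_sup_ubound; exists ([::], x).
apply: le_trans (_ : n.+1%:R ^+ (n * 2) * ((1 + euclid_norm x) ^+ (n * 2) * normc (psi x)) <= _).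
  rewrite mulrA -exprMn ler_wpM2r ?normc_ge0// lerXn2r ?nnegrE ?jap_ge0 ?jap_euclid_norm//.
  by rewrite mulr_ge0// addr_ge0// sqrtr_ge0.
by rewrite ler_wpM2l// exprn_ge0.
Qed.

Lemma tempered_wtb g : wtb g -> tempered (int_functional g).
Proof.
move=> wg; split.
  move=> a u v /schP su /schP sv; rewrite /int_functional.
  have iu := wtb_cintb_sch wg su; have iv := wtb_cintb_sch wg sv.
  rewrite -cintZ// -cintD//; last exact: cintbZ.
  by apply: eq_cint => x; ring.
set I := \int[mu]_x (normc (g x) * wt x).
exists (n * 2)%N, (2 * (n.+1%:R ^+ (n * 2) * I)) => psi spsi; have /schP sp := spsi.
have [_ /(_ (n * 2)%N) fin] := spsi.
have le0 : (0 <= schwartz_norm (n * 2) psi)%E.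
  apply: (@le_trans _ _ ((1 + euclid_norm (0 : 'rV[R]_n)) ^+ (n * 2) * normc (psi 0))%:E).
    by rewrite lee_fin mulr_ge0 ?normc_ge0// exprn_ge0// addr_ge0// sqrtr_ge0.
  by apply: ereal_sup_ubound; exists ([::], 0).
rewrite -[schwartz_norm _ _]fineK ?ge0_fin_numE// -EFinM lee_fin.
apply: le_trans (wtb_cint_le wg (cmfun_sch sp) (schwartz_norm_wt sp)) _.
by rewrite -/I le_eqVlt; apply/orP; left; apply/eqP; ring.
Qed.

(** Takes the place of Hölder's inequality: [le_powR_linear] at [a = c], together with [wt <= 1],
    bounds the integrand by [c * wt] plus [c^(1-p) * |g|^p], and the integral of the latter is at
    most [c]. *)
Lemma integral_normc_wt_le (p c : R) g : 1 <= p -> 0 < c -> cmfun g ->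
  (\int[mu]_x (normc (g x) `^ p)%:E <= (c `^ p)%:E)%E ->
  (\int[mu]_x (normc (g x) * wt x)%:E <= (c * (1 + wtint R n))%:E)%E.
Proof.
move=> p1 c0 mg hg; have mn := cmfun_normc mg.
have mp : measurable_fun setT (fun x => normc (g x) `^ p).
  by apply: (measurableT_comp (measurable_powR p)).
apply: (@le_trans _ _ (\int[mu]_x ((c * wt x)%:E + (c `^ (1 - p))%:E * (normc (g x) `^ p)%:E))%E).
  apply: ge0_le_integral => //.
  - by move=> x _; rewrite lee_fin mulr_ge0 ?normc_ge0 ?wt_ge0.
  - by apply/measurable_EFinP; apply: measurable_funM => //; exact: measurable_wt.
  - apply: emeasurable_funD; apply/measurable_EFinP; last exact: measurable_funM.
    by apply: measurable_funM => //; exact: measurable_wt.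
  move=> x _; rewrite lee_fin.
  apply: le_trans (_ : (c + c `^ (1 - p) * normc (g x) `^ p) * wt x <= _).
    by rewrite ler_wpM2r ?wt_ge0// le_powR_linear ?normc_ge0.
  by rewrite mulrDl lerD2l ler_piMr ?wt_le1// mulr_ge0 ?powR_ge0.
rewrite ge0_integralD//; last 4 first.
- by move=> x _; rewrite lee_fin mulr_ge0 ?wt_ge0 ?ltW.
- by apply/measurable_EFinP; apply: measurable_funM => //; exact: measurable_wt.
- by move=> x _; rewrite lee_fin mulr_ge0 ?powR_ge0.
- by apply/measurable_EFinP; exact: measurable_funM.
rewrite mulrDr mulr1 (addrC c) EFinD; apply: leeD.
  have ic := @integrable_Cwt R n c.
  rewrite -[leLHS]fineK; last exact: (integrable_fin_num measurableT ic).
  rewrite lee_fin /wtint -RintegralZl//; exact: integrable_wt.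

rewrite ge0_integralZl_EFin ?powR_ge0//; last 2 first.
- by move=> x _; rewrite lee_fin powR_ge0.
- exact/measurable_EFinP.
apply: le_trans (lee_wpmul2l _ hg) _; first by rewrite lee_fin powR_ge0.
rewrite -EFinM -powRD; last by rewrite (gt_eqF c0) implybT.
by rewrite subrK powRr1// ltW.
Qed.

Lemma wtb_series (p : R) (g : nat -> 'rV[R]_n -> R[i]) (c : nat -> R) :
  1 <= p -> (forall j, 0 < c j) -> (\sum_(j <oo) (c j)%:E < +oo)%E -> (forall j, cmfun (g j)) ->
  (forall j, (\int[mu]_x (normc (g j x) `^ p)%:E <= (c j `^ p)%:E)%E) ->
  (\int[mu]_x \sum_(j <oo) (normc (g j x) * wt x)%:E < +oo)%E.
Proof.
move=> p1 c0 cs mg hg.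
rewrite integral_nneseries//; last 2 first.
- move=> j; apply/measurable_EFinP; apply: measurable_funM; last exact: measurable_wt.
  exact: cmfun_normc.
- by move=> j x _; rewrite lee_fin mulr_ge0 ?normc_ge0 ?wt_ge0.
apply: (@le_lt_trans _ _ ((1 + wtint R n)%:E * \sum_(j <oo) (c j)%:E)%E).
  rewrite -nneseriesZl; last by move=> j _; rewrite lee_fin ltW.
  apply: lee_nneseries => [j _ _|j _].
    by apply: integral_ge0 => x _; rewrite lee_fin mulr_ge0 ?normc_ge0 ?wt_ge0.
  by rewrite -EFinM mulrC; exact: (integral_normc_wt_le p1).
by apply: lte_mul_pinfty => //; rewrite lee_fin addr_ge0 ?wtint_ge0.
Qed.

Lemma wt_gt0 (x : 'rV[R]_n) : 0 < wt x.
Proof. by apply: prodr_gt0 => i _; rewrite invr_gt0 ltr_pwDl// sqr_ge0. Qed.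

(** Dominated convergence with [C] times the sum of the [normc (gj j) * wt] as majorant. That sum is
    finite only almost everywhere, hence the [fine] in its definition. *)
Lemma series_cint_limit (gj : nat -> 'rV[R]_n -> R[i]) g (h : 'rV[R]_n -> R[i]) (C : R) :
  cmfun g -> (forall j, wtb (gj j)) ->
  (\int[mu]_y \sum_(j <oo) (normc (gj j y) * wt y)%:E < +oo)%E ->
  {ae mu, forall y, forall e, 0 < e -> \forall N \near \oo, normc (\sum_(j < N) gj j y - g y) <= e} ->
  cmfun h -> (forall y, normc (h y) <= C * wt y) ->
  cintb mu (fun y => g y * h y) /\
  forall e, 0 < e -> \forall N \near \oo,
    normc (\sum_(j < N) cint mu (fun y => gj j y * h y) - cint mu (fun y => g y * h y)) <= e.
Proof.
move=> mg wgj dom lim mh hC.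
have C0 : 0 <= C by have := le_trans (normc_ge0 _) (hC 0); rewrite pmulr_lge0// wt_gt0.
pose D y : \bar R := (\sum_(j <oo) (normc (gj j y) * wt y)%:E)%E.
have D0 y : (0 <= D y)%E by apply: nneseries_ge0 => j _ _; rewrite lee_fin mulr_ge0 ?normc_ge0 ?wt_ge0.
have mj j : measurable_fun setT (fun y => (normc (gj j y) * wt y)%:E).
  apply/measurable_EFinP; apply: measurable_funM; last exact: measurable_wt.
  exact: cmfun_normc (wgj j).1.
have mD : measurable_fun setT D.
  apply: (@ge0_emeasurable_sum _ _ _ _ _ xpredT) => // j y _ _.
  by rewrite lee_fin mulr_ge0 ?normc_ge0 ?wt_ge0.
have iD : mu.-integrable setT D.
  apply/integrableP; split => //; rewrite (eq_integral D)// => y _; by rewrite gee0_abs.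
have aD := integrable_ae measurableT iD.
pose E y := C * fine (D y).
have iE : mu.-integrable setT (EFin \o E).
  have iF : mu.-integrable setT (EFin \o (fun y => fine (D y))).
    have mF : measurable_fun setT (fun y => fine (D y)).
      exact: (measurableT_comp (@fine_measurable R setT measurableT)).
    apply: lty_integrable_ge0 => // [y|]; first by rewrite fine_ge0.
    apply: le_lt_trans dom; apply: ge0_le_integral => //.
    - by move=> y _; rewrite lee_fin fine_ge0.
    - exact/measurable_EFinP.
    - by move=> y _; rewrite -/(D y); case: (D y) (D0 y).
  have := integrableZl measurableT C iF.
  by apply: eq_integrable => // y _; rewrite /= EFinM.
have [|||||] := @cint_dominated _ _ _ mu
    (fun N y => (\sum_(j < N) gj j y) * h y) (fun y => g y * h y) E.
- move=> N; apply: cmfunM; last exact: mh.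
  by apply: cmfun_sum => j; exact: (wgj j).1.
- by apply: cmfunM; [exact: mg|exact: mh].
- exact: iE.
- apply: filterS lim => y H e e0.
  have e0' : 0 < e / (normc (h y) + 1) by rewrite divr_gt0// ltr_wpDl ?normc_ge0.
  apply: filterS (H _ e0') => N Hn; rewrite -mulrBl normcM.
  apply: (@le_trans _ _ (e / (normc (h y) + 1) * normc (h y))).
    by rewrite ler_wpM2r ?normc_ge0.
  by rewrite mulrAC ler_pdivrMr ?ltr_wpDl ?normc_ge0// ler_wpM2l ?(ltW e0)// lerDl.
- move=> N; apply: filterS aD => y /(_ I) fD; rewrite normcM.
  have h1 : normc (\sum_(j < N) gj j y) * wt y <= fine (D y).
    apply: le_trans (_ : (\sum_(j < N) normc (gj j y)) * wt y <= _).
      by rewrite ler_wpM2r ?wt_ge0 ?normc_sum.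
    rewrite mulr_suml -lee_fin fineK// -sumEFin.
    rewrite -(big_mkord xpredT (fun j => (normc (gj j y) * wt y)%:E)).
    by apply: nneseries_lim_ge => j _ _; rewrite lee_fin mulr_ge0 ?normc_ge0 ?wt_ge0.
  apply: le_trans (_ : normc (\sum_(j < N) gj j y) * (C * wt y) <= _).
    by rewrite ler_wpM2l ?normc_ge0.
  by rewrite mulrCA ler_wpM2l.
move=> ig H; split=> // e e0; apply: filterS (H e e0) => N.
suff -> : cint mu (fun y => (\sum_(j < N) gj j y) * h y) = \sum_(j < N) cint mu (fun y => gj j y * h y) by [].
rewrite -cint_sum; last by move=> j; exact: wtb_cintb hC.
by apply: eq_cint => y; rewrite mulr_suml.
Qed.

End weighted.

(** * One-dimensional blocks *)

Section kernel_convolution.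
Variables (R : realType) (phi : nat -> 'rV[R]_1 -> R[i]).
Hypothesis hphi : dyadic_resolution phi.
Local Notation mu := (lebesgue_rV R 1).
Implicit Types (g psi : 'rV[R]_1 -> R[i]) (y z : 'rV[R]_1) (k : nat).

Definition conv k g z : R[i] := cint mu (fun y => g y * kernel phi k (z - y)).

Lemma cmfun_kernel_sub k : cmfun (fun w : 'rV[R]_1 * 'rV[R]_1 => kernel phi k (w.1 - w.2)).
Proof.
apply: (cmfun_comp (cmfun_sch (sch_kernel hphi k))).
by apply: measurable_rV_sub; [exact: measurable_fst|exact: measurable_snd].
Qed.

Lemma cmfun_kernel_subr k z : cmfun (fun y => kernel phi k (z - y)).
Proof. by have := cmfun_comp (cmfun_kernel_sub k) (pair1_measurable z). Qed.

(** Peetre's inequality moves the decay from [z - y] to [y] at the price of [jap z ^+ 2]. The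
    constant depends on [k], so this yields integrability and limits but no uniform estimate. *)
Lemma kernel_sub_wt k : exists2 C : R, 0 <= C &
  forall z y, normc (kernel phi k (z - y)) <= C * jap z ^+ 2 * wt y.
Proof.
have [_ /(_ [::]) rk] := sch_kernel hphi k; have [C C0 hC] := rk 2%N.
exists C => // z; apply: rapid_wt => y; rewrite mul1n.
have := hC tt (z - y); rewrite mulr1 => h.
apply: (@le_trans _ _ ((jap z * jap (z - y)) ^+ 2 * normc (kernel phi k (z - y)))).
  rewrite ler_wpM2r ?normc_ge0// lerXn2r ?nnegrE ?mulr_ge0 ?jap_ge0//.
  by rewrite -(japN (z - y)) (le_trans _ (japD _ _))// opprB addrC subrK.
by rewrite exprMn -mulrA mulrC ler_wpM2r// exprn_ge0 ?jap_ge0.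
Qed.

Lemma cintb_conv k g z : wtb g -> cintb mu (fun y => g y * kernel phi k (z - y)).
Proof.
move=> wg; have [C C0 hC] := kernel_sub_wt k.
exact: wtb_cintb wg (cmfun_kernel_subr k z) (hC z).
Qed.

Lemma cmfun_conv k g : cmfun g -> cmfun (conv k g).
Proof.
move=> mg;
have h : cmfun (fun w : 'rV[R]_1 * 'rV[R]_1 => g w.2 * kernel phi k (w.1 - w.2)).
  apply: cmfunM; last exact: cmfun_kernel_sub.
  by apply: (cmfun_comp mg); exact: measurable_snd.
exact: (cmfun_cint1 mu h).
Qed.

Lemma cintb_conv_prod k g psi : wtb g -> sch psi ->
  cintb (mu \x mu)%E (fun w => g w.2 * (kernel phi k (w.1 - w.2) * psi w.1)).
Proof.
move=> wg sp; have [C C0 hC] := kernel_sub_wt k.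
(* Two powers of decay absorb [jap z ^+ 2], the other two provide [wt z]. *)
have [_ /(_ [::]) rp] := sp; have [D D0 hD] := rp (2 + 2)%N.
have hw z : jap z ^+ 2 * normc (psi z) <= D * wt z.
  have -> : jap z ^+ 2 * normc (psi z) = normc ((jap z ^+ 2)%:C * psi z).
    by rewrite normcM normc_real ger0_norm// exprn_ge0 ?jap_ge0.
  apply: (@rapid_wt _ _ (fun z => (jap z ^+ 2)%:C * psi z)) => {}z; rewrite mul1n.
  rewrite normcM normc_real ger0_norm ?exprn_ge0 ?jap_ge0// mulrA -exprD.
  by have := hD tt z; rewrite mulr1.
have i1 : cintb mu (fun y => (normc (g y) * wt y)%:C).
  split => /=; first exact: wtb_integrable.
  exact: integrable0.
have i2 : cintb mu (fun z : 'rV[R]_1 => (wt z)%:C).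
  split => /=; first exact: integrable_wt.
  exact: integrable0.
have [i12 _] := cintbZ (C * D)%:C (cintb_tensor i2 i1).
apply: cintb_le i12 _.
  apply: cmfunM; first by apply: (cmfun_comp wg.1); exact: measurable_snd.
  apply: cmfunM; first exact: cmfun_kernel_sub.
  by apply: (cmfun_comp (cmfun_sch sp)); exact: measurable_fst.
move=> [z y] /=; rewrite !mulr0 !mul0r !subr0 normcM (normcM (kernel phi k (z - y))).
apply: (@le_trans _ _ (normc (g y) * (C * jap z ^+ 2 * wt y * normc (psi z)))).
  by rewrite ler_wpM2l ?normc_ge0// ler_wpM2r ?normc_ge0//; exact: hC.
rewrite [leLHS](_ : _ = (C * (normc (g y) * wt y)) * (jap z ^+ 2 * normc (psi z))); last by ring.
rewrite [leRHS](_ : _ = (C * (normc (g y) * wt y)) * (D * wt z)); last by ring.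
by rewrite ler_wpM2l// !mulr_ge0 ?normc_ge0 ?wt_ge0.
Qed.

(** Fubini for the transposed kernel; in effect [conv k g] represents the [k]-th block of
    [int_functional g]. *)
Lemma conv_Pblock k g psi : wtb g -> sch psi ->
  cintb mu (fun z => conv k g z * psi z) /\
  cint mu (fun y => g y * Pblock phi k psi y) = cint mu (fun z => conv k g z * psi z).
Proof.
move=> wg sp; have ip := cintb_conv_prod k wg sp.
have e z : cint mu (fun y => g y * (kernel phi k (z - y) * psi z)) = conv k g z * psi z.
  rewrite /conv mulrC -cintZ; last exact: cintb_conv.
  by apply: eq_cint => y; ring.
split.
  have := cintb_fubini1 ip => /=.
  by rewrite (_ : (fun x => _) = fun z => conv k g z * psi z)//; apply/funext => z; exact: e.
transitivity (cint (mu \x mu)%E (fun w => g w.2 * (kernel phi k (w.1 - w.2) * psi w.1))).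
  rewrite cint_fubini2//=; apply: eq_cint => y.
  rewrite Pblock_kernel// -cintZ//.
  have [C C0 hC] := kernel_bound hphi.
  apply: (@cintbM_bounded _ _ _ _ _ _ (C * (2 ^+ k * 1))); first exact: cintb_sch.
    apply: (cmfun_comp (cmfun_sch (sch_kernel hphi k))).
    by apply: measurable_rV_sub => //; exact: measurable_cst.
  by move=> z; apply: le_trans (hC _ _) _; rewrite ler_wpM2l// ler_wpM2l ?exprn_ge0// wt_le1.
by rewrite cint_fubini1//=; apply: eq_cint => z; exact: e.
Qed.

Lemma kernel_int_sub : exists2 C : R, 0 < C & forall k y,
  (\int[mu]_z (normc (kernel phi k (z - y)))%:E <= C%:E)%E /\
  (\int[mu]_z (normc (kernel phi k (y - z)))%:E <= C%:E)%E.
Proof.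
have [C C0 hC] := kernel_int hphi; exists (C + 1); first by rewrite ltr_wpDl.
have mk k : measurable_fun setT (fun x => (normc (kernel phi k x))%:E).
  by apply/measurable_EFinP; exact: cmfun_normc (cmfun_sch (sch_kernel hphi k)).
have tr y (f : 'rV[R]_1 -> \bar R) : measurable_fun setT f -> (forall x, 0 <= f x)%E ->
    (\int[mu]_z f (z - y)%R = \int[mu]_z f z)%E.
  move=> mf f0; apply/esym.
  exact: (ge0_integral_image (measurable_rV_add (- y)) (lebesgue_rV_translation (- y)) mf).
have op (f : 'rV[R]_1 -> \bar R) : measurable_fun setT f -> (forall x, 0 <= f x)%E ->
    (\int[mu]_z f (- z)%R = \int[mu]_z f z)%E.
  move=> mf f0; apply/esym; apply: (ge0_integral_image _ (@lebesgue_rV1_opp R)) => //.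
  rewrite (_ : (fun x : 'rV[R]_1 => - x) = fun x => (-1) *: x); first exact: measurable_rV_scale.
  by apply/funext => x; rewrite scaleN1r.
have n0 k x : (0 <= (normc (kernel phi k x))%:E)%E by rewrite lee_fin normc_ge0.
have hC1 k : (\int[mu]_x (normc (kernel phi k x))%:E <= (C + 1)%:E)%E.
  by rewrite (le_trans (hC k))// lee_fin lerDl.
move=> k y; split; first by rewrite (tr y (fun x => (normc (kernel phi k x))%:E)).
rewrite -[leLHS](tr (- y)); last by [].
  rewrite (eq_integral (fun z => (normc (kernel phi k (- z)))%:E)).
    by rewrite (op (fun x => (normc (kernel phi k x))%:E)).
  by move=> z _; rewrite opprK opprD addrA (addrAC y) addrN sub0r.
apply/measurable_EFinP/cmfun_normc; exact: cmfun_kernel_subr.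
Qed.

End kernel_convolution.

(** Each term of the sum is at most its total, so the [p]-th roots of the [U j] are dominated by a
    multiple of [b^(-2j/p)], a summable geometric sequence because [b > 1]. *)
Lemma summable_norm_bounds (R : realType) (U : nat -> \bar R) (b p r : R) : 1 < b -> 1 <= p -> 0 < r ->
  (forall j, 0 <= U j)%E -> (\sum_(j <oo) ((b ^+ (2 * j))%:E * U j) `^ r < +oo)%E ->
  exists c : nat -> R, [/\ forall j, 0 < c j, (\sum_(j <oo) (c j)%:E < +oo)%E &
    forall j, (U j <= (c j `^ p)%:E)%E].
Proof.
move=> b1 p1 r0 U0 fin; have b0 : 0 < b := lt_trans ltr01 b1.
have p0 : 0 < p := lt_le_trans ltr01 p1.
pose S := fine (\sum_(j <oo) ((b ^+ (2 * j))%:E * U j) `^ r)%E.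
have t0 j : (0 <= ((b ^+ (2 * j))%:E * U j) `^ r)%E by exact: poweR_ge0.
have SE : (\sum_(j <oo) ((b ^+ (2 * j))%:E * U j) `^ r)%E = S%:E.
  by rewrite fineK// ge0_fin_numE// nneseries_ge0.
have S0 : 0 <= S by rewrite -lee_fin -SE nneseries_ge0.
pose A := S `^ r^-1 + 1; have A0 : 0 < A by rewrite ltr_wpDl ?powR_ge0.
have bU j : ((b ^+ (2 * j))%:E * U j <= A%:E)%E.
  apply: (@le_trans _ _ (S `^ r^-1)%:E); last by rewrite lee_fin lerDl.
  have bU0 : (0 <= (b ^+ (2 * j))%:E * U j)%E by rewrite mule_ge0// lee_fin exprn_ge0 ?ltW.
  rewrite -[leLHS]poweRe1// -(mulfV (lt0r_neq0 r0)) poweRrM -poweR_EFin.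
  by apply: ge0_le_poweR; rewrite ?invr_ge0 ?(ltW r0)// -SE le_term_nneseries.
pose x := (b ^- 2) `^ p^-1.
have x01 : 0 <= x < 1.
  have e1 : 1 `^ p^-1 = 1 :> R by rewrite powR1.
  rewrite powR_ge0/= -[ltRHS]e1 gt0_ltr_powR ?invr_gt0 ?nnegrE ?invr_ge0 ?exprn_ge0 ?(ltW b0)//.
  by rewrite invf_lt1 ?exprn_gt0// exprn_egt1.
have x0 : 0 < x by rewrite powR_gt0// invr_gt0 exprn_gt0.
exists (fun j => A `^ p^-1 * x ^+ j); split.
- by move=> j; rewrite mulr_gt0 ?powR_gt0 ?exprn_gt0.
(* For [k = 1] the shifted weight is [x ^+ j], so [shift_wt_sumr] is the geometric series. *)
- apply: (@le_lt_trans _ _ ((A `^ p^-1)%:E * \sum_(j <oo) (shift_wt x 1 j)%:E)%E).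
    rewrite -nneseriesZl; last by move=> j _; rewrite lee_fin shift_wt_ge0 ?ltW.
    apply: lee_nneseries => [j _ _|j _].
      by rewrite lee_fin mulr_ge0 ?powR_ge0 ?exprn_ge0 ?ltW.
    by rewrite /shift_wt/= subn1 EFinM.
  apply: lte_mul_pinfty; rewrite ?lee_fin ?powR_ge0//.
  by apply: le_lt_trans (shift_wt_sumr 1 x01) _; rewrite ltry.
- move=> j; rewrite powRM ?powR_ge0 ?exprn_ge0 ?(ltW x0)//.
  rewrite -powRrM mulVf ?gt_eqF// powRr1 ?(ltW A0)//.
  have -> : (x ^+ j) `^ p = b ^- (2 * j).
    have xp : x `^ p = b ^- 2.
      by rewrite /x -powRrM mulVf ?gt_eqF// powRr1// invr_ge0 exprn_ge0// ltW.
    rewrite -(powR_mulrn j (ltW x0)) -powRrM mulrC powRrM xp.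
    by rewrite powR_mulrn ?invr_ge0 ?exprn_ge0 ?(ltW b0)// exprVn -exprM.
  by rewrite EFinM muleC -lee_pdivrMl ?invr_gt0 ?exprn_gt0// invrK.
Qed.

(** * Jensen's inequality for the blocks of a series *)

Section slice_besov.
Variables (R : realType) (phi : nat -> 'rV[R]_1 -> R[i]).
Hypothesis hphi : dyadic_resolution phi.
Local Notation mu := (lebesgue_rV R 1).
Implicit Types (g h psi : 'rV[R]_1 -> R[i]) (y z : 'rV[R]_1) (k : nat).

(** The convolution of [|h|^p] with the modulus of the kernel, by which Jensen's inequality bounds
    [|conv k h|^p] up to a constant. *)
Definition conv_pow (p : R) k h z : \bar R :=
  (\int[mu]_y (normc (h y) `^ p * normc (kernel phi k (z - y)))%:E)%E.

Lemma measurable_conv_pow_integrand p k h : cmfun h ->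
  measurable_fun setT (fun w : 'rV[R]_1 * 'rV[R]_1 =>
    (normc (h w.2) `^ p * normc (kernel phi k (w.1 - w.2)))%:E).
Proof.
move=> mh; apply/measurable_EFinP; apply: measurable_funM; last exact: cmfun_normc (cmfun_kernel_sub hphi k).
apply: (measurableT_comp (measurable_powR p)); apply: cmfun_normc.
by apply: (cmfun_comp mh); exact: measurable_snd.
Qed.

Lemma conv_pow_ge0 p k h z : (0 <= conv_pow p k h z)%E.
Proof. by apply: integral_ge0 => y _; rewrite lee_fin mulr_ge0 ?powR_ge0 ?normc_ge0. Qed.

Lemma measurable_conv_pow p k h : cmfun h -> measurable_fun setT (conv_pow p k h).
Proof.
move=> mh; have := @measurable_fun_fubini_tonelli_F _ _ _ _ R mu _ (measurable_conv_pow_integrand p k mh).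
by apply => w; rewrite lee_fin mulr_ge0 ?powR_ge0 ?normc_ge0.
Qed.

(** Tonelli and the [L^1] bound of the kernels; the constant depends neither on [k] nor on [p]. *)
Lemma integral_conv_pow : exists2 C : R, 0 < C & forall p k h, cmfun h ->
  (\int[mu]_z conv_pow p k h z <= C%:E * \int[mu]_y (normc (h y) `^ p)%:E)%E.
Proof.
have [C C0 hC] := kernel_int_sub hphi; exists C => // p k h mh.
have mF := measurable_conv_pow_integrand p k mh.
have F0 (w : 'rV[R]_1 * 'rV[R]_1) :
    (0 <= (normc (h w.2) `^ p * normc (kernel phi k (w.1 - w.2)))%:E)%E.
  by rewrite lee_fin mulr_ge0 ?powR_ge0 ?normc_ge0.
have mp : measurable_fun setT (fun y => normc (h y) `^ p).
  by apply: (measurableT_comp (measurable_powR p)); exact: cmfun_normc.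
have mk y : measurable_fun setT (fun z => normc (kernel phi k (z - y))).
  apply: cmfun_normc; apply: (cmfun_comp (cmfun_sch (sch_kernel hphi k))).
  by apply: measurable_rV_sub => //; exact: measurable_cst.
rewrite [leLHS](@fubini_tonelli _ _ _ _ R mu mu _ mF F0).
rewrite -ge0_integralZl_EFin ?(ltW C0)//; last 2 first.
- by move=> y _; rewrite lee_fin powR_ge0.
- exact/measurable_EFinP.
apply: ge0_le_integral => //.
- by move=> y _; apply: integral_ge0 => z _.
- exact: (@measurable_fun_fubini_tonelli_G _ _ _ _ R mu _ mF F0).
- by apply/measurable_EFinP; apply: measurable_funM.
move=> y _ /=; rewrite (eq_integral (fun z => (normc (h y) `^ p)%:E * (normc (kernel phi k (z - y)))%:E)%E)//.
rewrite ge0_integralZl_EFin ?powR_ge0//; last 2 first.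
- by move=> z _; rewrite lee_fin normc_ge0.
- exact/measurable_EFinP.
rewrite muleC; apply: lee_wpmul2r; first by rewrite lee_fin powR_ge0.
exact: (hC k y).1.
Qed.

(** Jensen's inequality with its parameter [t] left free: [t] will be chosen separately for each
    piece, before the pieces are summed. *)
Lemma conv_le_linear : exists2 C : R, 0 < C & forall (p : R) k h z (t : R),
  1 <= p -> wtb h -> 0 < t ->
  ((normc (conv phi k h z))%:E <= (t * C)%:E + (2 * t `^ (1 - p))%:E * conv_pow p k h z)%E.
Proof.
have [C C0 hC] := kernel_int_sub hphi; exists (2 * C); first by rewrite mulr_gt0.
move=> p k h z t p1 wh t0; have mh := wh.1.
have mp : measurable_fun setT (fun y => normc (h y) `^ p).
  by apply: (measurableT_comp (measurable_powR p)); exact: cmfun_normc.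
have mk : measurable_fun setT (fun y => normc (kernel phi k (z - y))).
  by apply: cmfun_normc; exact: cmfun_kernel_subr.
apply: le_trans (cint_normc_le (cintb_conv hphi k z wh)) _.
apply: (@le_trans _ _ (2%:E * \int[mu]_y (t%:E * (normc (kernel phi k (z - y)))%:E +
   (t `^ (1 - p))%:E * (normc (h y) `^ p * normc (kernel phi k (z - y)))%:E))%E).
  apply: lee_wpmul2l => //; apply: ge0_le_integral => //.
  - by move=> y _; rewrite lee_fin normc_ge0.
  - apply/measurable_EFinP; apply: cmfun_normc; exact: (cintb_cmfun (cintb_conv hphi k z wh)).
  - by apply: emeasurable_funD; apply/measurable_EFinP; do ?apply: measurable_funM.
  move=> y _; rewrite lee_fin normcM mulrA -mulrDl ler_wpM2r ?normc_ge0//.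
  by rewrite le_powR_linear ?normc_ge0.
rewrite ge0_integralD//; last 4 first.
- by move=> y _; rewrite lee_fin mulr_ge0 ?normc_ge0 ?ltW.
- by apply/measurable_EFinP; apply: measurable_funM.
- by move=> y _; rewrite lee_fin !mulr_ge0 ?powR_ge0 ?normc_ge0.
- by apply/measurable_EFinP; do ?apply: measurable_funM.
rewrite ge0_integralZl_EFin ?(ltW t0)//; last 2 first.
- by move=> y _; rewrite lee_fin normc_ge0.
- exact/measurable_EFinP.
rewrite ge0_integralZl_EFin ?powR_ge0//; last 2 first.
- by move=> y _; rewrite lee_fin mulr_ge0 ?powR_ge0 ?normc_ge0.
- by apply/measurable_EFinP; apply: measurable_funM.
rewrite ge0_muleDr ?mule_ge0 ?lee_fin ?powR_ge0 ?conv_pow_ge0 ?(ltW t0)//; last first.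
  by apply: integral_ge0 => y _; rewrite lee_fin normc_ge0.
apply: leeD; last by rewrite muleA -EFinM.
rewrite muleA -EFinM (_ : t * (2 * C) = 2 * t * C); last by ring.
rewrite (EFinM _ C); apply: lee_wpmul2l; first by rewrite lee_fin mulr_ge0 ?ltW.
exact: (hC k z).2.
Qed.

Lemma conv_series_limit (gj : nat -> 'rV[R]_1 -> R[i]) g k z :
  wtb g -> (forall j, wtb (gj j)) ->
  (\int[mu]_y \sum_(j <oo) (normc (gj j y) * wt y)%:E < +oo)%E ->
  {ae mu, forall y, forall e, 0 < e -> \forall n \near \oo, normc (\sum_(j < n) gj j y - g y) <= e} ->
  forall e, 0 < e -> \forall n \near \oo,
    normc (\sum_(j < n) conv phi k (gj j) z - conv phi k g z) <= e.
Proof.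
move=> wg wgj dom lim; have [C C0 hC] := kernel_sub_wt hphi k.
have [_ H] := series_cint_limit wg.1 wgj dom lim (cmfun_kernel_subr hphi k z) (hC z).
exact: H.
Qed.

(** With [m = j + 1 - k] the left side is [a^(1-p) * b1^(m(p-1))]; enlarging [p - 1] to [p] makes
    the weight geometric with ratio [b1^p]. *)
Lemma shift_wt_linearize (b1 a p : R) k j : 1 < b1 -> 0 < a -> 1 <= p -> (k <= j.+1)%N ->
  (a * shift_wt b1^-1 k j) `^ (1 - p) <= a `^ (1 - p) * shift_wt (b1 `^ p) k j.
Proof.
move=> b11 a0 p1 kj; have b10 : 0 < b1 := lt_trans ltr01 b11.
rewrite /shift_wt kj; set m := (j.+1 - k)%N.
have v1 : 1 <= b1 ^+ m by rewrite exprn_ege1// ltW.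
have v0 : 0 < b1 ^+ m by rewrite exprn_gt0.
rewrite powRM ?(ltW a0) ?exprn_ge0 ?invr_ge0 ?(ltW b10)// ler_wpM2l ?powR_ge0//.
rewrite exprVn -powR_inv1 ?(ltW v0)// -powRrM.
have -> : (b1 `^ p) ^+ m = (b1 ^+ m) `^ p.
  rewrite -(powR_mulrn m (powR_ge0 _ _)) -powRrM -(powR_mulrn m (ltW b10)) -powRrM.
  by rewrite mulrC.
by rewrite ler_powR//; lra.
Qed.

Section block_bound.
Variables (p b1 : R) (gj : nat -> 'rV[R]_1 -> R[i]) (g : 'rV[R]_1 -> R[i]).
Hypotheses (p1 : 1 <= p) (b11 : 1 < b1) (wg : wtb g) (wgj : forall j, wtb (gj j)).
Hypothesis dom : (\int[mu]_y \sum_(j <oo) (normc (gj j y) * wt y)%:E < +oo)%E.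
Hypothesis lim : {ae mu, forall y, forall e, 0 < e ->
  \forall n \near \oo, normc (\sum_(j < n) gj j y - g y) <= e}.
Hypothesis zero : forall j k, (j.+2 <= k)%N -> {ae mu, forall z, conv phi k (gj j) z = 0}.

Let b := b1 `^ p.

(** For the [j]-th piece [t = a * b1^-(j+1-k)] is inserted in [conv_le_linear]: the first terms add
    up to at most [a * W], the second ones to at most [a^(1-p)] times twice the sum on the right. As
    [a] is still free, [powR_le_of_linear] produces the power [p]. If the sum is infinite there is
    nothing to prove. *)
Lemma conv_pow_sum_bound : exists2 C : R, 0 < C & forall k, {ae mu, forall z,
  ((normc (conv phi k g z) `^ p)%:E <=
    C%:E * \sum_(j <oo) ((shift_wt b k j)%:E * conv_pow p k (gj j) z))%E}.
Proof.
have b10 : 0 < b1 := lt_trans ltr01 b11.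
have [C1 C10 hC1] := conv_le_linear.
have x01 : 0 <= b1^-1 < 1 by rewrite invr_ge0 (ltW b10)/= invf_lt1.
have x0 : 0 <= b1^-1 by case/andP: x01.
have b0 : 0 <= b by exact: powR_ge0.
pose W := C1 / (1 - b1^-1).
have W0 : 0 < W by rewrite divr_gt0// subr_gt0; case/andP: x01.
exists (2 `^ p * W `^ (p - 1) * 2); first by rewrite !mulr_gt0 ?powR_gt0.
move=> k.
have : {ae mu, forall z, forall j, (j.+2 <= k)%N -> conv phi k (gj j) z = 0}.
  apply/ae_foralln => j; have [jk|jk] := leqP j.+2 k.
    by apply: filterS (zero jk) => z ->.
  exact: nearW.
apply: filterS => z Hz.
pose V j := conv_pow p k (gj j) z.
have V0 j : (0 <= V j)%E by exact: conv_pow_ge0.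
have VT j : (0 <= (shift_wt b k j)%:E * V j)%E by rewrite mule_ge0// lee_fin shift_wt_ge0.
set Y := (\sum_(j <oo) _)%E.
have Y0 : (0 <= Y)%E by apply: nneseries_ge0.
have [Yoo|/negP] := boolP (Y == +oo%E).
  by rewrite (eqP Yoo) gt0_muley ?leey// lte_fin !mulr_gt0 ?powR_gt0.
move=> /negP; rewrite -ltey => Yfin.
have Yf : Y = (fine Y)%:E by rewrite fineK// ge0_fin_numE.
have term a j : 0 < a -> ((normc (conv phi k (gj j) z))%:E <=
    (a * C1)%:E * (shift_wt b1^-1 k j)%:E + (2 * a `^ (1 - p))%:E * ((shift_wt b k j)%:E * V j))%E.
  move=> a0; have [jk|jk] := leqP j.+2 k.
    rewrite Hz// normc0 adde_ge0 ?mule_ge0 ?lee_fin ?mulr_ge0 ?powR_ge0 ?(ltW a0) ?(ltW C10)//.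
      exact: shift_wt_ge0.
    exact: shift_wt_ge0.
  have t0 : 0 < a * shift_wt b1^-1 k j by rewrite mulr_gt0// /shift_wt -ltnS jk exprn_gt0 ?invr_gt0.
  apply: le_trans (hC1 p k (gj j) z _ p1 (wgj j) t0) _; apply: leeD.
    by rewrite -EFinM lee_fin le_eqVlt; apply/orP; left; apply/eqP; ring.
  rewrite muleA -EFinM; apply: lee_wpmul2r; first exact: V0.
  by rewrite lee_fin -mulrA ler_wpM2l//; exact: shift_wt_linearize.
have sum a n : 0 < a -> normc (\sum_(j < n) conv phi k (gj j) z) <= a * W + a `^ (1 - p) * (2 * fine Y).
  move=> a0; apply: le_trans (normc_sum _ _ _) _; rewrite -lee_fin -sumEFin.
  apply: (@le_trans _ _ (\sum_(j < n) ((a * C1)%:E * (shift_wt b1^-1 k j)%:E +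
      (2 * a `^ (1 - p))%:E * ((shift_wt b k j)%:E * V j)))%E).
    by apply: lee_sum => j _; exact: term.
  rewrite big_split/= EFinD; apply: leeD.
    rewrite -ge0_sume_distrr; last by move=> j _; rewrite lee_fin shift_wt_ge0.
    rewrite /W mulrA (EFinM (a * C1)); apply: lee_wpmul2l; first by rewrite lee_fin mulr_ge0 ?ltW.
    apply: le_trans (shift_wt_sumr k x01).
    rewrite -(big_mkord xpredT (fun j => (shift_wt b1^-1 k j)%:E)).
    by apply: nneseries_lim_ge => j _ _; rewrite lee_fin shift_wt_ge0.
  rewrite -ge0_sume_distrr; last by move=> j _; exact: VT.
  rewrite mulrA (mulrC _ 2) (EFinM _ (fine Y)) -Yf; apply: lee_wpmul2l; first by rewrite lee_fin mulr_ge0 ?powR_ge0.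
  rewrite -(big_mkord xpredT (fun j => ((shift_wt b k j)%:E * V j)%E)).
  by apply: nneseries_lim_ge => j _ _; exact: VT.
have bound a : 0 < a -> normc (conv phi k g z) <= a * W + a `^ (1 - p) * (2 * fine Y).
  move=> a0; apply/ler_addgt0Pl => e e0.
  have [N _ HN] := conv_series_limit k z wg wgj dom lim e0.
  have := HN N (leqnn N); rewrite -normcN opprB => h.
  rewrite -[X in normc X](subrK (\sum_(j < N) conv phi k (gj j) z)).
  by apply: le_trans (normcD _ _) _; apply: lerD => //; exact: sum.
have := powR_le_of_linear p1 (normc_ge0 _) W0 _ bound.
rewrite mulr_ge0 ?fine_ge0// => /(_ isT) h.
by rewrite Yf -EFinM lee_fin; apply: le_trans h _; rewrite !mulrA.
Qed.

End block_bound.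

End slice_besov.

(** * A Besov criterion for sums of series on the line *)

Section besov_of_series.
Variables (R : realType) (phi : nat -> 'rV[R]_1 -> R[i]).
Hypothesis hphi : dyadic_resolution phi.
Local Notation mu := (lebesgue_rV R 1).
Local Notation leb := (@lebesgue_measure R).

Lemma cLnormE n (p : R) (h : 'rV[R]_n -> R[i]) : 0 < p ->
  cLnorm p h = ((\int[lebesgue_rV R n]_y (normc (h y) `^ p)%:E) `^ p^-1)%E.
Proof.
move=> p0; rewrite /cLnorm unlock; congr (_ `^ _)%E.
by apply: eq_integral => y _; rewrite gee0_abs ?lee_fin ?normc_ge0// poweR_EFin.
Qed.

(** Reduces the vanishing of a block to countably many scalar conditions, which can be imposed on
    almost every slice at once. *)
Lemma conv_eq0 (e : nat -> 'rV[R]_1 -> R[i]) k h : (forall l, sch (e l)) ->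
  (forall u : R -> R[i], cmfun u -> (forall l, cintb leb (fun t => u t * e l (rV1 t)) /\
     cint leb (fun t => u t * e l (rV1 t)) = 0) -> {ae leb, forall t, u t = 0}) ->
  wtb h -> (forall l, cint mu (fun y => h y * Pblock phi k (e l) y) = 0) ->
  {ae mu, forall z, conv phi k h z = 0}.
Proof.
move=> se He wh H; apply: ae_rV1.
have mc := cmfun_conv hphi k wh.1.
apply: He => [|l]; first exact: cmfun_comp mc (@measurable_rV1 R).
have [h1 h2] := conv_Pblock hphi k wh (se l).
have mh := cintb_cmfun h1.
by split; [exact: (cintb_mu1 mh).1|rewrite -(cint_mu1 mh) -h2 H].
Qed.

Lemma dist_Lnorm_ge0 n (p : R) (T : functional R n) : (0 <= dist_Lnorm p T)%E.
Proof. by apply: le_ereal_inf_tmp => _ [h _ <-]; exact: Lnorm_ge0. Qed.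

Lemma powR_gt1 (a t : R) : 1 < a -> 0 < t -> 1 < a `^ t.
Proof.
move=> a1 t0; have e : 1 `^ t = 1 :> R by rewrite powR1.
by rewrite -[ltLHS]e gt0_ltr_powR ?nnegrE// (le_trans ler01)// ltW.
Qed.

(** [conv k g] is one representative of the [k]-th block, so its norm bounds the infimum
    [dist_Lnorm] from above. The vanishing hypothesis may take [wtb (gj j)] for granted, since the
    finiteness of the sum provides it. *)
Lemma besov_fun_of_series (s p q : R) (gj : nat -> 'rV[R]_1 -> R[i]) (g : 'rV[R]_1 -> R[i]) :
  0 < s -> 1 <= q -> q <= p -> cmfun g -> (forall j, cmfun (gj j)) ->
  {ae mu, forall y, forall e, 0 < e -> \forall n \near \oo, normc (\sum_(j < n) gj j y - g y) <= e} ->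
  (\sum_(j <oo) ((((2 `^ (s / 2)) `^ p) ^+ (2 * j))%:E *
     \int[mu]_y (normc (gj j y) `^ p)%:E) `^ (q / p) < +oo)%E ->
  (forall j k, (j.+2 <= k)%N -> wtb (gj j) -> {ae mu, forall z, conv phi k (gj j) z = 0}) ->
  besov_fun phi s p q%:E g.
Proof.
move=> s0 q1 qp mg mgj lim fin zero.
have p1 : 1 <= p := le_trans q1 qp.
have p0 : 0 < p := lt_le_trans ltr01 p1.
have q0 : 0 < q := lt_le_trans ltr01 q1.
have r01 : 0 < q / p <= 1 by rewrite divr_gt0//= ler_pdivrMr// mul1r.
have [r0 r1] := andP r01.
set b1 := 2 `^ (s / 2) in fin *; set b := b1 `^ p in fin *.
have b11 : 1 < b1.
  by apply: powR_gt1; [rewrite ltr1n|rewrite divr_gt0].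
have bb1 : 1 < b by exact: powR_gt1.
have U0 j : (0 <= \int[mu]_y (normc (gj j y) `^ p)%:E)%E.
  by apply: integral_ge0 => y _; rewrite lee_fin powR_ge0.
have [c [c0 cs cU]] := summable_norm_bounds bb1 p1 r0 U0 fin.
have dom := wtb_series p1 c0 cs mgj cU.
have wgj j : wtb (gj j).
  split => //; apply: le_lt_trans (integral_normc_wt_le p1 (c0 j) (mgj j) (cU j)) _.
  by rewrite ltry.
have mwt (h : 'rV[R]_1 -> R[i]) : cmfun h -> measurable_fun setT (fun y => (normc (h y) * wt y)%:E).
  move=> mh; apply/measurable_EFinP; apply: measurable_funM; last exact: measurable_wt.
  exact: cmfun_normc.
have wg : wtb g.
  split => //; apply: le_lt_trans dom; apply: ae_ge0_le_integral => //.
  - by move=> y _; rewrite lee_fin mulr_ge0 ?normc_ge0 ?wt_ge0.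
  - exact: mwt.
  - by move=> y _; apply: nneseries_ge0 => j _ _; rewrite lee_fin mulr_ge0 ?normc_ge0 ?wt_ge0.
  - apply: (@ge0_emeasurable_sum _ _ _ _ _ xpredT) => [j y _ _|j _]; last exact: mwt.
    by rewrite lee_fin mulr_ge0 ?normc_ge0 ?wt_ge0.
  (* [normc (g y)] is at most the sum of the [normc (gj j y)], by comparison with a partial sum up
     to [e]. *)
  apply: filterS lim => y Hy _; apply/lee_addgt0Pr => e e0.
  have [N _ /(_ N (leqnn N)) hN] := Hy e e0.
  apply: (@le_trans _ _ ((\sum_(j < N) normc (gj j y) * wt y) + e)%:E).
    rewrite lee_fin -mulr_suml.
    have ng : normc (g y) <= normc (\sum_(j < N) gj j y) + e.
      rewrite -[X in normc X](subKr (\sum_(j < N) gj j y)).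
      by apply: le_trans (normcB _ _) _; rewrite lerD2l.
    apply: le_trans (_ : (\sum_(j < N) normc (gj j y) + e) * wt y <= _).
      by rewrite ler_wpM2r ?wt_ge0// (le_trans ng)// lerD2r normc_sum.
    by rewrite mulrDl lerD2l ler_piMr ?wt_le1// ltW.
  rewrite EFinD leeD2r// -sumEFin.
  rewrite -(big_mkord xpredT (fun j => (normc (gj j y) * wt y)%:E)).
  by apply: nneseries_lim_ge => j _ _; rewrite lee_fin mulr_ge0 ?normc_ge0 ?wt_ge0.
have [C C0 hC] := conv_pow_sum_bound hphi p1 b11 wg wgj dom lim (fun j k jk => zero j k jk (wgj j)).
have [D D0 hD] := integral_conv_pow hphi.
exists (int_functional g); split; first exact: represents_wtb.
split; first exact: tempered_wtb.
pose B k := (\int[mu]_z (normc (conv phi k g z) `^ p)%:E)%E.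
have rep k : represents (conv phi k g) (dyadic_block phi k (int_functional g)).
  split; first exact: cmfun_conv.
  move=> psi /schP sp; have [h1 h2] := conv_Pblock hphi k wg sp.
  by split => //; exact: h2.
have hB k : (B k <= (C * D)%:E * \sum_(j <oo) (shift_wt b k j)%:E * \int[mu]_y (normc (gj j y) `^ p)%:E)%E.
  have mV j : measurable_fun setT (fun z => (shift_wt b k j)%:E * conv_pow phi p k (gj j) z)%E.
    apply: emeasurable_funM; first exact: measurable_cst.
    exact: measurable_conv_pow.
  have V0 j z : (0 <= (shift_wt b k j)%:E * conv_pow phi p k (gj j) z)%E.
    by rewrite mule_ge0 ?conv_pow_ge0// lee_fin shift_wt_ge0 ?powR_ge0.
  have mS : measurable_fun setT (fun z => \sum_(j <oo) ((shift_wt b k j)%:E * conv_pow phi p k (gj j) z))%E.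
    by apply: (@ge0_emeasurable_sum _ _ _ _ _ xpredT).
  apply: (@le_trans _ _ (\int[mu]_z (C%:E * \sum_(j <oo) ((shift_wt b k j)%:E * conv_pow phi p k (gj j) z)))%E).
    apply: ae_ge0_le_integral => //.
    - by move=> z _; rewrite lee_fin powR_ge0.
    - apply/measurable_EFinP; apply: (measurableT_comp (measurable_powR p)).
      by apply: cmfun_normc; exact: cmfun_conv.
    - by move=> z _; rewrite mule_ge0 ?lee_fin ?(ltW C0)// nneseries_ge0.
    - by apply: emeasurable_funM => //; exact: measurable_cst.
    by apply: filterS (hC k) => z H _.
  rewrite ge0_integralZl_EFin ?(ltW C0)//; last first.
    by move=> z _; exact: nneseries_ge0.
  rewrite integral_nneseries// EFinM -muleA; apply: lee_wpmul2l; first by rewrite lee_fin ltW.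
  rewrite -nneseriesZl; last by move=> j _; rewrite mule_ge0// lee_fin shift_wt_ge0 ?powR_ge0.
  apply: lee_nneseries => [j _ _|j _]; first exact: integral_ge0.
  rewrite ge0_integralZl_EFin ?shift_wt_ge0 ?powR_ge0//; last 2 first.
  - by move=> z _; exact: conv_pow_ge0.
  - exact: measurable_conv_pow.
  rewrite muleCA; apply: lee_wpmul2l; first by rewrite lee_fin shift_wt_ge0 ?powR_ge0.
  exact: hD.
have B0 k : (0 <= B k)%E by apply: integral_ge0 => y _; rewrite lee_fin powR_ge0.
have := discrete_hardy r01 bb1 (mulr_ge0 (ltW C0) (ltW D0)) U0 B0 hB fin => finB.
rewrite /besov_norm Lnorm_counting//; apply: poweR_lty.
apply: le_lt_trans finB; apply: lee_nneseries => [j _ _|k _]; first exact: poweR_ge0.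
have dk : (dist_Lnorm p (dyadic_block phi k (int_functional g)) <= B k `^ p^-1)%E.
  rewrite -cLnormE//; apply: ereal_inf_lbound; exists (conv phi k g) => //.
  exact: rep.
rewrite gee0_abs; last by rewrite mule_ge0 ?dist_Lnorm_ge0// lee_fin powR_ge0.
apply: (@le_trans _ _ (((2 `^ (s * k%:R))%:E * B k `^ p^-1) `^ q)%E).
  apply: ge0_le_poweR; rewrite ?(ltW q0) ?mule_ge0 ?dist_Lnorm_ge0 ?lee_fin ?powR_ge0//.
  by apply: lee_wpmul2l => //; rewrite lee_fin powR_ge0.
rewrite poweRM ?poweR_ge0 ?lee_fin ?powR_ge0// -poweRrM.
rewrite [leRHS]poweRM ?B0 ?lee_fin ?exprn_ge0 ?powR_ge0//.
rewrite (mulrC p^-1); apply: lee_wpmul2r; first exact: poweR_ge0.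
rewrite !poweR_EFin lee_fin le_eqVlt; apply/orP; left; apply/eqP.
(* [b ^+ (2 * k)] is [2^(skp)], and its power [q / p] is [2^(skq)]. *)
rewrite -(powR_mulrn (2 * k) (powR_ge0 _ _)) /b /b1 -!powRrM; congr (2 `^ _).
by rewrite natrM; field; rewrite gt_eqF.
Qed.

End besov_of_series.

(** * Slices *)

Section block_functions.
Variables (R : realType) (n : nat).
Local Notation mu := (lebesgue_rV R n).

Lemma powRD_le2 (q x y : R) : 0 < q -> 0 <= x -> 0 <= y ->
  (x + y) `^ q <= 2 `^ q * (x `^ q + y `^ q).
Proof.
move=> q0 x0 y0; have m0 : 0 <= Num.max x y by rewrite le_max x0.
apply: (@le_trans _ _ ((2 * Num.max x y) `^ q)).
  rewrite ge0_ler_powR ?nnegrE ?(ltW q0) ?addr_ge0 ?mulr_ge0//.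
  by rewrite mulr_natl mulr2n lerD ?le_max ?lexx ?orbT.
rewrite powRM// ler_wpM2l ?powR_ge0//.
by case: (leP x y) => _; rewrite ?lerDl ?lerDr powR_ge0.
Qed.

(** The norm of a block is an infimum over representatives, so a representative is taken whose norm
    exceeds it by less than [2^-j / 2^(sj)]; once weighted, this slack contributes only [2^-j]. No
    uniqueness of representatives is invoked. The scalar [u] will be the inverse of the inversion
    constant. *)
Lemma block_functions (phi : nat -> 'rV[R]_n -> R[i]) (T : functional R n) (s p q : R) (u : R[i]) :
  1 <= q -> q <= p -> (besov_norm phi s p q%:E T < +oo)%E ->
  exists (F : nat -> 'rV[R]_n -> R[i]) (A : nat -> R),
  [/\ forall j, cmfun (F j),
      forall j psi, sch psi -> cintb mu (fun x => F j x * psi x) /\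
        cint mu (fun x => F j x * psi x) = u * dyadic_block phi j T psi,
      forall j, 0 < A j,
      (\sum_(j <oo) (A j `^ (q / p))%:E < +oo)%E &
      forall j, ((((2 `^ (s / 2)) `^ p) ^+ (2 * j))%:E *
        \int[mu]_y (normc (F j y) `^ p)%:E <= (A j)%:E)%E].
Proof.
move=> q1 qp; have q0 : 0 < q := lt_le_trans ltr01 q1.
have p1 : 1 <= p := le_trans q1 qp; have p0 : 0 < p := lt_le_trans ltr01 p1.
pose D j := dist_Lnorm p (dyadic_block phi j T).
have D0 j : (0 <= D j)%E := dist_Lnorm_ge0 p _.
pose S j : R := 2 `^ (s * j%:R).
have S0 j : 0 < S j by rewrite powR_gt0.
rewrite /besov_norm Lnorm_counting// => /lty_poweRy.
rewrite invr_eq0 gt_eqF// => /(_ isT) fin.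
have {}fin : (\sum_(j <oo) ((S j)%:E * D j) `^ q < +oo)%E.
  apply: le_lt_trans fin; apply: lee_nneseries => [j _ _|j _]; first exact: poweR_ge0.
  rewrite gee0_abs//; apply: mule_ge0; last exact: D0.
  by rewrite lee_fin powR_ge0.
have Dfin j : D j \is a fin_num.
  rewrite ge0_fin_numE//.
  have : (((S j)%:E * D j) `^ q < +oo)%E.
    by apply: le_lt_trans (le_term_nneseries _ _) fin => k; exact: poweR_ge0.
  move=> /lty_poweRy; rewrite gt_eqF// => /(_ isT).
  case: (D j) (D0 j) => [d _ _|_|//]; first exact: ltry.
  by rewrite gt0_muley ?lte_fin.
pose d j := fine (D j).
have d0 j : 0 <= d j by exact: fine_ge0.
pose nn j := d j + 2^-1 ^+ j / S j.
have nn0 j : 0 < nn j by rewrite ltr_wpDl// divr_gt0 ?exprn_gt0.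
have /choice[F HF] : forall j, exists h : 'rV[R]_n -> R[i],
    represents h (dyadic_block phi j T) /\ (cLnorm p h < (nn j)%:E)%E.
  move=> j; have : (D j < (nn j)%:E)%E.
    by rewrite -(fineK (Dfin j)) lte_fin /nn ltrDl divr_gt0// exprn_gt0.
  by move=> /ereal_inf_lt[_ [h rh <-] hn]; exists h.
have IF j : (\int[mu]_y (normc (F j y) `^ p)%:E <= (nn j `^ p)%:E)%E.
  have [_] := HF j; rewrite cLnormE// => /ltW h.
  have I0 : (0 <= \int[mu]_y (normc (F j y) `^ p)%:E)%E.
    by apply: integral_ge0 => y _; rewrite lee_fin powR_ge0.
  rewrite -[leLHS]poweRe1// -(mulVf (lt0r_neq0 p0)) poweRrM -poweR_EFin.
  by apply: ge0_le_poweR; rewrite ?(ltW p0) ?poweR_ge0.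
pose b := (2 `^ (s / 2)) `^ p.
(* The [+ 1] keeps [A j] positive whatever [u] is. *)
pose kap := normc u `^ p + 1.
have kap0 : 0 < kap by rewrite ltr_wpDl ?powR_ge0.
have bq j : (b ^+ (2 * j)) = S j `^ p.
  rewrite -(powR_mulrn (2 * j) (powR_ge0 _ _)) /b /S -!powRrM; congr (2 `^ _).
  by rewrite natrM; field.
have b0 j : 0 < b ^+ (2 * j) by rewrite bq powR_gt0.
exists (fun j x => u * F j x), (fun j => kap * (b ^+ (2 * j) * nn j `^ p)); split.
- move=> j; apply: cmfunM; first exact: cmfun_cst.
  by have [[]] := HF j.
- move=> j psi sp; have [[_ hr] _] := HF j; have [h1 h2] := hr psi ((schP psi).2 sp).
  rewrite (_ : (fun x => u * F j x * psi x) = fun x => u * (F j x * psi x)); last first.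
    by apply/funext => x; rewrite mulrA.
  split; first exact: cintbZ.
  by rewrite cintZ// h2.
- by move=> j; rewrite !mulr_gt0 ?powR_gt0.
- apply: (@le_lt_trans _ _ ((kap `^ (q / p) * 2 `^ q)%:E *
    (\sum_(j <oo) (((S j)%:E * D j) `^ q + ((2^-1 `^ q) ^+ j)%:E)))%E).
    rewrite -nneseriesZl; last by move=> j _; rewrite adde_ge0 ?poweR_ge0// lee_fin exprn_ge0 ?powR_ge0.
    apply: lee_nneseries => [j _ _|j _]; first by rewrite lee_fin powR_ge0.
    have -> : (((S j)%:E * D j) `^ q = ((S j * d j) `^ q)%:E)%E.
      by rewrite -poweR_EFin EFinM /d fineK.
    rewrite -EFinD -EFinM lee_fin.
    rewrite bq -powRM ?(ltW (S0 j)) ?(ltW (nn0 j))//.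
    rewrite powRM ?(ltW kap0) ?powR_ge0// -powRrM mulrCA divff ?gt_eqF// mulr1 -mulrA.
    rewrite ler_wpM2l ?powR_ge0//.
    have -> : S j * nn j = S j * d j + 2^-1 ^+ j.
      by rewrite /nn mulrDr mulrCA divff ?mulr1// gt_eqF.
    have -> : (2^-1 `^ q) ^+ j = (2^-1 ^+ j) `^ q.
      by rewrite -(powR_mulrn j (powR_ge0 _ _)) -powRrM mulrC powRrM powR_mulrn.
    by apply: powRD_le2; rewrite ?mulr_ge0 ?exprn_ge0 ?(ltW (S0 j)).
  apply: lte_mul_pinfty; rewrite ?lee_fin ?mulr_ge0 ?powR_ge0//.
  rewrite nneseriesD; last 2 first.
  - by move=> j _ _; exact: poweR_ge0.
  - by move=> j _ _; rewrite lee_fin exprn_ge0 ?powR_ge0.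
  apply: lte_add_pinfty => //.
  have x01 : 0 <= (2^-1 `^ q : R) < 1.
    have e : 1 `^ q = 1 :> R by rewrite powR1.
    by rewrite powR_ge0/= -[ltRHS]e gt0_ltr_powR ?nnegrE// invf_lt1 ?ltr1n.
  apply: le_lt_trans (_ : ((1 - 2^-1 `^ q)^-1)%:E < _)%E; last exact: ltry.
  apply: le_trans (shift_wt_sumr 1 x01); apply: lee_nneseries => [j _ _|j _].
    by rewrite lee_fin exprn_ge0 ?powR_ge0.
  by rewrite /shift_wt/= subn1.
- move=> j.
  have -> : (\int[mu]_y (normc (u * F j y) `^ p)%:E =
      (normc u `^ p)%:E * \int[mu]_y (normc (F j y) `^ p)%:E)%E.
    rewrite -ge0_integralZl_EFin ?powR_ge0//.
    + by apply: eq_integral => y _; rewrite normcM powRM ?normc_ge0.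
    + by move=> y _; rewrite lee_fin powR_ge0.
    + apply/measurable_EFinP; apply: (measurableT_comp (measurable_powR p)).
      by apply: cmfun_normc; have [[]] := HF j.
  rewrite muleCA EFinM; apply: lee_pmul.
  + by rewrite lee_fin powR_ge0.
  + rewrite mule_ge0 ?lee_fin ?(ltW (b0 j))//.
    by apply: integral_ge0 => y _; rewrite lee_fin powR_ge0.
  + by rewrite lee_fin lerDl.
  + by rewrite EFinM; apply: lee_wpmul2l => //; rewrite lee_fin ltW.
Qed.

End block_functions.

(** * Two-dimensional blocks tested on tensor products *)

Section slice2.
Variables (R : realType) (phi2 : nat -> 'rV[R]_2 -> R[i]) (phi1 : nat -> 'rV[R]_1 -> R[i]).
Hypotheses (hphi2 : dyadic_resolution phi2) (hphi1 : dyadic_resolution phi1).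
Local Notation leb := (@lebesgue_measure R).
Local Notation mu1 := (lebesgue_rV R 1).
Local Notation mu2 := (lebesgue_rV R 2).
Variable T : functional R 2.
Hypothesis hT : tempered T.

Let c1 : R[i] := cint mu1 (Fs 1 (phi1 0%N)).
(** The factor by which [fourier] after [ifourier] multiplies tensor products: [c1] from each
    variable, and the normalization of [ifourier] in dimension 2. It is left unevaluated. *)
Definition inv_const : R[i] := ((2 * pi) ^- 2)%:C * (c1 * c1).

Lemma inv_const_neq0 : inv_const != 0.
Proof.
have c10 : c1 != 0.
  by apply: inversion_constant_neq0 => //; [exact: dyadic_sch|exact: dyadic00].
rewrite !mulf_neq0// -normc_eq0 normc_real normr_eq0 invr_eq0 expf_neq0// mulf_neq0//.
by rewrite gt_eqF// pi_gt0.
Qed.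

Lemma Fs_invol (a : 'rV[R]_1 -> R[i]) : sch a -> Fs (-1) (Fs 1 a) = fun y => c1 * a y.
Proof.
move=> sa; apply/funext => y.
by rewrite (@Fs_inversion _ _ (phi1 0%N))//; [exact: dyadic_sch|exact: dyadic00].
Qed.

(** [tempered_dyadic_sum] for [g = ifourier (tens a b)]; on tensor products the two-dimensional
    inversion reduces to the one-dimensional formula. *)
Lemma dyadic_block_sum a b : sch a -> sch b -> forall e, 0 < e ->
  \forall J \near \oo, normc (\sum_(j < J.+1) dyadic_block phi2 j T (tens a b) -
    inv_const * T (tens a b)) <= e.
Proof.
move=> sa sb e e0.
have st := sch_tens sa sb.
have s1 : sch (Fs 1 (tens a b)) by apply: sch_Fs => //; exact: oner_neq0.
have sg : sch (ifourier (tens a b)) by rewrite ifourierE; exact: schZ.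
have e1 : T (Fs (-1) (ifourier (tens a b))) = inv_const * T (tens a b).
  rewrite -temperedZ//; congr (T _); apply/funext => xi.
  rewrite ifourierE FsZ; last exact: cintb_sch.
  rewrite Fs_tens// Fs_tens ?Fs_invol//; [|by apply: sch_Fs => //; exact: oner_neq0..].
  by rewrite /tens /inv_const; ring.
apply: filterS (tempered_dyadic_sum hphi2 hT sg e0) => J; rewrite e1.
suff -> : \sum_(j < J.+1) dyadic_block phi2 j T (tens a b) =
  \sum_(j < J.+1) T (Fs (-1) (fun x => phi2 j x * ifourier (tens a b) x)) by [].
by apply: eq_bigr => j _; rewrite /dyadic_block /dist_ifourier /dist_mul /dist_fourier fourierE.
Qed.

(** On the Fourier side the test function carries the factor [phi1 k] in the second frequency
    [xi_2], which requires [|xi_2| >= 2^(k-1) >= 2^(j+1)], whereas [phi2 j] requires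
    [|xi| < 2^(j+1)]. *)
Lemma dyadic_block_tens_eq0 j k a psi : (j.+2 <= k)%N -> sch a -> sch psi ->
  dyadic_block phi2 j T (tens a (Pblock phi1 k psi)) = 0.
Proof.
move=> jk sa sp.
have s1 : sch (Fs 1 a) by apply: sch_Fs => //; exact: oner_neq0.
pose v := fun x => ((2 * pi) ^- 1)%:C * (phi1 k x * Fs 1 psi x).
have sv : sch v.
  apply: schZ; apply: schM; first exact: dyadic_sch.
  by apply: sch_Fs => //; exact: oner_neq0.
have FP : Fs 1 (Pblock phi1 k psi) = fun y => cint mu1 (Fs (-1) (phi1 0%N)) * v y.
  rewrite PblockE; apply/funext => y.
  have := @Fs_inversion R (-1) (phi1 0%N) v y; rewrite opprK; apply.
  - by rewrite oppr_eq0 oner_neq0.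
  - exact: dyadic_sch.
  - exact: dyadic00.
  - exact: sv.
rewrite /dyadic_block /dist_ifourier /dist_mul /dist_fourier.
rewrite (_ : (fun x => _) = fun=> 0); last first.
  apply/funext => xi; rewrite ifourierE Fs_tens//; last exact: sch_Pblock.
  rewrite /tens FP /v.
  have [->|p2] := eqVneq (phi2 j xi) 0; first by rewrite mul0r.
  suff -> : phi1 k (rV1 (xi ord0 i1)) = 0 by rewrite !mul0r !mulr0.
  apply/eqP; apply: contraT => p1.
  case: k jk p1 {v sv FP} => // k jk /(dyadic_suppS hphi1)/andP[h1 _].
  have := dyadic_supp hphi2 p2; rewrite euclid_norm1 rV1E in h1.
  have h3 := coord_le_euclid xi i1.
  move=> h2; have : (2 : R) ^+ k < 2 ^+ j.+1 by apply: le_lt_trans h1 _; exact: le_lt_trans h3 h2.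
  by rewrite ltr_eXn2l ?ltr1n// => h4; move: jk; rewrite ltnS ltnNge -ltnS h4.
rewrite fourierE (_ : Fs _ _ = fun=> 0); first exact: tempered0.
apply/funext => xi; rewrite /Fs -[RHS](@cint0 _ _ _ mu2); apply: eq_cint => x.
by rewrite mulr0.
Qed.

End slice2.

(** The weighted sum is finite almost everywhere because its integral is, and the weight is positive
    at every point. *)
Lemma ae_series_finite (R : realType) n (gj : nat -> 'rV[R]_n -> R[i]) : (forall j, cmfun (gj j)) ->
  (\int[lebesgue_rV R n]_y \sum_(j <oo) (normc (gj j y) * wt y)%:E < +oo)%E ->
  {ae lebesgue_rV R n, forall y, (\sum_(j <oo) (normc (gj j y))%:E < +oo)%E}.
Proof.
move=> mgj dom; set mu := lebesgue_rV R n.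
pose D y : \bar R := (\sum_(j <oo) (normc (gj j y) * wt y)%:E)%E.
have D0 y : (0 <= D y)%E by apply: nneseries_ge0 => j _ _; rewrite lee_fin mulr_ge0 ?normc_ge0 ?wt_ge0.
have mD : measurable_fun setT D.
  apply: (@ge0_emeasurable_sum _ _ _ _ _ xpredT) => [j y _ _|j _].
    by rewrite lee_fin mulr_ge0 ?normc_ge0 ?wt_ge0.
  apply/measurable_EFinP; apply: measurable_funM; last exact: measurable_wt.
  exact: cmfun_normc.
have iD : mu.-integrable setT D.
  by apply/integrableP; split => //; rewrite (eq_integral D)// => y _; rewrite gee0_abs.
have := integrable_ae measurableT iD; apply: filterS => y /(_ I).
have -> : D y = ((wt y)%:E * \sum_(j <oo) (normc (gj j y))%:E)%E.
  rewrite -nneseriesZl; last by move=> j _; rewrite lee_fin normc_ge0.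
  by apply: eq_eseriesr => j _; rewrite -EFinM mulrC.
rewrite ltNge leye_eq => h; apply/negP => /eqP e; move: h.
by rewrite e gt0_muley// lte_fin wt_gt0.
Qed.

(** * Finiteness of the weighted sums on almost every slice *)

Section slice_powers.
Variable R : realType.
Local Notation leb := (@lebesgue_measure R).
Local Notation mu1 := (lebesgue_rV R 1).
Local Notation mu2 := (lebesgue_rV R 2).

Lemma poweR_le_affine (r A : R) (t : \bar R) : 0 < r <= 1 -> 0 < A -> (0 <= t)%E ->
  (t `^ r <= (A `^ r)%:E * (1 + (A^-1)%:E * t))%E.
Proof.
move=> r01 A0; have [r0 _] := andP r01; case: t => [t t0|_|//].
  apply: (@le_trans _ _ (A `^ r * (1 + t / A))%:E).
    by rewrite poweR_EFin lee_fin; exact: powR_le_affine.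
  by rewrite EFinM (mulrC t) EFinD EFinM.
by rewrite gt0_muley ?lte_fin ?invr_gt0// addey// gt0_muley ?leey// lte_fin powR_gt0.
Qed.

Lemma slice_powers_finite (p r : R) (F : nat -> 'rV[R]_2 -> R[i]) (A K : nat -> R) :
  0 < r <= 1 -> (forall j, cmfun (F j)) -> (forall j, 0 < A j) -> (forall j, 0 <= K j) ->
  (\sum_(j <oo) (A j `^ r)%:E < +oo)%E ->
  (forall j, ((K j)%:E * \int[mu2]_z (normc (F j z) `^ p)%:E <= (A j)%:E)%E) ->
  {ae leb, forall x, (\sum_(j <oo)
    ((K j)%:E * \int[mu1]_y (normc (F j (rV_cons (x, y))) `^ p)%:E) `^ r < +oo)%E}.
Proof.
move=> r01 mF A0 K0 As AF; have [r0 r1] := andP r01.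
pose V j (x : measurableTypeR R) : \bar R :=
  ((K j)%:E * \int[mu1]_y (normc (F j (rV_cons (x, y))) `^ p)%:E)%E.
have V0 j x : (0 <= V j x)%E.
  by rewrite mule_ge0 ?lee_fin// integral_ge0// => y _; rewrite lee_fin powR_ge0.
have mFp j : measurable_fun setT (fun z => (normc (F j z) `^ p)%:E).
  by apply/measurable_EFinP; apply: (measurableT_comp (measurable_powR p)); exact: cmfun_normc.
have F0 j (z : 'rV[R]_2) : (0 <= (normc (F j z) `^ p)%:E)%E by rewrite lee_fin powR_ge0.
have mFc j : measurable_fun setT (fun z : measurableTypeR R * 'rV[R]_1 =>
    (normc (F j (rV_cons z)) `^ p)%:E).
  exact: (measurableT_comp (mFp j) (@measurable_rV_cons R 1)).
have mI j := @measurable_fun_fubini_tonelli_F _ _ _ _ R mu1 _ (mFc j) (fun z => F0 j (rV_cons z)).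
have mV (j : nat) : measurable_fun setT (V j) by apply: measurable_funeM; exact: mI.
have iV j : (\int[leb]_x V j x <= (A j)%:E)%E.
  apply: le_trans (AF j); rewrite ge0_integralZl_EFin//; last 2 first.
  - by move=> x _; apply: integral_ge0 => y _.
  - exact: mI.
  apply: lee_wpmul2l; first by rewrite lee_fin.
  rewrite (ge0_integral_image (@measurable_rV_cons R 1) (@mu2E R) (mFp j) (F0 j)).
  by rewrite (@fubini_tonelli1 _ _ _ _ R leb mu1 _ (mFc j) (fun z => F0 j (rV_cons z))).
pose w (x : measurableTypeR R) : R := (1 + x ^+ 2)^-1.
have w0 x : 0 < w x by rewrite invr_gt0 ltr_pwDl// sqr_ge0.
have w1 x : w x <= 1 by rewrite invf_le1 ?lerDl ?sqr_ge0// ltr_pwDl// sqr_ge0.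
have mw : measurable_fun setT w by apply: continuous_measurable_fun; exact: continuous_oneDsqrV.
pose W := fine (\int[leb]_x (w x)%:E)%E.
have WE : (\int[leb]_x (w x)%:E)%E = W%:E.
  rewrite fineK// ge0_fin_numE ?integral_oneDsqrV//.
  by apply: integral_ge0 => x _; rewrite lee_fin ltW.
have W0 : 0 <= W by apply: fine_ge0; apply: integral_ge0 => x _; rewrite lee_fin ltW.
have T0 j x : (0 <= (w x)%:E * V j x `^ r)%E by rewrite mule_ge0 ?poweR_ge0// lee_fin ltW.
have mT j : measurable_fun setT (fun x => ((w x)%:E * V j x `^ r)%E).
  apply: emeasurable_funM; first exact/measurable_EFinP.
  exact: (measurableT_comp (measurable_poweR r)).
have AV0 j x : (0 <= ((A j)^-1)%:E * V j x)%E by rewrite mule_ge0// lee_fin invr_ge0 ltW.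
have iT : (\int[leb]_x \sum_(j <oo) ((w x)%:E * V j x `^ r) < +oo)%E.
  rewrite integral_nneseries//.
  (* [W] comes from the constant term of [poweR_le_affine], the other 1 from the integral of
     [V j / A j], where [w <= 1] is used. *)
  apply: (@le_lt_trans _ _ ((W + 1)%:E * \sum_(j <oo) (A j `^ r)%:E)%E); last first.
    by apply: lte_mul_pinfty => //; rewrite lee_fin addr_ge0.
  rewrite -nneseriesZl; last by move=> j _; rewrite lee_fin powR_ge0.
  apply: lee_nneseries => [j _ _|j _]; first exact: integral_ge0.
  apply: (@le_trans _ _ (\int[leb]_x ((A j `^ r)%:E * ((w x)%:E + ((A j)^-1)%:E * V j x)))%E).
    have mR : measurable_fun setT (fun x => ((w x)%:E + ((A j)^-1)%:E * V j x)%E).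
      apply: emeasurable_funD; first exact/measurable_EFinP.
      exact: measurable_funeM.
    apply: ge0_le_integral => //.
    - exact: measurable_funeM.
    move=> x _; apply: le_trans (lee_wpmul2l _ (poweR_le_affine r01 (A0 j) (V0 j x))) _.
      by rewrite lee_fin ltW.
    rewrite muleCA; apply: lee_wpmul2l; first by rewrite lee_fin powR_ge0.
    rewrite (ge0_muleDr _ _ (AV0 j x)) ?lee01// mule1.
    apply: leeD2l; rewrite -[leRHS]mul1e; apply: lee_wpmul2r; last by rewrite lee_fin.
    exact: AV0.
  have mAV : measurable_fun setT (fun x => ((A j)^-1)%:E * V j x)%E.
    exact: measurable_funeM.
  rewrite ge0_integralZl_EFin ?powR_ge0//; last 2 first.
  - by move=> x _; rewrite adde_ge0 ?lee_fin ?(ltW (w0 _)).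
  - by apply: emeasurable_funD => //; exact/measurable_EFinP.
  rewrite muleC; apply: lee_wpmul2r; first by rewrite lee_fin powR_ge0.
  rewrite ge0_integralD//; last 2 first.
  - by move=> x _; rewrite lee_fin ltW.
  - exact/measurable_EFinP.
  rewrite WE EFinD; apply: leeD2l.
  rewrite ge0_integralZl_EFin ?invr_ge0 ?(ltW (A0 j))//.
  by rewrite lee_pdivrMl// mule1.
pose h (x : measurableTypeR R) := (\sum_(j <oo) ((w x)%:E * V j x `^ r))%E.
have h0 x : (0 <= h x)%E by exact: nneseries_ge0.
have mh : measurable_fun setT h by apply: (@ge0_emeasurable_sum _ _ _ _ _ xpredT).
have ih : leb.-integrable setT h.
  by apply/integrableP; split => //; rewrite (eq_integral h)// => y _; rewrite gee0_abs.
have := integrable_ae measurableT ih.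
apply: (@filterS _ _ (ae_filter_ringOfSetsType leb)) => x /(_ I).
rewrite /h nneseriesZl; last by move=> j _; exact: poweR_ge0.
rewrite ltNge leye_eq => hx; apply/negP => /eqP e; move: hx.
by rewrite e gt0_muley// lte_fin w0.
Qed.

End slice_powers.

(** * Identification of almost every slice *)

Section slice_limit.
Variables (R : realType) (phi2 : nat -> 'rV[R]_2 -> R[i]) (phi1 : nat -> 'rV[R]_1 -> R[i]).
Hypotheses (hphi2 : dyadic_resolution phi2) (hphi1 : dyadic_resolution phi1).
Local Notation leb := (@lebesgue_measure R).
Local Notation mu1 := (lebesgue_rV R 1).
Local Notation mu2 := (lebesgue_rV R 2).
Variables (T : functional R 2) (f : 'rV[R]_2 -> R[i]) (F : nat -> 'rV[R]_2 -> R[i]).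
Hypotheses (hT : tempered T) (rf : represents f T) (mF : forall j, cmfun (F j)).
Hypothesis rF : forall j psi, sch psi -> cintb mu2 (fun x => F j x * psi x) /\
  cint mu2 (fun x => F j x * psi x) = (inv_const phi1)^-1 * dyadic_block phi2 j T psi.

Lemma cint_tens (h : 'rV[R]_2 -> R[i]) a b :
  cintb mu2 (fun z => h z * tens a b z) ->
  cintb (leb \x mu1)%E (fun z => h (rV_cons z) * (a (rV1 z.1) * b z.2)) /\
  cint (leb \x mu1)%E (fun z => h (rV_cons z) * (a (rV1 z.1) * b z.2)) =
    cint mu2 (fun z => h z * tens a b z).
Proof.
move=> ih; have mh := cintb_cmfun ih.
rewrite (_ : (fun z : measurableTypeR R * 'rV[R]_1 => h (rV_cons z) * (a (rV1 z.1) * b z.2)) =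
    fun z => (fun z => h z * tens a b z) (rV_cons z)); last first.
  by apply/funext => -[x y]; rewrite tens_cons.
by split; [exact: (cintb_mu2 mh).1|rewrite -(cint_mu2 mh)].
Qed.

(** The [j]-th block vanishes on [tens a (Pblock phi1 k psi)] for every [a], which is what
    [slice_cint_eq0] asks for. *)
Lemma ae_slice_block_eq0 j k psi : (j.+2 <= k)%N -> sch psi ->
  {ae leb, forall x, cint mu1 (fun y => F j (rV_cons (x, y)) * Pblock phi1 k psi y) = 0}.
Proof.
move=> jk sp.
have := slice_cint_eq0 hphi1 (g := fun z => F j (rV_cons z)) (b := Pblock phi1 k psi).
move=> H; apply: (@filterS _ _ (ae_filter_ringOfSetsType leb) _ _ _ (H _)) => [x []//|a sa].
have sP := sch_Pblock hphi1 k sp.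
have [h1 h2] := rF j (sch_tens sa sP).
have [h3 h4] := cint_tens h1; split=> //.
by rewrite h4 h2 (dyadic_block_tens_eq0 hphi2 hphi1 hT jk sa sp) mulr0.
Qed.

(** Tested on [tens a b], both [f] and [G] give the limit of the same sums of pairings with the
    [F j]: [G] by dominated convergence, [f] because it represents [T], which is the sum of its
    blocks. All tensor products thus annihilate [f - G], and [slice_eq0_of_tens] passes to
    slices. *)
Lemma ae_slice_series_limit (G : 'rV[R]_2 -> R[i]) : cmfun G -> (forall j, wtb (F j)) ->
  (\int[mu2]_y \sum_(j <oo) (normc (F j y) * wt y)%:E < +oo)%E ->
  {ae mu2, forall y, forall e, 0 < e -> \forall N \near \oo, normc (\sum_(j < N) F j y - G y) <= e} ->
  {ae leb, forall x, {ae mu1, forall y, f (rV_cons (x, y)) = G (rV_cons (x, y))}}.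
Proof.
move=> mG wF dom lim; have [mf rf'] := rf.
have c0 := inv_const_neq0 hphi1.
have eq0 a b : sch a -> sch b -> cintb mu2 (fun z => (f z - G z) * tens a b z) /\
    cint mu2 (fun z => (f z - G z) * tens a b z) = 0.
  move=> sa sb; have st := sch_tens sa sb; have [C _ hC] := sch_wt st.
  have [iG limG] := series_cint_limit mG wF dom lim (cmfun_sch st) hC.
  have [fI fE] := rf' _ ((schP _).2 st).
  have -> : (fun z => (f z - G z) * tens a b z) = fun z => f z * tens a b z - G z * tens a b z.
    by apply/funext => z; rewrite mulrBl.
  split; first exact: cintbB.
  rewrite cintB//; apply/eqP; rewrite subr_eq0; apply/eqP.
  transitivity (T (tens a b)); first by rewrite fE.
  apply: (@normc_lim_unique _ (fun J => \sum_(j < J.+1) cint mu2 (fun y => F j y * tens a b y))).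
    move=> e e0; pose w := (inv_const phi1)^-1.
    have e0' : 0 < e / (normc w + 1) by rewrite divr_gt0// ltr_wpDl ?normc_ge0.
    apply: filterS (dyadic_block_sum hphi2 hphi1 hT sa sb e0') => J HJ.
    rewrite (_ : _ - _ = (\sum_(j < J.+1) dyadic_block phi2 j T (tens a b) -
      inv_const phi1 * T (tens a b)) * w); last first.
      rewrite mulrBl mulr_suml mulrAC mulfV// mul1r; congr (_ - _).
      by apply: eq_bigr => j _; rewrite (rF j st).2 mulrC.
    by rewrite -[leRHS]mulr1; apply: normc_le_div; rewrite ?(ltW e0)// mulr1.
  (* [limG] concerns sums of [N] terms, the dyadic sums have [J + 1] terms. *)
  move=> e e0; have [N _ HN] := limG e e0; exists N => // J /= NJ.
  by apply: HN; exact: leqW.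
have mg : cmfun (fun z : measurableTypeR R * 'rV[R]_1 => f (rV_cons z) - G (rV_cons z)).
  by apply: (cmfun_comp (cmfunB mf mG)); exact: measurable_rV_cons.
apply: (@filterS _ _ (ae_filter_ringOfSetsType leb) _ _ _ (slice_eq0_of_tens hphi1 mg _)) => [x|a b sa sb]; last first.
  have [h1 h2] := eq0 a b sa sb.
  by have [h3 h4] := cint_tens h1; split=> //; rewrite h4.
by apply: filterS => y /eqP; rewrite subr_eq0 => /eqP.
Qed.

End slice_limit.

Theorem proposition6p10 (R : realType)
    (phi2 : nat -> 'rV[R]_2 -> R[i]) (phi1 : nat -> 'rV[R]_1 -> R[i])
    (hphi2 : dyadic_resolution phi2) (hphi1 : dyadic_resolution phi1)
    (s p q : R) (hs : 0 < s) (hq : 1 <= q) (hqp : q <= p)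
    (f : 'rV[R]_2 -> R[i]) (hf : besov_fun phi2 s p q%:E f) :
  {ae lebesgue_measure, forall x : R, besov_fun phi1 s p q%:E (slice f x)}.
Proof.
have p1 := le_trans hq hqp; have p0 : 0 < p := lt_le_trans ltr01 p1.
have q0 : 0 < q := lt_le_trans ltr01 hq.
have r01 : 0 < q / p <= 1 by rewrite divr_gt0//= ler_pdivrMr// mul1r.
have [r0 _] := andP r01.
have [T [rf [hT bT]]] := hf; have [mf _] := rf.
have [F [A [mF rF A0 As AF]]] := block_functions (inv_const phi1)^-1 hq hqp bT.
(* The test functions are fixed before [x], so that the vanishing of all the pairings below costs
   only a countable union of null sets. *)
have [e [se _ He]] := separating_test_functions hphi1.
set b := (2 `^ (s / 2)) `^ p in AF.
have b1 : 1 < b.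
  by apply: powR_gt1 => //; apply: powR_gt1; rewrite ?ltr1n// divr_gt0.
have b0 j : 0 <= b ^+ (2 * j) by rewrite exprn_ge0// ltW// (lt_trans ltr01).
have U0 n (h : 'rV[R]_n -> R[i]) : (0 <= \int[lebesgue_rV R n]_y (normc (h y) `^ p)%:E)%E.
  by apply: integral_ge0 => y _; rewrite lee_fin powR_ge0.
have fin : (\sum_(j <oo) ((b ^+ (2 * j))%:E *
    \int[lebesgue_rV R 2]_y (normc (F j y) `^ p)%:E) `^ (q / p) < +oo)%E.
  apply: le_lt_trans As; apply: lee_nneseries => [j _ _|j _]; first exact: poweR_ge0.
  rewrite -poweR_EFin; apply: ge0_le_poweR; rewrite ?(ltW r0)//.
  by rewrite mule_ge0 ?lee_fin.
have [c [c0 cs cU]] := summable_norm_bounds b1 p1 r0 (fun j => U0 2%N (F j)) fin.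
have dom := wtb_series p1 c0 cs mF cU.
have wF j : wtb (F j).
  split => //; apply: le_lt_trans (integral_normc_wt_le p1 (c0 j) (mF j) (cU j)) _.
  by rewrite ltry.
(* [G] is the sum of the [F j] at every point of absolute convergence, whereas [f] is linked to them
   only through [T]. *)
have [G mG limG] := cmfun_series_limit mF.
have lim : {ae lebesgue_rV R 2, forall y, forall e, 0 < e ->
    \forall N \near \oo, normc (\sum_(j < N) F j y - G y) <= e}.
  by apply: filterS (ae_series_finite mF dom) => y; exact: limG.
have ae1 := ae_slice_series_limit hphi2 hphi1 hT rf rF mG wF dom lim.
have ae2 : {ae lebesgue_measure, forall x : measurableTypeR R, forall j k l, (j.+2 <= k)%N ->
    cint (lebesgue_rV R 1) (fun y => F j (rV_cons (x, y)) * Pblock phi1 k (e l) y) = 0}.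
  apply/ae_foralln => j; apply/ae_foralln => k; apply/ae_foralln => l.
  have [jk|_] := leqP j.+2 k; last exact: nearW.
  have := ae_slice_block_eq0 hphi2 hphi1 hT rF jk (se l).
  by apply: (@filterS _ _ (ae_filter_ringOfSetsType _)) => x h _.
have ae3 := slice_powers_finite r01 mF A0 b0 As AF.
apply: (@filterS3 _ _ (ae_filter_ringOfSetsType _) _ _ _ _ _ ae1 ae2 ae3) => x fG zero finx.
have mp : measurable_fun setT (fun y : 'rV[R]_1 => rV_cons (x : measurableTypeR R, y)).
  exact: (measurableT_comp (@measurable_rV_cons R 1) (pair1_measurable _)).
have mFx j : cmfun (fun y => F j (rV_cons (x, y))) by exact: (cmfun_comp (mF j) mp).
(* The norm bounds are derived again on the slice, from [finx]. They give absolute convergence for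
   almost every [y], hence convergence to the slice of [G], without transferring a null set of the
   plane to the slice. *)
have [cx [cx0 cxs cxU]] := summable_norm_bounds b1 p1 r0 (fun j => U0 1%N _) finx.
have aefin := ae_series_finite mFx (wtb_series p1 cx0 cxs mFx cxU).
apply: (besov_fun_of_series hphi1 hs hq hqp (gj := fun j y => F j (rV_cons (x, y)))) => //.
- exact: (cmfun_comp mf mp).
- by apply: filterS2 fG aefin => y fGy fy; rewrite /slice fGy; exact: limG.
- move=> j k jk wj; apply: (conv_eq0 hphi1 se He wj) => l.
  exact: zero.
Qed.
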